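(* For $\tau\in\mathbb{H}^2$ let $q=e^{2\pi i\tau}$ and $$W=\theta^4\begin{bmatrix}1\\ \frac13\end{bmatrix}(0,\tau)\Big/\theta^4\begin{bmatrix}1\\ \frac23\end{bmatrix}(0,\tau).$$ Then $$W=\left\{\sqrt3\,\frac{(q^2;q^2)_\infty(q^3;q^3)_\infty^2}{(q;q)_\infty^2(q^6;q^6)_\infty}\right\}^4,$$ and $W$ satisfies the Riccati equation $$q\frac{dW}{dq}=\frac1{2^3}\left\{\frac{(q;q)_\infty^2(q^3;q^3)_\infty^2}{(q^2;q^2)_\infty(q^6;q^6)_\infty}\right\}^2\left(W^2-10W+9\right).$$
   Context: $\mathbb{H}^2$ is the upper half-plane. For $\epsilon,\epsilon'\in\mathbb{R}$, $\theta\begin{bmatrix}\epsilon\\ \epsilon'\end{bmatrix}(\zeta,\tau)=\sum_{n\in\mathbb{Z}}\exp\!\Big(2\pi i\Big[\tfrac12\big(n+\tfrac{\epsilon}{2}\big)^2\tau+\big(n+\tfrac{\epsilon}{2}\big)\big(\zeta+\tfrac{\epsilon'}{2}\big)\Big]\Big)$; $\theta^k$ is the $k$-th power. $(q^k;q^k)_\infty=\prod_{n\ge1}(1-q^{kn})$. The derivative $q\,d/dq$ is understood as $\frac{1}{2\pi i}\frac{d}{d\tau}$. *)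

(* Defs.v *)
From Stdlib Require Import Reals ClassicalEpsilon.
Open Scope R_scope.

Definition Cplx : Type := (R * R)%type.
Definition RtoC (x : R) : Cplx := (x, 0).
Definition Re (z : Cplx) : R := fst z.
Definition Im (z : Cplx) : R := snd z.
Definition C0 : Cplx := (0, 0).
Definition C1 : Cplx := (1, 0).
Definition Ci : Cplx := (0, 1).
Definition Cadd (z w : Cplx) : Cplx := (fst z + fst w, snd z + snd w).
Definition Copp (z : Cplx) : Cplx := (- fst z, - snd z).
Definition Csub (z w : Cplx) : Cplx := Cadd z (Copp w).
Definition Cmul (z w : Cplx) : Cplx :=
  (fst z * fst w - snd z * snd w, fst z * snd w + snd z * fst w).
Definition Cinv (z : Cplx) : Cplx :=
  (fst z / (fst z ^ 2 + snd z ^ 2), - snd z / (fst z ^ 2 + snd z ^ 2)).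
Definition Cdiv (z w : Cplx) : Cplx := Cmul z (Cinv w).
Fixpoint Cpow (z : Cplx) (n : nat) : Cplx :=
  match n with O => C1 | S m => Cmul z (Cpow z m) end.
Definition Cnorm (z : Cplx) : R := sqrt (fst z ^ 2 + snd z ^ 2).
Definition Cexp (z : Cplx) : Cplx := (exp (fst z) * cos (snd z), exp (fst z) * sin (snd z)).

Definition Cseq_cv (u : nat -> Cplx) (l : Cplx) : Prop :=
  forall eps : R, eps > 0 -> exists N : nat, forall n : nat, (n >= N)%nat ->
    Cnorm (Csub (u n) l) < eps.

Definition Clim (u : nat -> Cplx) : Cplx :=
  epsilon (inhabits C0) (fun l => Cseq_cv u l).

Definition C_derivable_lim (f : Cplx -> Cplx) (z l : Cplx) : Prop :=
  forall eps : R, eps > 0 -> exists delta : R, delta > 0 /\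
    forall h : Cplx, 0 < Cnorm h -> Cnorm h < delta ->
      Cnorm (Csub (Cdiv (Csub (f (Cadd z h)) (f z)) h) l) < eps.

Fixpoint Csum_nat (f : nat -> Cplx) (n : nat) : Cplx :=
  match n with O => C0 | S m => Cadd (Csum_nat f m) (f m) end.
Fixpoint Cprod_nat (f : nat -> Cplx) (n : nat) : Cplx :=
  match n with O => C1 | S m => Cmul (Cprod_nat f m) (f m) end.

Definition twopi_i : Cplx := (0, 2 * PI).

Definition theta_term (e e' : R) (zeta tau : Cplx) (n : Z) : Cplx :=
  let a := IZR n + e / 2 in
  Cexp (Cmul twopi_i
          (Cadd (Cmul (RtoC (/ 2 * a ^ 2)) tau)
                (Cmul (RtoC a) (Cadd zeta (RtoC (e' / 2)))))).

(* theta[e;e'](zeta,tau) = sum over n in Z, as limit of sums over -N..N *)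
Definition theta (e e' : R) (zeta tau : Cplx) : Cplx :=
  Clim (fun N => Csum_nat
          (fun k => theta_term e e' zeta tau (Z.of_nat k - Z.of_nat N)%Z)
          (2 * N + 1)).

Definition qpoch (k : nat) (q : Cplx) : Cplx :=
  Clim (fun N => Cprod_nat (fun m => Csub C1 (Cpow q (k * S m))) N).

Definition qexp (tau : Cplx) : Cplx := Cexp (Cmul twopi_i tau).

Definition Wfun (tau : Cplx) : Cplx :=
  Cdiv (Cpow (theta 1 (1/3) C0 tau) 4) (Cpow (theta 1 (2/3) C0 tau) 4).

(* Main.v *)
From Stdlib Require Import Reals Lra Lia ZArith List Permutation ClassicalEpsilon.
From Coquelicot Require Import Coquelicot.
Require Import Defs.
Import ListNotations.
Open Scope R_scope.

(** Write [E_k = (q^k;q^k)_oo], [B = E_1^6 E_6 / (E_2^3 E_3^2)], [C = E_3^6 E_2 / (E_1^2 E_6^3)].  The triple product at sixth roots of unity gives [W = 9 C / B], and the braces in the Riccati equation satisfy [P^2 = B C].  Kronecker's identity expresses [B] and [C] through the cubic theta function [a(q)]: [B = 2 a(q^2) - a(q)] and [3 C = a(q) + 2 a(q^2)].  The logarithmic derivative of [W], a combination of the Lambert series [sum n q^(kn) / (1 - q^(kn))] for [k = 1, 2, 3, 6], equals [(2/3) (a(q)^2 - a(q^2)^2) = (C - B) (9 C - B) / 8] because [a(q)^2 = 1 + 12 sum_(3 not dividing n) n q^n / (1 - q^n)].  The Riccati equation is then an identity between rational functions of [B] and [C]. *)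

(** Kronecker's series, the sum of a^n / (1 - b q^n), converges only for |q| < |a| < 1, while the
    evaluation giving B takes a = -1. It is therefore multiplied by 1 - a, which turns the
    coefficients into differences decaying like |q|^|n| on both sides. The identity compares Laurent
    coefficients in a: those of theta(a) times the series obey a first-order recurrence, and letting
    a tend to 1 fixes the remaining constant. In weight two, a(q) is 3 times the sum over all
    integers n of g(q^n), where g(x) = x / (1 + x + x^2). The partial fractions of g(x) g(xy) have a
    part that telescopes along each diagonal of the double sum, and this part produces the Lambert
    series. The quadratic is (W - 1)(W - 9), with W - 1 = (9 C - B) / B and W - 9 = 9 (C - B) / B.
    Here 9 C - B and C - B are multiples of a(q) + a(q^2) and a(q) - a(q^2), which is how the two
    sides meet. Derivatives rest on explicit quadratic remainders, so no logarithm and no termwise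
    differentiation enters. *)

Module Hauptmodul.

(* [Defs] reuses several names of Coquelicot; inside this module the latter take precedence. *)
Import Coquelicot.Complex.
Open Scope C_scope.

(** * Unconditional sums *)

Definition csum {I : Type} (f : I -> C) (F : list I) : C :=
  fold_right (fun i s => f i + s) (RtoC 0) F.

Definition rsum {I : Type} (f : I -> R) (F : list I) : R :=
  fold_right (fun i s => (f i + s)%R) 0%R F.

(** Summation along the net of finite subsets, so that reindexing by a bijection needs no hypothesis. *)
Definition hsum {I : Type} (f : I -> C) (s : C) : Prop :=
  forall eps : R, (0 < eps)%R -> exists F0 : list I, forall F : list I,
    NoDup F -> incl F0 F -> (Cmod (csum f F - s) < eps)%R.

Definition rbounded {I : Type} (g : I -> R) : Prop :=
  exists M : R, forall F : list I, NoDup F -> (rsum g F <= M)%R.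

Definition asum {I : Type} (f : I -> C) : Prop := rbounded (fun i => Cmod (f i)).

(** Decided classically, so that finite subsets of any index type have duplicate-free unions and
    complements. *)
Definition eqdec {I : Type} (x y : I) : {x = y} + {x <> y} :=
  excluded_middle_informative (x = y).

Definition union {I : Type} (F G : list I) : list I := nodup eqdec (F ++ G).

Lemma union_NoDup {I : Type} (F G : list I) : NoDup (union F G).
Proof. apply NoDup_nodup. Qed.

Lemma union_In {I : Type} (F G : list I) i : In i (union F G) <-> In i F \/ In i G.
Proof. unfold union. rewrite nodup_In, in_app_iff. reflexivity. Qed.

Lemma union_l {I : Type} (F G : list I) : incl F (union F G).
Proof. intros i Hi. apply union_In; auto. Qed.

Lemma union_r {I : Type} (F G : list I) : incl G (union F G).
Proof. intros i Hi. apply union_In; auto. Qed.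

Lemma csum_app {I : Type} (f : I -> C) F G : csum f (F ++ G) = csum f F + csum f G.
Proof. induction F as [|a F IH]; simpl; [ring | rewrite IH; ring]. Qed.

Lemma rsum_app {I : Type} (f : I -> R) F G : rsum f (F ++ G) = (rsum f F + rsum f G)%R.
Proof. induction F as [|a F IH]; simpl; [ring | rewrite IH; ring]. Qed.

Lemma csum_perm {I : Type} (f : I -> C) F G : Permutation F G -> csum f F = csum f G.
Proof. induction 1; simpl; try congruence; ring. Qed.

Lemma rsum_perm {I : Type} (f : I -> R) F G : Permutation F G -> rsum f F = rsum f G.
Proof. induction 1; simpl; try congruence; ring. Qed.

Lemma csum_plus {I : Type} (f g : I -> C) F :
  csum (fun i => f i + g i) F = csum f F + csum g F.
Proof. induction F as [|a F IH]; simpl; [ring | rewrite IH; ring]. Qed.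

Lemma csum_scal {I : Type} (c : C) (f : I -> C) F :
  csum (fun i => c * f i) F = c * csum f F.
Proof. induction F as [|a F IH]; simpl; [ring | rewrite IH; ring]. Qed.

Lemma rsum_scal {I : Type} (c : R) (f : I -> R) F :
  rsum (fun i => (c * f i)%R) F = (c * rsum f F)%R.
Proof. induction F as [|a F IH]; simpl; [ring | rewrite IH; ring]. Qed.

Lemma rsum_plus {I : Type} (f g : I -> R) F :
  rsum (fun i => (f i + g i)%R) F = (rsum f F + rsum g F)%R.
Proof. induction F as [|a F IH]; simpl; [ring | rewrite IH; ring]. Qed.

Lemma csum_ext_in {I : Type} (f g : I -> C) F :
  (forall i, In i F -> f i = g i) -> csum f F = csum g F.
Proof.
  induction F as [|a F IH]; simpl; intros H; auto.
  rewrite H by auto. rewrite IH by auto. reflexivity.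
Qed.

Lemma rsum_le {I : Type} (f g : I -> R) F :
  (forall i, In i F -> (f i <= g i)%R) -> (rsum f F <= rsum g F)%R.
Proof.
  induction F as [|a F IH]; simpl; intros H; [lra|].
  assert (H1 := H a (or_introl eq_refl)).
  assert (H2 := IH (fun i Hi => H i (or_intror Hi))). lra.
Qed.

Lemma rsum_nonneg {I : Type} (f : I -> R) F :
  (forall i, (0 <= f i)%R) -> (0 <= rsum f F)%R.
Proof.
  intros H; induction F as [|a F IH]; simpl; [lra|]. specialize (H a). lra.
Qed.

Lemma csum_le {I : Type} (f : I -> C) F :
  (Cmod (csum f F) <= rsum (fun i => Cmod (f i)) F)%R.
Proof.
  induction F as [|a F IH]; simpl; [rewrite Cmod_0; lra|].
  eapply Rle_trans; [apply Cmod_triangle|]. lra.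
Qed.

Lemma csum_zero {I : Type} (f : I -> C) F :
  (forall i, In i F -> f i = 0) -> csum f F = 0.
Proof.
  induction F as [|a F IH]; simpl; intros H; auto.
  rewrite H, IH by auto. ring.
Qed.

Lemma csum_map {I J : Type} (f : I -> C) (p : J -> I) F :
  csum f (map p F) = csum (fun j => f (p j)) F.
Proof. induction F as [|a F IH]; simpl; congruence. Qed.

Lemma rsum_map {I J : Type} (f : I -> R) (p : J -> I) F :
  rsum f (map p F) = rsum (fun j => f (p j)) F.
Proof. induction F as [|a F IH]; simpl; congruence. Qed.

(** [G] is the complement of [F0] in [F]. All tail estimates below split a large finite set in this
    way. *)
Lemma incl_split {I : Type} (F0 F : list I) : NoDup F0 -> NoDup F -> incl F0 F ->
  exists G, Permutation F (F0 ++ G) /\ NoDup (F0 ++ G).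
Proof.
  intros H0 HF Hi.
  set (G := filter (fun i => if in_dec eqdec i F0 then false else true) F).
  assert (HN : NoDup (F0 ++ G)).
  { apply NoDup_app; auto.
    - apply NoDup_filter; auto.
    - intros a Ha Hb. apply filter_In in Hb. destruct (in_dec eqdec a F0); intuition. }
  exists G; split; auto.
  apply NoDup_Permutation; auto.
  intros x; rewrite in_app_iff. unfold G; rewrite filter_In.
  split; [|intros [H|H]; auto; tauto].
  intros H. destruct (in_dec eqdec x F0); auto.
Qed.

Lemma rsum_incl {I : Type} (f : I -> R) (F0 F : list I) :
  (forall i, (0 <= f i)%R) -> NoDup F0 -> NoDup F -> incl F0 F ->
  (rsum f F0 <= rsum f F)%R.
Proof.
  intros Hf H0 HF Hi. destruct (incl_split F0 F H0 HF Hi) as [G [HP _]].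
  rewrite (rsum_perm _ _ _ HP), rsum_app.
  assert (H := rsum_nonneg f G Hf). lra.
Qed.

Lemma Cmod_minus_triangle (a b c : C) : (Cmod (a - c) <= Cmod (a - b) + Cmod (b - c))%R.
Proof.
  replace (a - c) with ((a - b) + (b - c)) by ring. apply Cmod_triangle.
Qed.

Lemma Cmod_sym (a b : C) : Cmod (a - b) = Cmod (b - a).
Proof. rewrite <- Cmod_opp. f_equal. ring. Qed.

Lemma Cmod_small (a b : C) : (forall eps, (0 < eps)%R -> (Cmod (a - b) < eps)%R) -> a = b.
Proof.
  intros H. assert (Cmod (a - b) = 0)%R.
  { assert (H0 := Cmod_ge_0 (a - b)). destruct (Req_dec (Cmod (a - b)) 0); auto.
    assert (0 < Cmod (a - b))%R by lra. specialize (H _ H2). lra. }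
  apply Cmod_eq_0 in H0. replace a with ((a - b) + b) by ring. rewrite H0. ring.
Qed.

(** * Uniqueness, linearity and reindexing of unconditional sums *)

Lemma hsum_unique {I : Type} (f : I -> C) s t : hsum f s -> hsum f t -> s = t.
Proof.
  intros Hs Ht. apply Cmod_small. intros eps He.
  destruct (Hs (eps / 2)%R) as [F1 H1]; [lra|].
  destruct (Ht (eps / 2)%R) as [F2 H2]; [lra|].
  specialize (H1 (union F1 F2) (union_NoDup _ _) (union_l _ _)).
  specialize (H2 (union F1 F2) (union_NoDup _ _) (union_r _ _)).
  assert (H := Cmod_minus_triangle s (csum f (union F1 F2)) t).
  rewrite (Cmod_sym s (csum f _)) in H. lra.
Qed.

Lemma hsum_ext {I : Type} (f g : I -> C) s : (forall i, f i = g i) -> hsum f s -> hsum g s.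
Proof.
  intros H Hs eps He. destruct (Hs eps He) as [F0 H0]. exists F0. intros F HF Hi.
  rewrite <- (csum_ext_in f g) by auto. auto.
Qed.

Lemma hsum_plus {I : Type} (f g : I -> C) s t :
  hsum f s -> hsum g t -> hsum (fun i => f i + g i) (s + t).
Proof.
  intros Hs Ht eps He.
  destruct (Hs (eps / 2)%R) as [F1 H1]; [lra|].
  destruct (Ht (eps / 2)%R) as [F2 H2]; [lra|].
  exists (F1 ++ F2). intros F HF Hi. apply incl_app_inv in Hi. destruct Hi as [Hi1 Hi2].
  rewrite csum_plus.
  specialize (H1 F HF Hi1). specialize (H2 F HF Hi2).
  replace (csum f F + csum g F - (s + t)) with ((csum f F - s) + (csum g F - t)) by ring.
  eapply Rle_lt_trans; [apply Cmod_triangle|]. lra.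
Qed.

Lemma hsum_scal {I : Type} (c : C) (f : I -> C) s :
  hsum f s -> hsum (fun i => c * f i) (c * s).
Proof.
  intros Hs eps He.
  assert (Hc := Cmod_ge_0 c).
  destruct (Hs (eps / (Cmod c + 1))%R) as [F0 H0]; [apply Rdiv_lt_0_compat; lra|].
  exists F0. intros F HF Hi. specialize (H0 F HF Hi).
  rewrite csum_scal. replace (c * csum f F - c * s) with (c * (csum f F - s)) by ring.
  rewrite Cmod_mult.
  apply Rle_lt_trans with ((Cmod c + 1) * Cmod (csum f F - s))%R.
  - assert (H := Cmod_ge_0 (csum f F - s)). nra.
  - apply Rmult_lt_compat_l with (r := (Cmod c + 1)%R) in H0; [|lra].
    replace ((Cmod c + 1) * (eps / (Cmod c + 1)))%R with eps in H0 by (field; lra). auto.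
Qed.

Lemma hsum_minus {I : Type} (f g : I -> C) s t :
  hsum f s -> hsum g t -> hsum (fun i => f i - g i) (s - t).
Proof.
  intros Hs Ht. replace (s - t) with (s + (-(1)) * t) by ring.
  apply hsum_ext with (fun i => f i + (-(1)) * g i); [intros; ring|].
  apply hsum_plus; auto. apply hsum_scal; auto.
Qed.

Lemma hsum_0 {I : Type} : hsum (fun _ : I => RtoC 0) 0.
Proof.
  intros eps He. exists nil. intros F _ _. rewrite csum_zero by auto.
  replace (RtoC 0 - RtoC 0) with (RtoC 0) by ring. rewrite Cmod_0. auto.
Qed.

Lemma hsum_finite {I : Type} (f : I -> C) F0 : NoDup F0 ->
  (forall i, ~ In i F0 -> f i = 0) -> hsum f (csum f F0).
Proof.
  intros H0 Hf eps He. exists F0. intros F HF Hi.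
  destruct (incl_split F0 F H0 HF Hi) as [G [HP HN]].
  rewrite (csum_perm _ _ _ HP), csum_app, (csum_zero f G).
  - replace (csum f F0 + 0 - csum f F0) with (RtoC 0) by ring. rewrite Cmod_0; auto.
  - intros i Hi'. apply Hf. intros Hj.
    revert Hj Hi'. clear -HN. induction F0 as [|a F0 IH]; simpl; auto.
    simpl in HN. inversion HN; subst. intros [->|H] Hi; auto.
    apply H1. apply in_app_iff; auto.
Qed.

(** Only indices in the range of [p] contribute, so a finite set of indices can be traded for its
    preimage. The equivalence on membership serves both to pull sums back and to push them
    forward. *)
Lemma preimage_list {I J : Type} (p : J -> I) (f : I -> C) :
  (forall j k, p j = p k -> j = k) ->
  (forall i, (forall j, p j <> i) -> f i = 0) ->
  forall F, NoDup F -> exists G, NoDup G /\ (forall j, In j G <-> In (p j) F) /\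
    csum f F = csum (fun j => f (p j)) G.
Proof.
  intros Hp Hf F. induction F as [|a F IH]; intros HF.
  - exists nil. split; [constructor|]. split; [simpl; tauto|reflexivity].
  - inversion HF; subst. destruct (IH H2) as [G [HG [HIn HS]]].
    destruct (classic (exists j, p j = a)) as [[j Hj]|Hn].
    + exists (j :: G). split; [constructor; auto; rewrite HIn, Hj; auto|].
      split; [|simpl; rewrite HS, Hj; reflexivity].
      intros k; simpl. rewrite HIn. split; intros [H|H]; subst; auto.
    + exists G. split; auto. split.
      * intros k. rewrite HIn. simpl. split; auto. intros [H|H]; auto.
        exfalso; apply Hn; exists k; auto.
      * simpl. rewrite HS, (Hf a); [ring|]. intros j Hj; apply Hn; exists j; auto.
Qed.

Lemma hsum_pull {I J : Type} (p : J -> I) (f : I -> C) s :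
  (forall j k, p j = p k -> j = k) ->
  (forall i, (forall j, p j <> i) -> f i = 0) ->
  hsum f s -> hsum (fun j => f (p j)) s.
Proof.
  intros Hp Hf Hs eps He. destruct (Hs eps He) as [F0 H0].
  destruct (preimage_list p f Hp Hf (nodup eqdec F0) (NoDup_nodup _ _)) as [G0 [HG0 [HI0 _]]].
  exists G0. intros G HG Hi.
  (* The image of [G] is enlarged to contain [F0]. Its preimage is still [G], because [G] already
     contains the preimage of [F0]. *)
  destruct (preimage_list p f Hp Hf (union (map p G) F0) (union_NoDup _ _))
    as [G' [HG' [HI' HS']]].
  assert (HP : Permutation G' G).
  { apply NoDup_Permutation; auto. intros j. rewrite HI', union_In, in_map_iff. split.
    - intros [[k [Hk Hk']]|H]; [apply Hp in Hk; subst; auto|].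
      apply Hi. apply HI0. rewrite nodup_In; auto.
    - intros H. left. exists j; auto. }
  rewrite <- (csum_perm _ _ _ HP), <- HS'. apply H0; [apply union_NoDup | apply union_r].
Qed.

Lemma hsum_push {I J : Type} (p : J -> I) (f : I -> C) s :
  (forall j k, p j = p k -> j = k) ->
  (forall i, (forall j, p j <> i) -> f i = 0) ->
  hsum (fun j => f (p j)) s -> hsum f s.
Proof.
  intros Hp Hf Hs eps He. destruct (Hs eps He) as [G0 H0].
  exists (map p G0). intros F HF Hi.
  destruct (preimage_list p f Hp Hf F HF) as [G [HG [HI HS]]].
  rewrite HS. apply H0; auto. intros j Hj. apply HI, Hi, in_map, Hj.
Qed.

Lemma hsum_bij {I J : Type} (p : J -> I) (r : I -> J) (f : I -> C) s :
  (forall j, r (p j) = j) -> (forall i, p (r i) = i) ->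
  hsum f s -> hsum (fun j => f (p j)) s.
Proof.
  intros H1 H2. apply hsum_pull.
  - intros j k H. rewrite <- (H1 j), <- (H1 k), H. reflexivity.
  - intros i H. exfalso. apply (H (r i)). auto.
Qed.

(** * Absolute summability *)

Lemma rbounded_le {I : Type} (f g : I -> R) :
  (forall i, (f i <= g i)%R) -> rbounded g -> rbounded f.
Proof.
  intros H [M HM]. exists M. intros F HF. eapply Rle_trans; [apply rsum_le; intros; apply H|auto].
Qed.

Lemma rbounded_plus {I : Type} (f g : I -> R) :
  rbounded f -> rbounded g -> rbounded (fun i => (f i + g i)%R).
Proof.
  intros [M HM] [N HN]. exists (M + N)%R. intros F HF. rewrite rsum_plus.
  apply Rplus_le_compat; auto.
Qed.

Lemma rbounded_scal {I : Type} (c : R) (f : I -> R) : (0 <= c)%R ->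
  rbounded f -> rbounded (fun i => (c * f i)%R).
Proof.
  intros Hc [M HM]. exists (c * M)%R. intros F HF. rewrite rsum_scal.
  apply Rmult_le_compat_l; auto.
Qed.

Lemma rbounded_inj {I J : Type} (p : J -> I) (f : I -> R) :
  (forall j k, p j = p k -> j = k) -> rbounded f -> rbounded (fun j => f (p j)).
Proof.
  intros Hp [M HM]. exists M. intros F HF. rewrite <- rsum_map. apply HM.
  apply FinFun.Injective_map_NoDup; auto.
Qed.

Lemma asum_le {I : Type} (f : I -> C) (g : I -> R) :
  (forall i, (Cmod (f i) <= g i)%R) -> rbounded g -> asum f.
Proof. apply rbounded_le. Qed.

Lemma asum_ext {I : Type} (f g : I -> C) : (forall i, f i = g i) -> asum f -> asum g.
Proof. intros H. apply asum_le. intros i; rewrite H; lra. Qed.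

Lemma asum_plus {I : Type} (f g : I -> C) : asum f -> asum g -> asum (fun i => f i + g i).
Proof.
  intros Hf Hg. eapply asum_le; [|apply (rbounded_plus _ _ Hf Hg)].
  intros i; apply Cmod_triangle.
Qed.

Lemma asum_scal {I : Type} (c : C) (f : I -> C) : asum f -> asum (fun i => c * f i).
Proof.
  intros Hf. eapply asum_le; [|apply (rbounded_scal (Cmod c) _ (Cmod_ge_0 c) Hf)].
  intros i; simpl. rewrite Cmod_mult. lra.
Qed.

Lemma asum_inj {I J : Type} (p : J -> I) (f : I -> C) :
  (forall j k, p j = p k -> j = k) -> asum f -> asum (fun j => f (p j)).
Proof. intros Hp. apply (rbounded_inj p (fun i => Cmod (f i))); auto. Qed.

Lemma rbounded_sup {I : Type} (g : I -> R) : (forall i, (0 <= g i)%R) -> rbounded g ->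
  exists s, (forall F, NoDup F -> (rsum g F <= s)%R) /\
    forall eps, (0 < eps)%R -> exists F0, NoDup F0 /\ (s - eps < rsum g F0)%R.
Proof.
  intros Hg [M HM].
  destruct (completeness (fun x => exists F, NoDup F /\ x = rsum g F)) as [s [Hu Hl]].
  - exists M. intros x [F [HF ->]]. auto.
  - exists 0%R, nil. split; [constructor|reflexivity].
  - exists s. split; [intros F HF; apply Hu; eauto|].
    intros eps He. apply NNPP. intros Hn.
    assert (s <= s - eps)%R; [|lra].
    apply Hl. intros x [F [HF ->]]. apply Rnot_lt_le. intros H. apply Hn. eauto.
Qed.

Lemma rbounded_hsum {I : Type} (g : I -> R) : (forall i, (0 <= g i)%R) -> rbounded g ->
  exists s : R, hsum (fun i => RtoC (g i)) s.
Proof.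
  intros Hg Hb. destruct (rbounded_sup g Hg Hb) as [s [H1 H2]]. exists s.
  intros eps He. destruct (H2 eps He) as [F0 [HF0 H0]]. exists F0. intros F HF Hi.
  assert (Hc : csum (fun i => RtoC (g i)) F = RtoC (rsum g F)).
  { clear. induction F as [|a F IH]; simpl; auto. rewrite IH, RtoC_plus; auto. }
  rewrite Hc, <- RtoC_minus, Cmod_R.
  assert (H3 := rsum_incl g F0 F Hg HF0 HF Hi). specialize (H1 F HF).
  apply Rabs_def1; lra.
Qed.

(** The family splits into four nonnegative ones, the positive and negative parts of the real and
    imaginary parts, each dominated by the modulus. *)
Lemma asum_hsum {I : Type} (f : I -> C) : asum f -> exists s, hsum f s.
Proof.
  intros Hf.
  assert (Hpos : forall u : I -> R, (forall i, (Rabs (u i) <= Cmod (f i))%R) ->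
    exists s, hsum (fun i => RtoC (u i)) s).
  { intros u Hu.
    destruct (rbounded_hsum (fun i => Rmax (u i) 0)) as [s1 H1].
    - intros; apply Rmax_r.
    - eapply rbounded_le; [|apply Hf]. intros i; simpl. specialize (Hu i).
      apply Rmax_lub; [|apply Cmod_ge_0]. assert (H := Rle_abs (u i)). lra.
    - destruct (rbounded_hsum (fun i => Rmax (- u i) 0)) as [s2 H2].
      + intros; apply Rmax_r.
      + eapply rbounded_le; [|apply Hf]. intros i; simpl. specialize (Hu i).
        apply Rmax_lub; [|apply Cmod_ge_0]. assert (H := Rle_abs (- u i)).
        rewrite Rabs_Ropp in H. lra.
      + exists (RtoC s1 - RtoC s2). eapply hsum_ext; [|apply (hsum_minus _ _ _ _ H1 H2)].
        intros i; simpl. rewrite <- RtoC_minus. f_equal.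
        unfold Rmax. destruct (Rle_dec (u i) 0), (Rle_dec (- u i) 0); lra. }
  destruct (Hpos (fun i => Re (f i))) as [s1 H1]; [intros; apply re_le_Cmod|].
  destruct (Hpos (fun i => Im (f i))) as [s2 H2].
  { intros i. eapply Rle_trans; [apply Rmax_r | apply Rmax_Cmod]. }
  exists (s1 + Ci * s2).
  eapply hsum_ext; [|apply (hsum_plus _ _ _ _ H1 (hsum_scal Ci _ _ H2))].
  intros i; simpl. destruct (f i) as [x y]. unfold Re, Im, Cplus, Cmult, Ci, RtoC; simpl.
  f_equal; ring.
Qed.

(** * Double sums and dominated convergence *)

Lemma csum_list_prod {I J : Type} (f : I * J -> C) F G :
  csum f (list_prod F G) = csum (fun i => csum (fun j => f (i, j)) G) F.
Proof.
  induction F as [|a F IH]; simpl; auto.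
  rewrite csum_app, IH, csum_map. reflexivity.
Qed.

Lemma rsum_list_prod {I J : Type} (f : I * J -> R) F G :
  rsum f (list_prod F G) = rsum (fun i => rsum (fun j => f (i, j)) G) F.
Proof.
  induction F as [|a F IH]; simpl; auto.
  rewrite rsum_app, IH, rsum_map. reflexivity.
Qed.

Lemma NoDup_list_prod {I J : Type} (F : list I) (G : list J) :
  NoDup F -> NoDup G -> NoDup (list_prod F G).
Proof.
  intros HF HG. induction HF as [|a F Ha HF IH]; simpl; [constructor|].
  apply NoDup_app; auto.
  - apply FinFun.Injective_map_NoDup; auto. intros x y H; congruence.
  - intros [x y] H1 H2. apply in_map_iff in H1. destruct H1 as [z [H1 _]].
    apply in_prod_iff in H2. inversion H1; subst. tauto.
Qed.

(** A finite set [F] of rows meeting [F0] is completed by one finite set [G] of columns, chosen so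
    that the rectangle contains [F0] and each row is within eps / (2 (|F| + 1)) of its sum. The
    summand 1 keeps the denominator positive when [F] is empty. *)
Lemma hsum_fubini {I J : Type} (f : I * J -> C) (s : I -> C) S :
  hsum f S -> (forall i, hsum (fun j => f (i, j)) (s i)) -> hsum s S.
Proof.
  intros HS Hs eps He. destruct (HS (eps / 2)%R) as [F0 H0]; [lra|].
  exists (map fst F0). intros F HF Hi.
  assert (Hfib : forall d, (0 < d)%R -> exists J0, forall G, NoDup G -> incl J0 G ->
    (Cmod (csum (fun i => csum (fun j => f (i, j)) G) F - csum s F) <= INR (length F) * d)%R).
  { intros d Hd. clear -Hs Hd. induction F as [|a F [J1 H1]].
    - exists nil. intros. simpl. replace (RtoC 0 - RtoC 0) with (RtoC 0) by ring.
      rewrite Cmod_0. lra.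
    - destruct (Hs a d Hd) as [J2 H2]. exists (J1 ++ J2). intros G HG HI.
      apply incl_app_inv in HI. destruct HI as [HI1 HI2].
      specialize (H1 G HG HI1). specialize (H2 G HG HI2).
      replace (length (a :: F)) with (S (length F)) by reflexivity. rewrite S_INR. simpl csum.
      match goal with |- (Cmod (?a + ?b - (?c + ?d)) <= _)%R =>
        replace (a + b - (c + d)) with ((a - c) + (b - d)) by ring end.
      eapply Rle_trans; [apply Cmod_triangle|]. lra. }
  assert (HL : (0 < INR (length F) + 1)%R) by (assert (H := pos_INR (length F)); lra).
  destruct (Hfib (eps / (2 * (INR (length F) + 1)))%R) as [J0 HJ].
  { apply Rdiv_lt_0_compat; lra. }
  set (G := union J0 (map snd F0)).
  specialize (HJ G (union_NoDup _ _) (union_l _ _)).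
  specialize (H0 (list_prod F G) (NoDup_list_prod _ _ HF (union_NoDup _ _))).
  rewrite csum_list_prod in H0.
  assert (H1 : (Cmod (csum (fun i => csum (fun j => f (i, j)) G) F - S) < eps / 2)%R).
  { apply H0. intros [i j] Hij. apply in_prod.
    - apply Hi. apply (in_map fst) in Hij. auto.
    - apply union_r. apply (in_map snd) in Hij. auto. }
  assert (H2 : (INR (length F) * (eps / (2 * (INR (length F) + 1))) <= eps / 2)%R).
  { apply Rmult_le_reg_r with (2 * (INR (length F) + 1))%R; [lra|].
    field_simplify; [|lra]. nra. }
  assert (H3 := Cmod_minus_triangle (csum s F)
    (csum (fun i => csum (fun j => f (i, j)) G) F) S).
  rewrite (Cmod_sym (csum s F) (csum _ F)) in H3. lra.
Qed.

Lemma rbounded_prod {I J : Type} (f : I -> R) (g : J -> R) :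
  (forall i, (0 <= f i)%R) -> (forall j, (0 <= g j)%R) ->
  rbounded f -> rbounded g -> rbounded (fun ij : I * J => (f (fst ij) * g (snd ij))%R).
Proof.
  intros Hf Hg [M HM] [N HN]. exists (M * N)%R. intros F HF.
  set (F1 := nodup eqdec (map fst F)). set (F2 := nodup eqdec (map snd F)).
  apply Rle_trans with (rsum (fun ij : I * J => (f (fst ij) * g (snd ij))%R) (list_prod F1 F2)).
  - apply rsum_incl; auto.
    + intros; apply Rmult_le_pos; auto.
    + apply NoDup_list_prod; apply NoDup_nodup.
    + intros [i j] H. apply in_prod; apply nodup_In.
      * apply (in_map fst) in H; auto.
      * apply (in_map snd) in H; auto.
  - rewrite rsum_list_prod. simpl.
    replace (rsum (fun i => rsum (fun j => (f i * g j)%R) F2) F1)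
      with (rsum f F1 * rsum g F2)%R.
    + apply Rmult_le_compat; try (apply rsum_nonneg; auto).
      * apply HM, NoDup_nodup.
      * apply HN, NoDup_nodup.
    + generalize F1; intros L; clear. induction L as [|a L IH]; simpl; [ring|]. rewrite <- IH, rsum_scal. ring.
Qed.

Lemma asum_prod {I J : Type} (f : I -> C) (g : J -> C) : asum f -> asum g ->
  asum (fun ij : I * J => f (fst ij) * g (snd ij)).
Proof.
  intros Hf Hg.
  eapply asum_le; [|apply (rbounded_prod (fun i => Cmod (f i)) (fun j => Cmod (g j)));
    auto; intros; apply Cmod_ge_0].
  intros [i j]; simpl. rewrite Cmod_mult. lra.
Qed.

Lemma hsum_prod {I J : Type} (f : I -> C) (g : J -> C) s t :
  asum f -> asum g -> hsum f s -> hsum g t ->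
  hsum (fun ij : I * J => f (fst ij) * g (snd ij)) (s * t).
Proof.
  intros Hf Hg Hs Ht.
  destruct (asum_hsum _ (asum_prod f g Hf Hg)) as [S HS].
  replace (s * t) with S; auto.
  apply (hsum_unique (fun i => t * f i)).
  - apply (hsum_fubini _ _ _ HS). intros i; simpl.
    replace (t * f i) with (f i * t) by ring. apply hsum_scal; auto.
  - replace (s * t) with (t * s) by ring. apply hsum_scal; auto.
Qed.

(** Absolute summability provides the double sum, and both iterated sums agree with it. *)
Lemma hsum_swap {I J : Type} (f : I * J -> C) (s : I -> C) (t : J -> C) S :
  asum f -> (forall i, hsum (fun j => f (i, j)) (s i)) ->
  (forall j, hsum (fun i => f (i, j)) (t j)) -> hsum s S -> hsum t S.
Proof.
  intros Hf Hs Ht HS. destruct (asum_hsum f Hf) as [S' HS'].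
  assert (S' = S) by (eapply hsum_unique; [eapply hsum_fubini; eauto | auto]). subst S'.
  apply (hsum_fubini (fun ji : J * I => f (snd ji, fst ji))).
  - apply (hsum_bij (fun ji : J * I => (snd ji, fst ji)) (fun ij => (snd ij, fst ij)) f); auto;
      intros [x y]; reflexivity.
  - auto.
Qed.

Lemma csum_cv {I : Type} (f : nat -> I -> C) (g : I -> C) F :
  (forall i, Cseq_cv (fun n => f n i) (g i)) -> Cseq_cv (fun n => csum (f n) F) (csum g F).
Proof.
  intros H. induction F as [|a F IH]; intros eps He.
  - exists 0%nat. intros. simpl. change (Cmod (RtoC 0 - RtoC 0) < eps)%R.
    replace (RtoC 0 - RtoC 0) with (RtoC 0) by ring. rewrite Cmod_0; auto.
  - destruct (IH (eps / 2)%R) as [N1 H1]; [lra|].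
    destruct (H a (eps / 2)%R) as [N2 H2]; [lra|].
    exists (N1 + N2)%nat. intros n Hn.
    assert (H3 := H1 n ltac:(lia)). assert (H4 := H2 n ltac:(lia)).
    simpl. change (Cmod (csum (f n) F - csum g F) < eps / 2)%R in H3.
    change (Cmod (f n a - g a) < eps / 2)%R in H4.
    change (Cmod (f n a + csum (f n) F - (g a + csum g F)) < eps)%R.
    replace (f n a + csum (f n) F - (g a + csum g F))
      with ((f n a - g a) + (csum (f n) F - csum g F)) by ring.
    eapply Rle_lt_trans; [apply Cmod_triangle|]. lra.
Qed.

(** Dominated convergence. [F0] carries the total mass of [b] up to eps / 8, so every dominated
    family, the limit [g] included, has its sum within eps / 4 of its part on [F0]. On [F0] itself
    termwise convergence suffices. *)
Lemma hsum_tannery {I : Type} (f : nat -> I -> C) (g : I -> C) (b : I -> R) s t :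
  (forall n i, (Cmod (f n i) <= b i)%R) -> rbounded b ->
  (forall i, Cseq_cv (fun n => f n i) (g i)) ->
  (forall n, hsum (f n) (s n)) -> hsum g t -> Cseq_cv s t.
Proof.
  intros Hb Hbb Hcv Hs Ht.
  assert (Hb0 : forall i, (0 <= b i)%R).
  { intros i. eapply Rle_trans; [apply Cmod_ge_0 | apply (Hb 0%nat i)]. }
  assert (Hg : forall i, (Cmod (g i) <= b i)%R).
  { intros i. apply Rnot_lt_le. intros H.
    destruct (Hcv i (Cmod (g i) - b i)%R) as [N HN]; [lra|].
    specialize (HN N (le_n _)). change (Cmod (f N i - g i) < Cmod (g i) - b i)%R in HN.
    specialize (Hb N i).
    assert (H2 := Cmod_triangle (g i - f N i) (f N i)).
    replace (g i - f N i + f N i) with (g i) in H2 by ring.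
    rewrite (Cmod_sym (g i)) in H2. lra. }
  destruct (rbounded_sup b Hb0 Hbb) as [M [HM1 HM2]].
  intros eps He. destruct (HM2 (eps / 8)%R) as [F0 [HF0 H0]]; [lra|].
  assert (Htail : forall (h : I -> C) u, (forall i, (Cmod (h i) <= b i)%R) -> hsum h u ->
    (Cmod (u - csum h F0) <= eps / 4)%R).
  { intros h u Hh Hu. destruct (Hu (eps / 8)%R) as [F1 H1]; [lra|].
    specialize (H1 (union F0 F1) (union_NoDup _ _) (union_r _ _)).
    destruct (incl_split F0 (union F0 F1) HF0 (union_NoDup _ _) (union_l _ _)) as [G [HP HN]].
    rewrite (csum_perm _ _ _ HP), csum_app in H1.
    assert (H2 : (Cmod (csum h G) <= eps / 8)%R).
    { eapply Rle_trans; [apply csum_le|].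
      eapply Rle_trans; [apply rsum_le; intros; apply Hh|].
      specialize (HM1 _ HN). rewrite rsum_app in HM1. change (rsum b G <= eps / 8)%R; lra. }
    replace (u - csum h F0) with ((u - (csum h F0 + csum h G)) + csum h G) by ring.
    eapply Rle_trans; [apply Cmod_triangle|]. rewrite (Cmod_sym u). lra. }
  destruct (csum_cv f g F0 Hcv (eps / 4)%R) as [N HN]; [lra|].
  exists N. intros n Hn. specialize (HN n Hn).
  change (Cmod (csum (f n) F0 - csum g F0) < eps / 4)%R in HN.
  change (Cmod (s n - t) < eps)%R.
  assert (H1 := Htail (f n) (s n) (Hb n) (Hs n)). assert (H2 := Htail g t Hg Ht).
  assert (H3 := Cmod_minus_triangle (s n) (csum (f n) F0) t).
  assert (H4 := Cmod_minus_triangle (csum (f n) F0) (csum g F0) t).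
  rewrite (Cmod_sym (csum g F0) t) in H4. lra.
Qed.

(** * Limits, integer powers and infinite products *)

Lemma Cseq_cvE (u : nat -> C) (l : C) :
  Cseq_cv u l <-> forall eps : R, (0 < eps)%R -> exists N, forall n, (N <= n)%nat ->
    (Cmod (u n - l) < eps)%R.
Proof. reflexivity. Qed.

Lemma cv_unique (u : nat -> C) (l m : C) : Cseq_cv u l -> Cseq_cv u m -> l = m.
Proof.
  rewrite !Cseq_cvE. intros Hl Hm. apply Cmod_small. intros eps He.
  destruct (Hl (eps / 2)%R) as [N1 H1]; [lra|].
  destruct (Hm (eps / 2)%R) as [N2 H2]; [lra|].
  specialize (H1 (N1 + N2)%nat ltac:(lia)). specialize (H2 (N1 + N2)%nat ltac:(lia)).
  assert (H := Cmod_minus_triangle l (u (N1 + N2)%nat) m).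
  rewrite (Cmod_sym l (u _)) in H. lra.
Qed.

Lemma Clim_eq (u : nat -> C) (l : C) : Cseq_cv u l -> Clim u = l.
Proof.
  intros H. apply (cv_unique u); auto. unfold Clim. apply epsilon_spec. exists l; auto.
Qed.

Lemma cv_const (c : C) : Cseq_cv (fun _ => c) c.
Proof.
  apply Cseq_cvE. intros eps He. exists 0%nat. intros _ _.
  replace (c - c) with (RtoC 0) by ring. rewrite Cmod_0; auto.
Qed.

Lemma cv_ext (u v : nat -> C) (l : C) : (forall n, u n = v n) -> Cseq_cv u l -> Cseq_cv v l.
Proof.
  rewrite !Cseq_cvE. intros H Hu eps He. destruct (Hu eps He) as [N HN]. exists N.
  intros n Hn. rewrite <- H. auto.
Qed.

Lemma cv_plus (u v : nat -> C) (l m : C) : Cseq_cv u l -> Cseq_cv v m -> Cseq_cv (fun n => u n + v n) (l + m).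
Proof.
  rewrite !Cseq_cvE. intros Hl Hm eps He.
  destruct (Hl (eps / 2)%R) as [N1 H1]; [lra|].
  destruct (Hm (eps / 2)%R) as [N2 H2]; [lra|].
  exists (N1 + N2)%nat. intros n Hn.
  specialize (H1 n ltac:(lia)). specialize (H2 n ltac:(lia)).
  replace (u n + v n - (l + m)) with ((u n - l) + (v n - m)) by ring.
  eapply Rle_lt_trans; [apply Cmod_triangle|]. lra.
Qed.

Lemma cv_mult (u v : nat -> C) (l m : C) : Cseq_cv u l -> Cseq_cv v m -> Cseq_cv (fun n => u n * v n) (l * m).
Proof.
  rewrite !Cseq_cvE. intros Hl Hm eps He.
  assert (Hl0 := Cmod_ge_0 l). assert (Hm0 := Cmod_ge_0 m).
  set (d := Rmin 1 (eps / (Cmod l + Cmod m + 2))).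
  assert (Hd : (0 < d)%R).
  { apply Rmin_pos; [lra|]. apply Rdiv_lt_0_compat; lra. }
  assert (Hd1 : (d <= 1)%R) by apply Rmin_l.
  assert (Hd2 : (d * (Cmod l + Cmod m + 2) <= eps)%R).
  { apply Rle_trans with (eps / (Cmod l + Cmod m + 2) * (Cmod l + Cmod m + 2))%R.
    - apply Rmult_le_compat_r; [lra|apply Rmin_r].
    - right; field; lra. }
  destruct (Hl d Hd) as [N1 H1]. destruct (Hm d Hd) as [N2 H2].
  exists (N1 + N2)%nat. intros n Hn.
  specialize (H1 n ltac:(lia)). specialize (H2 n ltac:(lia)).
  replace (u n * v n - l * m) with ((u n - l) * (v n - m) + ((u n - l) * m + l * (v n - m))) by ring.
  eapply Rle_lt_trans; [apply Cmod_triangle|].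
  assert (H3 := Cmod_triangle ((u n - l) * m) (l * (v n - m))).
  rewrite !Cmod_mult in H3. rewrite Cmod_mult.
  assert (H4 := Cmod_ge_0 (u n - l)). assert (H5 := Cmod_ge_0 (v n - m)).
  assert ((Cmod (u n - l) * Cmod (v n - m) < d * 1)%R) by (apply Rmult_le_0_lt_compat; lra).
  assert ((Cmod (u n - l) * Cmod m <= d * Cmod m)%R) by (apply Rmult_le_compat_r; lra).
  assert ((Cmod l * Cmod (v n - m) <= d * Cmod l)%R).
  { rewrite Rmult_comm. apply Rmult_le_compat_r; lra. }
  nra.
Qed.

Lemma cv_scal (c : C) (u : nat -> C) (l : C) : Cseq_cv u l -> Cseq_cv (fun n => c * u n) (c * l).
Proof. intros H. apply cv_mult; auto. apply cv_const. Qed.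

Lemma cv_minus (u v : nat -> C) (l m : C) : Cseq_cv u l -> Cseq_cv v m -> Cseq_cv (fun n => u n - v n) (l - m).
Proof.
  intros Hl Hm. replace (l - m) with (l + (-(1)) * m) by ring.
  apply cv_ext with (fun n => u n + (-(1)) * v n); [intros; ring|].
  apply cv_plus; auto. apply cv_scal; auto.
Qed.

Lemma cv_subseq (u : nat -> C) (l : C) (p : nat -> nat) : (forall n, (n <= p n)%nat) ->
  Cseq_cv u l -> Cseq_cv (fun n => u (p n)) l.
Proof.
  rewrite !Cseq_cvE. intros Hp H eps He. destruct (H eps He) as [N HN]. exists N.
  intros n Hn. apply HN. specialize (Hp n). lia.
Qed.

Lemma cv_squeeze (u : nat -> C) (l : C) (r : nat -> R) : (forall n, (Cmod (u n - l) <= r n)%R) ->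
  is_lim_seq r 0%R -> Cseq_cv u l.
Proof.
  rewrite Cseq_cvE. intros H Hr eps He.
  apply is_lim_seq_spec in Hr. destruct (Hr (mkposreal eps He)) as [N HN].
  exists N. intros n Hn. specialize (HN n Hn). simpl in HN. rewrite Rminus_0_r in HN.
  eapply Rle_lt_trans; [apply H|]. eapply Rle_lt_trans; [apply Rle_abs|]. auto.
Qed.

Lemma cv_bound (u : nat -> C) (l : C) (M : R) : Cseq_cv u l -> (forall n, (Cmod (u n) <= M)%R) -> (Cmod l <= M)%R.
Proof.
  rewrite Cseq_cvE. intros H HM. apply Rnot_lt_le. intros Hl.
  destruct (H (Cmod l - M)%R) as [N HN]; [lra|]. specialize (HN N (le_n _)).
  specialize (HM N). assert (H2 := Cmod_triangle (l - u N) (u N)).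
  replace (l - u N + u N) with l in H2 by ring. rewrite (Cmod_sym l (u N)) in H2. lra.
Qed.

Lemma Csum_nat_csum (f : nat -> C) N : Csum_nat f N = csum f (seq 0 N) :> C.
Proof.
  induction N as [|N IH]; auto. rewrite seq_S, csum_app. simpl.
  change (Csum_nat f N + f N = csum f (seq 0 N) + (f N + 0)). rewrite IH. ring.
Qed.

Lemma incl_seq (F : list nat) : exists N, forall n, (N <= n)%nat -> incl F (seq 0 n).
Proof.
  exists (S (list_max F)). intros n Hn i Hi. apply in_seq.
  assert (H := proj1 (list_max_le F (list_max F)) (le_n _)).
  rewrite Forall_forall in H. specialize (H i Hi). lia.
Qed.

Lemma hsum_nat_cv (f : nat -> C) (s : C) : hsum f s -> Cseq_cv (Csum_nat f) s.
Proof.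
  intros H. apply Cseq_cvE. intros eps He. destruct (H eps He) as [F0 H0].
  destruct (incl_seq F0) as [N HN]. exists N. intros n Hn. rewrite Csum_nat_csum.
  apply H0; [apply seq_NoDup | auto].
Qed.

(** The symmetric windows are those in the definition of [theta], so unconditional sums over the
    integers compute theta values. *)
Lemma hsum_Z_cv (f : Z -> C) s : hsum f s ->
  Cseq_cv (fun N => Csum_nat (fun k => f (Z.of_nat k - Z.of_nat N)%Z) (2 * N + 1)) s.
Proof.
  intros H. apply Cseq_cvE. intros eps He. destruct (H eps He) as [F0 H0].
  destruct (incl_seq (map Z.abs_nat F0)) as [N HN]. exists N. intros n Hn.
  rewrite Csum_nat_csum, <- (csum_map f (fun k => (Z.of_nat k - Z.of_nat n)%Z)).
  apply H0.
  - apply FinFun.Injective_map_NoDup; [|apply seq_NoDup]. intros x y Hxy. lia.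
  - intros i Hi. apply in_map_iff. exists (Z.to_nat (i + Z.of_nat n)).
    assert (Hi' := HN n Hn (Z.abs_nat i) (in_map _ _ _ Hi)). apply in_seq in Hi'.
    split; [lia|]. apply in_seq. lia.
Qed.

(** * Integer powers *)

Definition zpow (z : C) (n : Z) : C :=
  match n with Z0 => 1 | Zpos p => z ^ Pos.to_nat p | Zneg p => / z ^ Pos.to_nat p end.

Lemma zpow_of_nat (z : C) (n : nat) : zpow z (Z.of_nat n) = z ^ n.
Proof.
  destruct n as [|n]; auto. simpl Z.of_nat. unfold zpow.
  rewrite SuccNat2Pos.id_succ. reflexivity.
Qed.

Lemma zpow_opp_nat (z : C) (n : nat) : zpow z (- Z.of_nat n) = / z ^ n.
Proof.
  destruct n as [|n].
  - simpl. apply injective_projections; simpl; field.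
  - simpl Z.of_nat. unfold zpow, Z.opp. rewrite SuccNat2Pos.id_succ. reflexivity.
Qed.

Lemma Z_nat_cases (P : Z -> Prop) :
  (forall n : nat, P (Z.of_nat n)) -> (forall n : nat, P (- Z.of_nat (S n))%Z) -> forall n, P n.
Proof.
  intros H1 H2 n. destruct (Z_le_gt_dec 0 n).
  - rewrite <- (Z2Nat.id n) by lia. apply H1.
  - replace n with (- Z.of_nat (S (Z.to_nat (- n - 1))))%Z by lia. apply H2.
Qed.

(** The step is an equivalence so that an invertible recurrence can be run from 0 in both
    directions. *)
Lemma Z_bi_ind (P : Z -> Prop) : P 0%Z -> (forall n, P n <-> P (n + 1)%Z) -> forall n, P n.
Proof.
  intros H0 HS. apply Z_nat_cases.
  - intros n; induction n as [|n IH]; auto. replace (Z.of_nat (S n)) with (Z.of_nat n + 1)%Z by lia.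
    apply (proj1 (HS _)); auto.
  - assert (H : forall n : nat, P (- Z.of_nat n)%Z); [|auto].
    intros n; induction n as [|n IH]; auto. apply (proj2 (HS _)).
    replace (- Z.of_nat (S n) + 1)%Z with (- Z.of_nat n)%Z by lia. auto.
Qed.

Lemma zpow_0 (z : C) : zpow z 0 = 1.
Proof. reflexivity. Qed.

Lemma zpow_1 (z : C) : zpow z 1 = z.
Proof. unfold zpow. change (Pos.to_nat 1) with 1%nat. simpl. ring. Qed.

Lemma zpow_succ (z : C) (n : Z) : z <> 0 -> zpow z (n + 1) = z * zpow z n.
Proof.
  intros Hz. revert n. apply Z_nat_cases; intros n.
  - replace (Z.of_nat n + 1)%Z with (Z.of_nat (S n)) by lia. rewrite !zpow_of_nat. reflexivity.
  - replace (- Z.of_nat (S n) + 1)%Z with (- Z.of_nat n)%Z by lia. rewrite !zpow_opp_nat.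
    simpl. field. repeat split; auto; apply Cpow_nz; auto.
Qed.

Lemma zpow_nz (z : C) (n : Z) : z <> 0 -> zpow z n <> 0.
Proof.
  intros Hz. revert n. apply Z_nat_cases; intros n.
  - rewrite zpow_of_nat. apply Cpow_nz; auto.
  - rewrite zpow_opp_nat. 
    intros H. apply C1_nz. rewrite <- (Cinv_r (z ^ S n)) by (apply Cpow_nz; auto).
    rewrite H. ring.
Qed.

Lemma zpow_add (z : C) (n m : Z) : z <> 0 -> zpow z (n + m) = zpow z n * zpow z m.
Proof.
  intros Hz. revert m. apply Z_bi_ind.
  - rewrite Z.add_0_r, zpow_0. ring.
  - intros m. rewrite Z.add_assoc, !zpow_succ by auto. split; intros H.
    + rewrite H. ring.
    + apply (f_equal (fun x => / z * x)) in H.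
      replace (/ z * (z * zpow z (n + m))) with (zpow z (n + m)) in H by (field; auto).
      rewrite H. field; auto.
Qed.

Lemma zpow_opp (z : C) (n : Z) : z <> 0 -> zpow z (- n) = / zpow z n.
Proof.
  intros Hz. assert (H := zpow_add z n (- n) Hz). rewrite Z.add_opp_diag_r, zpow_0 in H.
  assert (H1 := zpow_nz z n Hz).
  replace (zpow z (- n)) with (/ zpow z n * (zpow z n * zpow z (- n))) by (field; auto).
  rewrite <- H. ring.
Qed.

Lemma zpow_sub (z : C) (n m : Z) : z <> 0 -> zpow z (n - m) = zpow z n / zpow z m.
Proof. intros Hz. unfold Z.sub. rewrite zpow_add, zpow_opp by auto. reflexivity. Qed.

Lemma zpow_mult (z w : C) (n : Z) : z <> 0 -> w <> 0 -> zpow (z * w) n = zpow z n * zpow w n.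
Proof.
  intros Hz Hw. revert n. apply Z_nat_cases; intros n.
  - rewrite !zpow_of_nat. apply Cpow_mult_l.
  - rewrite !zpow_opp_nat, Cpow_mult_l. field; split; apply Cpow_nz; auto.
Qed.

Lemma zpow_pow (z : C) (k : nat) n : z <> 0 -> zpow (z ^ k) n = zpow z (Z.of_nat k * n).
Proof.
  intros Hz. revert n. apply Z_nat_cases; intros n.
  - rewrite <- Nat2Z.inj_mul, !zpow_of_nat, Cpow_mult_r. reflexivity.
  - replace (Z.of_nat k * - Z.of_nat (S n))%Z with (- Z.of_nat (k * S n))%Z by lia.
    rewrite !zpow_opp_nat, Cpow_mult_r. reflexivity.
Qed.

Lemma zpow_one n : zpow 1 n = 1.
Proof.
  revert n. apply Z_nat_cases; intros n.
  - rewrite zpow_of_nat. apply Cpow_1_l.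
  - rewrite zpow_opp_nat, Cpow_1_l. field.
Qed.

(** * Geometric majorants over the naturals and the integers *)

Lemma rsum_seq_geo (r : R) N : (0 <= r < 1)%R -> (rsum (fun i => r ^ i) (seq 0 N) <= / (1 - r))%R.
Proof.
  intros Hr.
  assert (H : (rsum (fun i => r ^ i) (seq 0 N) * (1 - r) = 1 - r ^ N)%R).
  { induction N as [|N IH]; [simpl; ring|]. rewrite seq_S, rsum_app, Rmult_plus_distr_r, IH.
    simpl. ring. }
  assert (H1 : (0 <= r ^ N)%R) by (apply pow_le; lra).
  apply Rmult_le_reg_r with (1 - r)%R; [lra|]. rewrite H, Rinv_l by lra. lra.
Qed.

Lemma rbounded_nat (g : nat -> R) M : (forall i, (0 <= g i)%R) ->
  (forall N, (rsum g (seq 0 N) <= M)%R) -> rbounded g.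
Proof.
  intros Hg HM. exists M. intros F HF. destruct (incl_seq F) as [N HN].
  eapply Rle_trans; [|apply (HM N)]. apply rsum_incl; auto. apply seq_NoDup.
Qed.

Lemma rbounded_geo (r : R) : (0 <= r < 1)%R -> rbounded (fun n : nat => (r ^ n)%R).
Proof.
  intros Hr. apply rbounded_nat with (/ (1 - r))%R.
  - intros; apply pow_le; lra.
  - intros; apply rsum_seq_geo; auto.
Qed.

Lemma rbounded_Z (g : Z -> R) : (forall i, (0 <= g i)%R) ->
  rbounded (fun n : nat => g (Z.of_nat n)) -> rbounded (fun n : nat => g (- Z.of_nat n)%Z) ->
  rbounded g.
Proof.
  intros Hg [M HM] [M' HM']. exists (M + M')%R. intros F HF.
  set (F1 := nodup eqdec (map Z.to_nat F)).
  set (F2 := nodup eqdec (map (fun z => Z.to_nat (- z)) F)).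
  specialize (HM F1 (NoDup_nodup _ _)). specialize (HM' F2 (NoDup_nodup _ _)).
  set (L1 := map Z.of_nat F1). set (L2 := map (fun n : nat => (- Z.of_nat n)%Z) F2).
  assert (HL : (rsum g (union L1 L2) <= rsum g L1 + rsum g L2)%R).
  { destruct (incl_split L1 (union L1 L2)) as [G [HP HN]].
    - apply FinFun.Injective_map_NoDup; [intros x y; lia|apply NoDup_nodup].
    - apply union_NoDup.
    - apply union_l.
    - rewrite (rsum_perm _ _ _ HP), rsum_app. apply Rplus_le_compat_l.
      apply rsum_incl; auto.
      + apply NoDup_app_remove_l in HN; auto.
      + apply FinFun.Injective_map_NoDup; [intros x y; lia|apply NoDup_nodup].
      + intros i Hi.
        assert (Hi2 : In i (union L1 L2)).
        { eapply Permutation_in; [symmetry; apply HP|]. apply in_app_iff; auto. }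
        apply union_In in Hi2. destruct Hi2; auto. exfalso.
        apply in_split in Hi. destruct Hi as [l1 [l2 ->]]. rewrite app_assoc in HN.
        apply NoDup_remove_2 in HN. apply HN. rewrite !in_app_iff. auto. }
  assert (E1 : rsum g L1 = rsum (fun n : nat => g (Z.of_nat n)) F1) by apply rsum_map.
  assert (E2 : rsum g L2 = rsum (fun n : nat => g (- Z.of_nat n)%Z) F2) by apply rsum_map.
  assert (rsum g F <= rsum g (union L1 L2))%R; [|lra].
  apply rsum_incl; auto; [apply union_NoDup|].
  intros i Hi. apply union_In. destruct (Z_le_gt_dec 0 i).
  - left. apply in_map_iff. exists (Z.to_nat i). split; [lia|]. apply nodup_In.
    apply in_map; auto.
  - right. apply in_map_iff. exists (Z.to_nat (- i)). split; [lia|]. apply nodup_In.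
    apply (in_map (fun z => Z.to_nat (- z))); auto.
Qed.

Lemma rbounded_geo_Z (r : R) : (0 <= r < 1)%R -> rbounded (fun n : Z => (r ^ Z.abs_nat n)%R).
Proof.
  intros Hr. apply rbounded_Z.
  - intros; apply pow_le; lra.
  - eapply rbounded_le; [|apply (rbounded_geo r Hr)]. intros i; simpl.
    rewrite Zabs2Nat.id. lra.
  - eapply rbounded_le; [|apply (rbounded_geo r Hr)]. intros i; simpl.
    replace (Z.abs_nat (- Z.of_nat i)) with i by lia. lra.
Qed.

Lemma asum_geo_Z (f : Z -> C) (K r : R) : (0 <= r < 1)%R ->
  (forall n, (Cmod (f n) <= K * r ^ Z.abs_nat n)%R) -> asum f.
Proof.
  intros Hr Hf. eapply asum_le; [apply Hf|]. apply rbounded_scal; [|apply rbounded_geo_Z; auto].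
  specialize (Hf 0%Z). simpl in Hf. assert (H := Cmod_ge_0 (f 0%Z)). lra.
Qed.

(** A linear factor is absorbed by the larger ratio s halfway between r and 1: Bernoulli's
    inequality bounds (s / r)^n = (1 + h)^n below by 1 + n h, and multiplying this by 1 + 1 / h
    exceeds n + 1. *)
Lemma linear_geo (r : R) : (0 < r < 1)%R -> exists K s : R, (0 < s < 1)%R /\ (0 < K)%R /\
  forall n : nat, ((INR n + 1) * r ^ n <= K * s ^ n)%R.
Proof.
  intros Hr. set (s := ((1 + r) / 2)%R). set (h := (s / r - 1)%R).
  assert (Hh : (0 < h)%R).
  { unfold h, s. apply Rmult_lt_reg_r with r; [lra|]. field_simplify; lra. }
  exists (1 + / h)%R, s. split; [unfold s; lra|]. assert (H := Rinv_0_lt_compat h Hh).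
  split; [lra|]. intros n.
  assert (Hp := poly n h Hh).
  replace (1 + h)%R with (s / r)%R in Hp by (unfold h; ring).
  replace (s ^ n)%R with ((s / r) ^ n * r ^ n)%R
    by (rewrite <- Rpow_mult_distr; f_equal; field; lra).
  rewrite <- Rmult_assoc. apply Rmult_le_compat_r; [apply pow_le; lra|].
  apply Rle_trans with ((1 + / h) * (1 + INR n * h))%R.
  - replace ((1 + / h) * (1 + INR n * h))%R with (INR n + 1 + INR n * h + / h)%R by (field; lra).
    assert (H1 := pos_INR n). nra.
  - apply Rmult_le_compat_l; lra.
Qed.

(** From [N] on, u_n 2^n is nonincreasing, so it never exceeds the sum of its values at the indices
    0 to N, which is the constant chosen. *)
Lemma ratio_bound (u r : nat -> R) N : (forall n, (0 <= u n)%R) ->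
  (forall n, (u (S n) = r n * u n)%R) -> (forall n, (N <= n)%nat -> (r n <= / 2)%R) ->
  exists K, forall n, (u n <= K * (/ 2) ^ n)%R.
Proof.
  intros Hu Hr HN.
  exists (rsum (fun n => (u n * 2 ^ n)%R) (seq 0 (S N))). intros n.
  assert (Hn0 : (0 < 2 ^ n)%R) by (apply pow_lt; lra).
  apply Rmult_le_reg_r with (2 ^ n)%R; auto.
  rewrite Rmult_assoc, <- Rpow_mult_distr, Rinv_l, pow1, Rmult_1_r by lra.
  assert (Hpos : forall n, (0 <= u n * 2 ^ n)%R).
  { intros k; apply Rmult_le_pos; auto. apply pow_le; lra. }
  assert (Hle : forall k, (k <= N)%nat ->
    (u k * 2 ^ k <= rsum (fun n => (u n * 2 ^ n)%R) (seq 0 (S N)))%R).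
  { intros k Hk. replace (u k * 2 ^ k)%R with (rsum (fun n => (u n * 2 ^ n)%R) [k])
      by (simpl; ring). apply rsum_incl; auto; try apply seq_NoDup.
    - repeat constructor; auto.
    - intros i [<-|[]]. apply in_seq; lia. }
  destruct (le_lt_dec n N); [auto|].
  replace n with (N + (n - N))%nat by lia. induction (n - N)%nat as [|m IH].
  - rewrite Nat.add_0_r; auto.
  - eapply Rle_trans; [|apply IH]. rewrite Nat.add_succ_r. rewrite Hr. simpl.
    specialize (HN (N + m)%nat ltac:(lia)). specialize (Hpos (N + m)%nat). nra.
Qed.

(** * Convergence and perturbation of infinite products *)

Lemma Cprod_nat_S (f : nat -> C) N : Cprod_nat f (S N) = (Cprod_nat f N : C) * f N :> C.
Proof. reflexivity. Qed.

Lemma Cprod_nat_ext (f g : nat -> C) N : (forall i, (i < N)%nat -> f i = g i) -> Cprod_nat f N = Cprod_nat g N :> C.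
Proof.
  induction N as [|N IH]; intros H; auto. rewrite !Cprod_nat_S, IH, H; auto.
Qed.

Lemma Cprod_nat_mult (f g : nat -> C) N :
  Cprod_nat (fun i => f i * g i) N = Cprod_nat f N * Cprod_nat g N :> C.
Proof.
  induction N as [|N IH]; [simpl; change (RtoC 1 = 1 * 1); ring|].
  rewrite !Cprod_nat_S, IH. ring.
Qed.

Lemma Cprod_nat_bound (u : nat -> C) (M : R) : (forall N, (rsum (fun i => Cmod (u i)) (seq 0 N) <= M)%R) ->
  forall N, (Cmod (Cprod_nat (fun i => 1 + u i)%C N) <= exp M)%R.
Proof.
  intros HM N.
  apply Rle_trans with (exp (rsum (fun i => Cmod (u i)) (seq 0 N)))%R.
  - clear HM. induction N as [|N IH].
    + simpl. change (Cmod 1 <= exp 0)%R. rewrite Cmod_1, exp_0. lra.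
    + rewrite Cprod_nat_S, Cmod_mult, seq_S, rsum_app. simpl. rewrite Rplus_0_r, exp_plus.
      apply Rmult_le_compat; auto; try apply Cmod_ge_0.
      eapply Rle_trans; [apply Cmod_triangle|]. rewrite Cmod_1.
      destruct (Req_dec (Cmod (u N)) 0) as [->|Hn]; [rewrite exp_0; lra|].
      assert (H := Cmod_ge_0 (u N)). left. apply exp_ineq1; lra.
  - destruct (Rle_lt_or_eq_dec _ _ (HM N)) as [H|H]; [left; apply exp_increasing; auto|].
    rewrite H; lra.
Qed.

Lemma asum_seq_bound (u : nat -> C) : asum u -> exists M : R, (0 <= M)%R /\
  forall N, (rsum (fun i => Cmod (u i)) (seq 0 N) <= M)%R.
Proof.
  intros [M HM]. exists M. split; [apply (HM nil); constructor|].
  intros N. apply HM, seq_NoDup.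
Qed.

(** The increment P_(n+1) - P_n = P_n u_n is at most exp(M) |u_n|, so the partial products are the
    partial sums of an absolutely summable series. *)
Lemma prod_cv (u : nat -> C) : asum u -> exists l, Cseq_cv (Cprod_nat (fun i => 1 + u i)%C) l.
Proof.
  intros Hu. destruct (asum_seq_bound u Hu) as [M [HM0 HM]].
  assert (Hb := Cprod_nat_bound u M HM).
  destruct (asum_hsum (fun n => Cprod_nat (fun i => 1 + u i)%C n * u n)) as [s Hs].
  - eapply asum_le; [|apply (rbounded_scal (exp M) _ (Rlt_le _ _ (exp_pos M)) Hu)].
    intros i; simpl. rewrite Cmod_mult. apply Rmult_le_compat_r; auto. apply Cmod_ge_0.
  - exists (1 + s). apply hsum_nat_cv in Hs.
    eapply cv_ext; [|apply (cv_plus _ _ _ _ (cv_const 1) Hs)].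
    intros n; simpl. induction n as [|n IH].
    + change (RtoC 1 + RtoC 0 = RtoC 1). ring.
    + rewrite Cprod_nat_S, <- IH at 1.
      change (Csum_nat (fun n0 => Cprod_nat (fun i => 1 + u i)%C n0 * u n0) (S n)) with
        (Csum_nat (fun n0 => Cprod_nat (fun i => 1 + u i)%C n0 * u n0) n
         + Cprod_nat (fun i => 1 + u i)%C n * u n). rewrite <- IH. ring.
Qed.

(** The reciprocal factors 1 - u / (1 + u) form a convergent product as well, thanks to the lower
    bound [c]. The two limits multiply to 1, so neither vanishes. *)
Lemma prod_cv_nz (u : nat -> C) (c : R) : asum u -> (0 < c)%R -> (forall i, (c <= Cmod (1 + u i))%R) ->
  exists l : C, l <> 0 /\ Cseq_cv (Cprod_nat (fun i => 1 + u i)%C) l.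
Proof.
  intros Hu Hc Hi.
  assert (Hnz : forall i, 1 + u i <> 0).
  { intros i H. specialize (Hi i). rewrite H, Cmod_0 in Hi. lra. }
  destruct (prod_cv u Hu) as [l Hl]. exists l. split; auto.
  destruct (prod_cv (fun i => - u i / (1 + u i))) as [m Hm].
  - eapply asum_le; [|apply (rbounded_scal (/ c) _ (Rlt_le _ _ (Rinv_0_lt_compat c Hc)) Hu)].
    intros i; simpl. rewrite Cmod_div, Cmod_opp by auto. unfold Rdiv. rewrite Rmult_comm.
    apply Rmult_le_compat_r; [apply Cmod_ge_0|]. apply Rinv_le_contravar; auto.
  - intros H0. apply C1_nz. apply (cv_unique (fun _ => RtoC 1)); [apply cv_const|].
    replace (RtoC 0) with (l * m) by (rewrite H0; ring).
    eapply cv_ext; [|apply (cv_mult _ _ _ _ Hl Hm)].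
    intros n; simpl. rewrite <- Cprod_nat_mult.
    clear -Hnz. induction n as [|n IH]; auto. rewrite Cprod_nat_S, IH. field; auto.
Qed.

(** The factors are exchanged one at a time. The induction carries the partial exponential
    [exp (rsum w (seq 0 N))], which absorbs each new factor, and bounds it by [exp M] only at the
    end. *)
Lemma prod_diff (u v : nat -> C) (w : nat -> R) (M : R) :
  (forall i, (Cmod (u i) <= w i)%R) -> (forall i, (Cmod (v i) <= w i)%R) ->
  (forall N, (rsum w (seq 0 N) <= M)%R) -> forall N,
  (Cmod (Cprod_nat (fun i => 1 + u i)%C N - Cprod_nat (fun i => 1 + v i)%C N)
   <= exp M * exp M * rsum (fun i => Cmod (u i - v i)) (seq 0 N))%R.
Proof.
  intros Hu Hv HM N.
  assert (HM0 : (0 <= M)%R) by apply (HM 0%nat).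
  assert (He : (1 <= exp M)%R) by (assert (H := exp_ge_taylor M 0 HM0); simpl in H; lra).
  assert (Hb : forall N, (Cmod (Cprod_nat (fun i => 1 + v i)%C N) <= exp M)%R).
  { apply Cprod_nat_bound. intros n. eapply Rle_trans; [|apply (HM n)]. apply rsum_le; auto. }
  assert (Hw : forall i, (0 <= w i)%R).
  { intros i. eapply Rle_trans; [apply Cmod_ge_0|apply Hu]. }
  apply Rle_trans with (exp M * exp (rsum w (seq 0 N))
    * rsum (fun i => Cmod (u i - v i)) (seq 0 N))%R.
  - induction N as [|N IH].
    + simpl. replace (C1 - C1) with (RtoC 0) by (unfold C1, Cminus, Cplus, Copp, RtoC; simpl; f_equal; ring).
      rewrite Cmod_0. lra.
    + rewrite !Cprod_nat_S, !seq_S, !rsum_app. simpl. rewrite !Rplus_0_r, exp_plus.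
      set (P := Cprod_nat (fun i => 1 + u i)%C N) in *. set (Q := Cprod_nat (fun i => 1 + v i)%C N) in *.
      set (E := exp (rsum w (seq 0 N))) in *.
      set (D := rsum (fun i => Cmod (u i - v i)) (seq 0 N)) in *.
      replace (P * (1 + u N) - Q * (1 + v N)) with ((P - Q) * (1 + u N) + Q * (u N - v N)) by ring.
      eapply Rle_trans; [apply Cmod_triangle|]. rewrite !Cmod_mult.
      assert (H1 : (Cmod (1 + u N) <= exp (w N))%R).
      { eapply Rle_trans; [apply Cmod_triangle|]. rewrite Cmod_1. specialize (Hu N).
        assert (H := exp_ge_taylor (w N) 1 (Hw N)). simpl in H. lra. }
      assert (H2 : (1 <= E)%R).
      { unfold E. assert (H := exp_ge_taylor _ 0 (rsum_nonneg w (seq 0 N) Hw)). simpl in H. lra. }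
      assert (H3 : (1 <= exp (w N))%R).
      { assert (H := exp_ge_taylor _ 0 (Hw N)). simpl in H. lra. }
      assert (H4 := Cmod_ge_0 (u N - v N)).
      assert (H5 : (0 <= D)%R) by (apply rsum_nonneg; intros; apply Cmod_ge_0).
      apply Rle_trans with (exp M * E * D * exp (w N) + exp M * Cmod (u N - v N))%R.
      * apply Rplus_le_compat.
        -- apply Rmult_le_compat; auto; apply Cmod_ge_0.
        -- apply Rmult_le_compat_r; auto. apply Hb.
      * rewrite Rmult_plus_distr_l. apply Rplus_le_compat.
        -- right; ring.
        -- apply Rmult_le_compat_r; auto.
           rewrite <- (Rmult_1_r (exp M)) at 1. apply Rmult_le_compat_l; [lra|]. nra.
  - apply Rmult_le_compat_r; [apply rsum_nonneg; intros; apply Cmod_ge_0|].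
    apply Rmult_le_compat_l; [lra|].
    destruct (Rle_lt_or_eq_dec _ _ (HM N)) as [H|H]; [left; apply exp_increasing; auto|].
    rewrite H; lra.
Qed.

(** The first bound controls the cross term (P - 1) u_N in the induction for the second. The second
    isolates the linear part of a product, which later becomes a logarithmic derivative. *)
Lemma prod_second_order (u : nat -> C) : forall N (S := rsum (fun i => Cmod (u i)) (seq 0 N)), (S <= / 2)%R ->
  (Cmod (Cprod_nat (fun i => 1 + u i)%C N - 1) <= 2 * S)%R /\
  (Cmod (Cprod_nat (fun i => 1 + u i)%C N - 1 - Csum_nat u N) <= 2 * S * S)%R.
Proof.
  induction N as [|N IH]; intros S HS.
  - unfold S; simpl. change C1 with (RtoC 1). change C0 with (RtoC 0).
    replace (RtoC 1 - RtoC 1 - RtoC 0) with (RtoC 0) by ring.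
    replace (RtoC 1 - RtoC 1) with (RtoC 0) by ring. rewrite Cmod_0. lra.
  - unfold S in *; clear S. rewrite seq_S, rsum_app in HS |- *. simpl in HS |- *.
    rewrite Rplus_0_r in *.
    set (S := rsum (fun i => Cmod (u i)) (seq 0 N)) in *.
    assert (HS0 : (0 <= S)%R) by (apply rsum_nonneg; intros; apply Cmod_ge_0).
    assert (Hu := Cmod_ge_0 (u N)).
    destruct IH as [H1 H2]; [lra|].
    change (Cmul (Cprod_nat (fun i => 1 + u i)%C N) (1 + u N))
      with (Cprod_nat (fun i => 1 + u i)%C N * (1 + u N)).
    change (Cadd (Csum_nat u N) (u N)) with (Csum_nat u N + u N).
    set (P := Cprod_nat (fun i => 1 + u i)%C N) in *. set (T := Csum_nat u N) in *.
    split.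
    + replace (P * (1 + u N) - 1) with ((P - 1) + ((P - 1) * u N + u N)) by ring.
      assert (H3 := Cmod_triangle (P - 1) ((P - 1) * u N + u N)).
      assert (H4 := Cmod_triangle ((P - 1) * u N) (u N)). rewrite Cmod_mult in H4.
      assert (Cmod (P - 1) * Cmod (u N) <= 1 * Cmod (u N))%R by (apply Rmult_le_compat_r; lra).
      lra.
    + replace (P * (1 + u N) - 1 - (T + u N)) with ((P - 1 - T) + (P - 1) * u N) by ring.
      assert (H3 := Cmod_triangle (P - 1 - T) ((P - 1) * u N)). rewrite Cmod_mult in H3.
      assert (Cmod (P - 1) * Cmod (u N) <= 2 * S * Cmod (u N))%R by (apply Rmult_le_compat_r; lra).
      nra.
Qed.

(** An arbitrary value when [f] is not summable. *)
Definition tsum {I : Type} (f : I -> C) : C := epsilon (inhabits (RtoC 0)) (hsum f).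

Lemma tsum_eq {I : Type} (f : I -> C) s : hsum f s -> tsum f = s.
Proof.
  intros H. apply (hsum_unique f); auto. unfold tsum. apply epsilon_spec. exists s; auto.
Qed.

Lemma tsum_spec {I : Type} (f : I -> C) : asum f -> hsum f (tsum f).
Proof. intros H. destruct (asum_hsum f H) as [s Hs]. rewrite (tsum_eq f s); auto. Qed.

Lemma cv_bounded (u : nat -> C) (l : C) : Cseq_cv u l ->
  exists M : R, (0 < M)%R /\ forall n, (Cmod (u n) <= M)%R.
Proof.
  rewrite Cseq_cvE. intros H. destruct (H 1%R Rlt_0_1) as [N HN].
  set (S := rsum (fun n => Cmod (u n)) (seq 0 N)).
  assert (HS : (0 <= S)%R) by (apply rsum_nonneg; intros; apply Cmod_ge_0).
  assert (Hl := Cmod_ge_0 l).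
  exists (S + (Cmod l + 1))%R. split; [lra|]. intros n.
  destruct (le_lt_dec N n) as [Hn|Hn].
  - specialize (HN n Hn). assert (H1 := Cmod_triangle (u n - l) l).
    replace (u n - l + l) with (u n) in H1 by ring. lra.
  - assert (Cmod (u n) <= S)%R; [|lra].
    replace (Cmod (u n)) with (rsum (fun n => Cmod (u n)) [n]) by (simpl; ring).
    apply rsum_incl; try apply seq_NoDup.
    + intros; apply Cmod_ge_0.
    + repeat constructor; auto.
    + intros i [<-|[]]. apply in_seq; lia.
Qed.

Lemma cv_inv (u : nat -> C) (l : C) : (forall n, u n <> 0) -> l <> 0 -> Cseq_cv u l ->
  Cseq_cv (fun n => / u n) (/ l).
Proof.
  rewrite !Cseq_cvE. intros Hu Hl H eps He.
  assert (Hl0 : (0 < Cmod l)%R) by (apply Cmod_gt_0; auto).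
  set (d := Rmin (Cmod l / 2) (eps * (Cmod l * Cmod l) / 2)).
  assert (Hd : (0 < d)%R).
  { apply Rmin_pos; [lra|]. apply Rdiv_lt_0_compat; [|lra]. repeat apply Rmult_lt_0_compat; auto. }
  destruct (H d Hd) as [N HN]. exists N. intros n Hn. specialize (HN n Hn).
  assert (H1 : (d <= Cmod l / 2)%R) by apply Rmin_l.
  assert (H2 : (d <= eps * (Cmod l * Cmod l) / 2)%R) by apply Rmin_r.
  assert (H3 : (Cmod l / 2 < Cmod (u n))%R).
  { assert (H3 := Cmod_triangle (l - u n) (u n)).
    replace (l - u n + u n) with l in H3 by ring. rewrite (Cmod_sym l (u n)) in H3. lra. }
  replace (/ u n - / l) with ((l - u n) / (u n * l)) by (field; auto).
  rewrite Cmod_div, Cmod_mult, Cmod_sym by (apply Cmult_neq_0; auto).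
  apply Rmult_lt_reg_r with (Cmod (u n) * Cmod l)%R; [apply Rmult_lt_0_compat; lra|].
  unfold Rdiv. rewrite Rmult_assoc, Rinv_l, Rmult_1_r by (apply Rgt_not_eq, Rmult_lt_0_compat; lra).
  apply Rlt_le_trans with d; auto.
  eapply Rle_trans; [apply H2|]. unfold Rdiv. rewrite Rmult_assoc.
  apply Rmult_le_compat_l; [lra|]. nra.
Qed.

Lemma cv_pow (z : C) : (Cmod z < 1)%R -> Cseq_cv (fun n => z ^ n) (RtoC 0).
Proof.
  intros Hz. apply cv_squeeze with (fun n => (Cmod z ^ n)%R).
  - intros n. replace (z ^ n - 0) with (z ^ n) by ring. rewrite Cmod_pow. lra.
  - apply is_lim_seq_geom. rewrite Rabs_pos_eq; [auto|apply Cmod_ge_0].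
Qed.

(** Over the window from -N to N the differences collapse to f(N) - f(-N-1). *)
Lemma hsum_telescope (f : Z -> C) (p m : C) : asum (fun n => f n - f (n - 1)%Z) ->
  Cseq_cv (fun n => f (Z.of_nat n)) p -> Cseq_cv (fun n => f (- Z.of_nat n)%Z) m ->
  hsum (fun n => f n - f (n - 1)%Z) (p - m).
Proof.
  intros Ha Hp Hm. destruct (asum_hsum _ Ha) as [s Hs].
  replace (p - m) with s; auto.
  apply hsum_Z_cv in Hs. apply (cv_unique _ _ _ Hs).
  apply cv_ext with (fun N => f (Z.of_nat N) - f (- Z.of_nat (S N))%Z).
  - intros N.
    assert (H : forall M, (Csum_nat (fun k => f (Z.of_nat k - Z.of_nat N)%Z
      - f (Z.of_nat k - Z.of_nat N - 1)%Z) M : C)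
      = f (Z.of_nat M - Z.of_nat N - 1)%Z - f (- Z.of_nat (S N))%Z).
    { induction M as [|M IH].
      - replace (Z.of_nat 0 - Z.of_nat N - 1)%Z with (- Z.of_nat (S N))%Z by lia.
        change (RtoC 0 = f (- Z.of_nat (S N))%Z - f (- Z.of_nat (S N))%Z). ring.
      - match goal with |- Csum_nat ?g (S M) = _ => change (Csum_nat g M + g M
          = f (Z.of_nat (S M) - Z.of_nat N - 1)%Z - f (- Z.of_nat (S N))%Z :> C) end.
        rewrite IH. replace (Z.of_nat (S M) - Z.of_nat N - 1)%Z with (Z.of_nat M - Z.of_nat N)%Z
          by lia. ring. }
    rewrite H. f_equal. f_equal. lia.
  - apply cv_minus; auto.
    apply (cv_subseq (fun n => f (- Z.of_nat n)%Z) m S); auto.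
Qed.

Lemma hsum_shift (f : Z -> C) s (k : Z) : hsum f s -> hsum (fun n => f (n + k)%Z) s.
Proof.
  apply (hsum_bij (fun n : Z => (n + k)%Z) (fun n => (n - k)%Z)); intros; lia.
Qed.

Lemma hsum_reflect (f : Z -> C) s (k : Z) : hsum f s -> hsum (fun n => f (k - n)%Z) s.
Proof.
  apply (hsum_bij (fun n : Z => (k - n)%Z) (fun n => (k - n)%Z)); intros; lia.
Qed.

(** * The triple product *)

Section Theta.

Context (Q : C) (HQ0 : Q <> 0) (HQ1 : (Cmod Q < 1)%R).

Lemma nome_pos : (0 < Cmod Q)%R.
Proof. apply Cmod_gt_0; auto. Qed.

(** The coefficient of a^n in Jacobi's theta function (a;Q)_oo (Q/a;Q)_oo (Q;Q)_oo, whose series is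
    [jth]. *)
Definition gam (n : Z) : C := zpow (-(1)) n * zpow Q (n * (n - 1) / 2).

Lemma m1_nz : -(1) <> RtoC 0.
Proof. intros H. apply C1_nz. replace (RtoC 1) with (- -(1)) by ring. rewrite H. ring. Qed.

Lemma gam_0 : gam 0 = 1.
Proof. unfold gam. simpl. ring. Qed.

Lemma gam_succ n : gam (n + 1) = - zpow Q n * gam n.
Proof.
  unfold gam. rewrite zpow_succ by apply m1_nz.
  replace ((n + 1) * (n + 1 - 1))%Z with (n * (n - 1) + n * 2)%Z by ring.
  rewrite Z.div_add, zpow_add by (auto; lia). ring.
Qed.

Lemma zpow_m1_sqr n : zpow (-(1)) n * zpow (-(1)) n = 1.
Proof.
  rewrite <- zpow_mult by apply m1_nz. replace (-(1) * -(1)) with (RtoC 1) by ring.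
  apply zpow_one.
Qed.

Lemma zpow_m1_opp n : zpow (-(1)) (- n) = zpow (-(1)) n.
Proof.
  assert (H := zpow_m1_sqr n). rewrite zpow_opp by apply m1_nz.
  assert (Hz := zpow_nz _ n m1_nz).
  replace (zpow (-(1)) n) with (/ zpow (-(1)) n * (zpow (-(1)) n * zpow (-(1)) n)) at 2
    by (field; auto).
  rewrite H. ring.
Qed.

Lemma gam_anti n : gam (1 - n) = - gam n.
Proof.
  unfold gam. replace ((1 - n) * (1 - n - 1))%Z with (n * (n - 1))%Z by ring.
  unfold Z.sub at 1. rewrite zpow_add, zpow_m1_opp, zpow_1 by apply m1_nz. ring.
Qed.

Lemma gam_pred n : gam (n - 1) = - zpow Q (1 - n) * gam n.
Proof.
  assert (H := gam_succ (n - 1)). replace (n - 1 + 1)%Z with n in H by lia. rewrite H.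
  replace (1 - n)%Z with (- (n - 1))%Z by lia. rewrite zpow_opp by auto.
  field. apply zpow_nz; auto.
Qed.

Lemma geo_half (A : R) : (0 <= A)%R -> exists N, forall n, (N <= n)%nat ->
  (Cmod Q ^ n * A <= / 2)%R.
Proof.
  intros HA. assert (H := cv_pow Q HQ1). rewrite Cseq_cvE in H.
  destruct (H (/ (2 * (A + 1)))%R) as [N HN]; [apply Rinv_0_lt_compat; lra|].
  exists N. intros n Hn. specialize (HN n Hn).
  replace (Q ^ n - 0) with (Q ^ n) in HN by ring. rewrite Cmod_pow in HN.
  assert (H0 : (0 <= Cmod Q ^ n)%R) by (apply pow_le, Cmod_ge_0).
  apply Rle_trans with (/ (2 * (A + 1)) * (A + 1))%R; [|right; field; lra].
  apply Rmult_le_compat; lra.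
Qed.

(** Consecutive terms have ratio of modulus |Q|^n |a| towards plus infinity and |Q|^(n+1) / |a|
    towards minus infinity. Both are eventually at most 1/2. *)
Lemma gam_bound (a : C) : a <> 0 -> exists K : R, forall n,
  (Cmod (gam n * zpow a n) <= K * (/ 2) ^ Z.abs_nat n)%R.
Proof.
  intros Ha. assert (HA : (0 < Cmod a)%R) by (apply Cmod_gt_0; auto).
  destruct (geo_half (Cmod a)) as [N1 HN1]; [lra|].
  destruct (ratio_bound (fun n => Cmod (gam (Z.of_nat n) * zpow a (Z.of_nat n)))
    (fun n => (Cmod Q ^ n * Cmod a)%R) N1) as [K1 H1]; auto.
  { intros; apply Cmod_ge_0. }
  { intros n. replace (Z.of_nat (S n)) with (Z.of_nat n + 1)%Z by lia.
    rewrite gam_succ, zpow_succ, zpow_of_nat by auto.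
    rewrite !Cmod_mult, Cmod_opp, Cmod_pow. ring. }
  destruct (geo_half (/ Cmod a)) as [N2 HN2]; [left; apply Rinv_0_lt_compat; auto|].
  destruct (ratio_bound (fun n => Cmod (gam (- Z.of_nat n) * zpow a (- Z.of_nat n)))
    (fun n => (Cmod Q ^ S n * / Cmod a)%R) N2) as [K2 H2]; auto.
  { intros; apply Cmod_ge_0. }
  { intros n. replace (- Z.of_nat (S n))%Z with (- Z.of_nat n - 1)%Z by lia.
    rewrite gam_pred, (zpow_sub a _ 1), zpow_1 by auto.
    replace (1 - - Z.of_nat n)%Z with (Z.of_nat (S n)) by lia. rewrite zpow_of_nat.
    rewrite !Cmod_mult, Cmod_div, Cmod_opp, Cmod_pow by auto. unfold Rdiv. ring. }
  exists (Rmax K1 K2). intros n.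
  assert (Hp : forall k, (0 <= (/ 2) ^ k)%R) by (intros; apply pow_le; lra).
  destruct (Z_le_gt_dec 0 n) as [Hn|Hn].
  - specialize (H1 (Z.abs_nat n)). rewrite Zabs2Nat.id_abs, Z.abs_eq in H1 by auto.
    eapply Rle_trans; [apply H1|]. apply Rmult_le_compat_r; [apply Hp | apply Rmax_l].
  - specialize (H2 (Z.abs_nat n)). rewrite Zabs2Nat.id_abs, Z.abs_neq, Z.opp_involutive in H2 by lia.
    eapply Rle_trans; [apply H2|]. apply Rmult_le_compat_r; [apply Hp | apply Rmax_r].
Qed.

Lemma asum_gam (a : C) : a <> 0 -> asum (fun n => gam n * zpow a n).
Proof.
  intros Ha. destruct (gam_bound a Ha) as [K HK]. apply (asum_geo_Z _ K (/ 2)); auto. lra.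
Qed.

Definition jth (a : C) : C := tsum (fun n => gam n * zpow a n).

Lemma jth_spec (a : C) : a <> 0 -> hsum (fun n => gam n * zpow a n) (jth a).
Proof. intros Ha. apply tsum_spec, asum_gam; auto. Qed.

(** The theta function vanishes at a = 1: the reflection n -> 1 - n changes the sign of every
    coefficient. *)
Lemma hsum_gam : hsum gam 0.
Proof.
  assert (H : hsum gam (jth 1)).
  { eapply hsum_ext; [|apply (jth_spec 1); apply C1_nz].
    intros n; simpl. rewrite zpow_one. ring. }
  assert (H2 : jth 1 = - jth 1).
  { replace (- jth 1) with (-(1) * jth 1) by ring. apply (hsum_unique gam); auto.
    apply hsum_ext with (fun n => -(1) * gam (1 - n)%Z).
    - intros n. rewrite gam_anti. ring.
    - apply hsum_scal, hsum_reflect; auto. }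
  replace (RtoC 0) with (jth 1); auto.
  assert (H3 : jth 1 + jth 1 = 0) by (rewrite H2 at 1; ring).
  replace (jth 1) with ((jth 1 + jth 1) / 2) by field. rewrite H3. field.
Qed.

(** The finite product (Q;Q)_m, in the form 1 + u required by the product lemmas. *)
Definition qp (m : nat) : C := Cprod_nat (fun i => 1 + - Q ^ S i) m.

Lemma qp_S m : qp (S m) = qp m * (1 - Q ^ S m).
Proof. reflexivity. Qed.

Lemma asum_nome_pow : asum (fun i : nat => Q ^ S i).
Proof.
  apply asum_le with (fun i => (Cmod Q * Cmod Q ^ i)%R).
  - intros i. rewrite Cmod_pow. simpl. lra.
  - apply rbounded_scal; [apply Cmod_ge_0|]. apply rbounded_geo. split; auto. apply Cmod_ge_0.
Qed.

Lemma Cmod_1_minus (z : C) (r : R) : (Cmod z <= r)%R -> (1 - r <= Cmod (1 - z))%R.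
Proof.
  intros H. assert (H1 := Cmod_triangle (1 - z) z).
  replace (1 - z + z) with (RtoC 1) in H1 by ring. rewrite Cmod_1 in H1. lra.
Qed.

Lemma Cmod_nome_pow i : (Cmod (Q ^ S i) <= Cmod Q)%R.
Proof.
  rewrite Cmod_pow. simpl. apply Rle_trans with (Cmod Q * 1)%R; [|lra].
  apply Rmult_le_compat_l; [apply Cmod_ge_0|]. rewrite <- (pow1 i).
  apply pow_incr. split; [apply Cmod_ge_0 | lra].
Qed.

Lemma qp_cv : exists L : C, L <> 0 /\ Cseq_cv qp L.
Proof.
  apply prod_cv_nz with (1 - Cmod Q)%R.
  - eapply asum_ext; [|apply (asum_scal (-(1)) _ asum_nome_pow)]. intros; simpl; ring.
  - lra.
  - intros i. apply (Cmod_1_minus (Q ^ S i)). apply Cmod_nome_pow.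
Qed.

Lemma qp_nz m : qp m <> 0.
Proof.
  induction m as [|m IH]; [apply C1_nz|]. rewrite qp_S. apply Cmult_neq_0; auto.
  intros H. assert (H1 := Cmod_1_minus _ _ (Cmod_nome_pow m)). rewrite H, Cmod_0 in H1. lra.
Qed.

Definition qinf : C := Clim qp.

Lemma qinf_spec : Cseq_cv qp qinf.
Proof. destruct qp_cv as [L [_ HL]]. unfold qinf. rewrite (Clim_eq _ _ HL). auto. Qed.

Lemma qinf_nz : qinf <> 0.
Proof. destruct qp_cv as [L [HL HL']]. unfold qinf. rewrite (Clim_eq _ _ HL'). auto. Qed.

(** [1 / (Q;Q)_m], extended by 0 so that [rho_pred] holds for every integer [m]. *)
Definition rho (m : Z) : C := if Z_lt_dec m 0 then 0 else / qp (Z.to_nat m).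

Lemma rho_pred m : rho (m - 1) = (1 - zpow Q m) * rho m.
Proof.
  unfold rho. destruct (Z_lt_dec (m - 1) 0), (Z_lt_dec m 0); try lia.
  - ring.
  - replace m with 0%Z by lia. rewrite zpow_0. ring.
  - replace (Z.to_nat m) with (S (Z.to_nat (m - 1))) by lia. rewrite qp_S.
    replace (zpow Q m) with (Q ^ S (Z.to_nat (m - 1)))
      by (rewrite <- zpow_of_nat; f_equal; lia).
    assert (H := qp_nz (S (Z.to_nat (m - 1)))). rewrite qp_S in H.
    assert (H1 := qp_nz (Z.to_nat (m - 1))). field. split; auto.
    intros H2. apply H. rewrite H2. ring.
Qed.

Definition jprod (a : C) (N : nat) : C :=
  Cprod_nat (fun i => (1 - a * Q ^ i) * (1 - Q ^ S i / a)) N.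

(** The finite triple product: [rho (N - n) * rho (N + n) * qp (2 * N)] is the Gaussian binomial
    [2N choose N+n]. The induction expands the new factor (1 - a Q^N)(1 - Q^(N+1)/a) and compares
    coefficients of a^n; the zero values of [rho] make the boundary cases uniform. *)
Lemma jprod_finite (a : C) : a <> 0 -> forall N,
  hsum (fun n => gam n * (rho (Z.of_nat N - n) * rho (Z.of_nat N + n)) * qp (2 * N) * zpow a n)
    (jprod a N).
Proof.
  intros Ha. induction N as [|N IH].
  - match goal with |- hsum ?f _ => replace (jprod a 0) with (csum f [0%Z]) end.
    + apply hsum_finite; [repeat constructor; auto|]. intros n Hn.
      unfold rho. destruct (Z_lt_dec (Z.of_nat 0 - n) 0); [ring|].
      destruct (Z_lt_dec (Z.of_nat 0 + n) 0); [ring|].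
      exfalso; apply Hn; left; lia.
    + unfold csum, fold_right. rewrite gam_0. change (rho (Z.of_nat 0 - 0)) with (/ qp 0).
      change (rho (Z.of_nat 0 + 0)) with (/ qp 0). change (qp (2 * 0)) with (qp 0).
      change (qp 0) with (RtoC 1). change (jprod a 0) with (RtoC 1). rewrite zpow_0.
      field.
  - replace (jprod a (S N)) with ((1 + Q ^ (2 * N + 1)) * jprod a N
      - Q ^ N * (a * jprod a N) - Q ^ S N * (/ a * jprod a N)).
    2:{ unfold jprod at 4. rewrite Cprod_nat_S. fold (jprod a N).
        replace (2 * N + 1)%nat with (N + S N)%nat by lia. rewrite Cpow_add_r. field. auto. }
    eapply hsum_ext; [|apply hsum_minus; [apply hsum_minus|]; apply hsum_scal; [apply IH|
      apply (hsum_scal a), (hsum_shift _ _ (-1) IH)|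
      apply (hsum_scal (/ a)), (hsum_shift _ _ 1 IH)]].
    intros n. cbv beta.
    replace (Z.of_nat N - (n + -1))%Z with (Z.of_nat (S N) - n)%Z by lia.
    replace (Z.of_nat N + (n + -1))%Z with (Z.of_nat (S N) + n - 1 - 1)%Z by lia.
    replace (Z.of_nat N - (n + 1))%Z with (Z.of_nat (S N) - n - 1 - 1)%Z by lia.
    replace (Z.of_nat N + (n + 1))%Z with (Z.of_nat (S N) + n)%Z by lia.
    replace (Z.of_nat N - n)%Z with (Z.of_nat (S N) - n - 1)%Z by lia.
    replace (Z.of_nat N + n)%Z with (Z.of_nat (S N) + n - 1)%Z by lia.
    rewrite !rho_pred.
    replace (n + -1)%Z with (n - 1)%Z by lia. rewrite gam_pred, gam_succ.
    replace (2 * S N)%nat with (S (S (2 * N))) by lia. rewrite !qp_S.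
    rewrite !zpow_sub, !zpow_add, zpow_1, !zpow_of_nat by auto.
    replace (2 * N + 1)%nat with (S (N + N)) by lia.
    replace (2 * N)%nat with (N + N)%nat by lia.
    simpl Cpow. rewrite !Cpow_add_r.
    generalize (rho (Z.of_nat (S N) - n)) (rho (Z.of_nat (S N) + n)) (qp (N + N)) (gam n).
    intros. assert (H1 := zpow_nz Q n HQ0). assert (H2 := zpow_nz a n Ha).
    assert (H3 := Cpow_nz Q N HQ0). rewrite zpow_1.
    field. auto.
Qed.

Lemma rho_bounded : exists M : R, (0 < M)%R /\ forall m, (Cmod (rho m) <= M)%R.
Proof.
  destruct (cv_bounded _ _ (cv_inv qp qinf qp_nz qinf_nz qinf_spec)) as [M [HM H]].
  exists M. split; auto. intros m. unfold rho. destruct (Z_lt_dec m 0); auto.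
  rewrite Cmod_0. lra.
Qed.

Lemma rho_cv (k n : Z) : (k = 1 \/ k = -1)%Z ->
  Cseq_cv (fun N => rho (Z.of_nat N + k * n)) (/ qinf).
Proof.
  intros Hk. assert (H := cv_inv qp qinf qp_nz qinf_nz qinf_spec).
  rewrite Cseq_cvE in *. intros eps He. destruct (H eps He) as [N HN].
  exists (N + Z.abs_nat n)%nat. intros m Hm. unfold rho.
  destruct (Z_lt_dec (Z.of_nat m + k * n) 0); [lia|]. apply HN. lia.
Qed.

(** In the finite form each Gaussian binomial tends to 1 / (Q;Q)_oo and stays bounded, so the limit
    is taken termwise by [hsum_tannery]. *)
Lemma jprod_cv (a : C) : a <> 0 -> Cseq_cv (jprod a) (jth a / qinf).
Proof.
  intros Ha. destruct rho_bounded as [M [HM HMb]].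
  destruct (cv_bounded _ _ qinf_spec) as [M' [HM' HMb']].
  apply (hsum_tannery
    (fun N n => gam n * (rho (Z.of_nat N - n) * rho (Z.of_nat N + n)) * qp (2 * N) * zpow a n)
    (fun n => / qinf * (gam n * zpow a n))
    (fun n => (M * M * M' * Cmod (gam n * zpow a n))%R)).
  - intros N n. replace (gam n * (rho (Z.of_nat N - n) * rho (Z.of_nat N + n)) * qp (2 * N) * zpow a n)
      with ((rho (Z.of_nat N - n) * rho (Z.of_nat N + n) * qp (2 * N)) * (gam n * zpow a n)) by ring.
    rewrite Cmod_mult. apply Rmult_le_compat_r; [apply Cmod_ge_0|].
    rewrite !Cmod_mult. repeat apply Rmult_le_compat; auto; try apply Rmult_le_pos; apply Cmod_ge_0.
  - apply rbounded_scal; [|apply asum_gam; auto].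
    repeat apply Rmult_le_pos; lra.
  - intros n. replace (/ qinf * (gam n * zpow a n))
      with (gam n * (/ qinf * / qinf) * qinf * zpow a n) by (field; apply qinf_nz).
    apply cv_mult; [|apply cv_const]. apply cv_mult; [apply cv_scal, cv_mult|].
    + eapply cv_ext; [|apply (rho_cv (-1) n); auto]. intros N; cbv beta; f_equal; lia.
    + eapply cv_ext; [|apply (rho_cv 1 n); auto]. intros N; cbv beta; f_equal; lia.
    + apply (cv_subseq qp qinf (fun N => (2 * N)%nat)); [intros; lia|apply qinf_spec].
  - apply jprod_finite; auto.
  - replace (jth a / qinf) with (/ qinf * jth a) by (unfold Cdiv; ring).
    apply hsum_scal, jth_spec; auto.
Qed.

Lemma jacobi_triple_product (a : C) : a <> 0 ->
  Cseq_cv (fun N => jprod a N * qp N) (jth a).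
Proof.
  intros Ha. replace (jth a) with (jth a / qinf * qinf) by (field; apply qinf_nz).
  apply cv_mult; [apply jprod_cv; auto | apply qinf_spec].
Qed.

(** The triple product without its factor 1 - a. It remains meaningful at a = 1, where it tends to
    (Q;Q)_oo^3. *)
Definition Jprod (a : C) (N : nat) : C :=
  Cprod_nat (fun i => (1 - a * Q ^ S i) * (1 - Q ^ S i / a)) N * qp N.

Lemma Jprod_jprod (a : C) N : jprod a N * qp N * (1 - a * Q ^ N) = (1 - a) * Jprod a N.
Proof.
  unfold Jprod, jprod. induction N as [|N IH].
  - simpl. change (1 * qp 0 * (1 - a * 1) = (1 - a) * (1 * qp 0)). ring.
  - rewrite !Cprod_nat_S, qp_S.
    transitivity (Cprod_nat (fun i => (1 - a * Q ^ i) * (1 - Q ^ S i / a)) N * qp N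
      * (1 - a * Q ^ N) * ((1 - Q ^ S N / a) * (1 - Q ^ S N) * (1 - a * Q ^ S N))); [ring|].
    rewrite IH. ring.
Qed.

Lemma Jprod_cv (a l : C) : a <> 0 -> Cseq_cv (Jprod a) l -> jth a = (1 - a) * l.
Proof.
  intros Ha Hl. apply (cv_unique (fun N => jprod a N * qp N * (1 - a * Q ^ N))).
  - replace (jth a) with (jth a * (1 - a * 0)) by ring.
    apply cv_mult; [apply jacobi_triple_product; auto|].
    apply cv_minus; [apply cv_const|]. apply cv_scal, cv_pow; auto.
  - eapply cv_ext; [intros N; symmetry; apply Jprod_jprod|]. apply cv_scal; auto.
Qed.

Lemma Jprod_cv_ne1 (a : C) : a <> 0 -> a <> 1 -> Cseq_cv (Jprod a) (jth a / (1 - a)).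
Proof.
  intros Ha Ha1. assert (H1 : 1 - a <> 0).
  { intros H. apply Ha1. replace a with (1 - (1 - a)) by ring. rewrite H. ring. }
  apply cv_ext with (fun N => jprod a N * qp N * (1 - a * Q ^ N) * / (1 - a)).
  - intros N. rewrite Jprod_jprod. field; auto.
  - replace (jth a / (1 - a)) with (jth a * (1 - a * 0) * / (1 - a)) by (field; auto).
    apply cv_mult; [|apply cv_const]. apply cv_mult; [apply jacobi_triple_product; auto|].
    apply cv_minus; [apply cv_const|]. apply cv_scal, cv_pow; auto.
Qed.

End Theta.

(** * Kronecker's identity *)

Section Kronecker.

Context (Q : C) (HQ0 : Q <> 0) (HQ1 : (Cmod Q < 1)%R).
Context (b : C) (Hb0 : b <> 0) (Hb : forall n, 1 - b * zpow Q n <> 0).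

Definition kre (n : Z) : C := / (1 - b * zpow Q n).

(** The coefficients of (1 - a) times Kronecker's series, the sum of a^n / (1 - b Q^n). They decay
    like |Q|^|n|, so the series converges for |Q| < |a| < 1 / |Q|, which includes the unit
    circle. *)
Definition krd (n : Z) : C := kre n - kre (n - 1).

Lemma kre_cv : Cseq_cv (fun n => kre (Z.of_nat n)) (RtoC 1).
Proof.
  replace (RtoC 1) with (/ (1 - b * 0)) by (field; intros H; apply C1_nz; rewrite <- H; ring).
  apply (cv_inv (fun n => 1 - b * zpow Q (Z.of_nat n))).
  - intros; apply Hb.
  - replace (1 - b * 0) with (RtoC 1) by ring. apply C1_nz.
  - apply cv_minus; [apply cv_const|]. apply cv_scal.
    eapply cv_ext; [|apply (cv_pow Q HQ1)]. intros n. rewrite zpow_of_nat. auto.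
Qed.

Lemma kre_opp n : kre (- n) = zpow Q n * / (zpow Q n - b).
Proof.
  assert (H := Hb (- n)%Z). unfold kre. rewrite zpow_opp in * by auto.
  assert (Hz := zpow_nz Q n HQ0).
  assert (H1 : zpow Q n - b <> 0).
  { intros H1. apply H. replace (1 - b * / zpow Q n) with ((zpow Q n - b) / zpow Q n)
      by (field; auto). rewrite H1. field; auto. }
  field. auto.
Qed.

Lemma kre_opp_cv_aux : Cseq_cv (fun n => / (zpow Q (Z.of_nat n) - b)) (/ - b).
Proof.
  replace (- b) with (0 - b) by ring.
  apply (cv_inv (fun n => zpow Q (Z.of_nat n) - b)).
  - intros n H1. apply (Hb (- Z.of_nat n)%Z). rewrite zpow_opp by auto.
    assert (Hz := zpow_nz Q (Z.of_nat n) HQ0).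
    replace (1 - b * / zpow Q (Z.of_nat n)) with ((zpow Q (Z.of_nat n) - b) / zpow Q (Z.of_nat n))
      by (field; auto). rewrite H1. field; auto.
  - intros H. apply Hb0. replace b with (- (0 - b)) by ring. rewrite H. ring.
  - apply cv_minus; [|apply cv_const].
    eapply cv_ext; [|apply (cv_pow Q HQ1)]. intros n. rewrite zpow_of_nat. auto.
Qed.

Lemma kre_bounds : exists K : R, (0 < K)%R /\
  (forall n : nat, (Cmod (1 - kre (Z.of_nat n)) <= K * Cmod Q ^ n)%R) /\
  (forall n : nat, (Cmod (kre (- Z.of_nat n)) <= K * Cmod Q ^ n)%R).
Proof.
  destruct (cv_bounded _ _ kre_cv) as [M1 [HM1 H1]].
  destruct (cv_bounded _ _ kre_opp_cv_aux) as [M2 [HM2 H2]].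
  assert (Hbp := Cmod_ge_0 b).
  assert (HQn : forall n, (0 <= Cmod Q ^ n)%R) by (intros; apply pow_le, Cmod_ge_0).
  exists (Cmod b * M1 + M2)%R. split; [nra|]. split; intros n.
  - replace (1 - kre (Z.of_nat n)) with (- (Q ^ n * (b * kre (Z.of_nat n)))).
    + rewrite Cmod_opp, !Cmod_mult, Cmod_pow, Rmult_comm.
      apply Rmult_le_compat_r; auto.
      assert (Cmod b * Cmod (kre (Z.of_nat n)) <= Cmod b * M1)%R
        by (apply Rmult_le_compat_l; auto). lra.
    + unfold kre. assert (H := Hb (Z.of_nat n)). rewrite zpow_of_nat in *. field. auto.
  - rewrite kre_opp, zpow_of_nat, Cmod_mult, Cmod_pow, Rmult_comm.
    apply Rmult_le_compat_r; auto. specialize (H2 n). rewrite zpow_of_nat in H2. nra.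
Qed.

Lemma kre_bounded : exists M : R, (0 < M)%R /\ forall n, (Cmod (kre n) <= M)%R.
Proof.
  destruct kre_bounds as [K [HK [_ H2]]].
  destruct (cv_bounded _ _ kre_cv) as [M1 [HM1 H1]].
  exists (K + M1)%R. split; [lra|]. apply Z_nat_cases; intros n.
  - eapply Rle_trans; [apply H1|]. lra.
  - eapply Rle_trans; [apply H2|].
    assert (Cmod Q ^ S n <= 1)%R.
    { rewrite <- (pow1 (S n)). apply pow_incr. split; [apply Cmod_ge_0|lra]. }
    nra.
Qed.

Lemma krd_bound : exists K : R, (0 < K)%R /\
  forall n, (Cmod (krd n) <= K * Cmod Q ^ Z.abs_nat n)%R.
Proof.
  destruct kre_bounds as [K [HK [H1 H2]]].
  assert (HQ := nome_pos Q HQ0).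
  assert (HQn : forall n, (0 <= Cmod Q ^ n)%R) by (intros; apply pow_le; lra).
  assert (HQi : (1 <= / Cmod Q)%R) by (rewrite <- Rinv_1; apply Rinv_le_contravar; lra).
  exists (K * (1 + / Cmod Q))%R. split; [nra|].
  assert (Hneg : forall n : nat, (Cmod (krd (- Z.of_nat n)) <= K * (1 + / Cmod Q) * Cmod Q ^ n)%R).
  { intros n. unfold krd. replace (- Z.of_nat n - 1)%Z with (- Z.of_nat (S n))%Z by lia.
    assert (H3 := H2 n). assert (H4 := H2 (S n)).
    assert (H5 := Cmod_triangle (kre (- Z.of_nat n)) (- kre (- Z.of_nat (S n)))).
    rewrite Cmod_opp in H5. simpl pow in H4. specialize (HQn n).
    assert (K * (Cmod Q * Cmod Q ^ n) <= K * (/ Cmod Q * Cmod Q ^ n))%R.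
    { apply Rmult_le_compat_l; [lra|]. apply Rmult_le_compat_r; lra. }
    unfold Cminus. lra. }
  apply Z_nat_cases; intros n.
  - destruct n as [|n]; [apply (Hneg 0%nat)|].
    rewrite Zabs2Nat.id. unfold krd. replace (Z.of_nat (S n) - 1)%Z with (Z.of_nat n) by lia.
    assert (H3 := H1 n). assert (H4 := H1 (S n)).
    replace (kre (Z.of_nat (S n)) - kre (Z.of_nat n))
      with ((1 - kre (Z.of_nat n)) + - (1 - kre (Z.of_nat (S n)))) by ring.
    eapply Rle_trans; [apply Cmod_triangle|]. rewrite Cmod_opp.
    replace (K * (1 + / Cmod Q) * Cmod Q ^ S n)%R
      with (K * Cmod Q ^ S n + K * Cmod Q ^ n)%R by (simpl; field; lra). lra.
  - replace (Z.abs_nat (- Z.of_nat (S n))) with (S n) by lia. apply Hneg.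
Qed.

Lemma asum_krd : asum krd.
Proof.
  destruct krd_bound as [K [HK H]]. apply (asum_geo_Z _ K (Cmod Q)); auto.
  split; auto. apply Cmod_ge_0.
Qed.

Lemma hsum_krd : hsum krd 1.
Proof.
  replace (RtoC 1) with (1 - 0) by ring.
  apply (hsum_telescope kre); [apply asum_krd | apply kre_cv |].
  destruct kre_bounds as [K [HK [_ H2]]].
  apply cv_squeeze with (fun n => (K * Cmod Q ^ n)%R).
  - intros n. replace (kre (- Z.of_nat n) - 0) with (kre (- Z.of_nat n)) by ring. apply H2.
  - replace (Finite 0) with (Rbar_mult (Finite K) (Finite 0)) by (simpl; f_equal; ring).
    apply (is_lim_seq_scal_l (fun n => (Cmod Q ^ n)%R) K 0%R). apply is_lim_seq_geom.
    rewrite Rabs_pos_eq; [auto|apply Cmod_ge_0].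
Qed.

(** Formally the coefficient of a^m in [jth Q a] times the sum of [kre n] a^n. *)
Definition krc (m : Z) : C := tsum (fun n => gam Q n * kre (m - n)).

Lemma asum_gam1 : asum (gam Q).
Proof.
  eapply asum_ext; [|apply (asum_gam Q HQ0 HQ1 1), C1_nz].
  intros n; simpl. rewrite zpow_one. ring.
Qed.

Lemma krc_spec m : hsum (fun n => gam Q n * kre (m - n)) (krc m).
Proof.
  apply tsum_spec. destruct kre_bounded as [M [HM H]].
  apply asum_le with (fun n => (M * Cmod (gam Q n))%R).
  - intros n. rewrite Cmod_mult, Rmult_comm. apply Rmult_le_compat_r; auto. apply Cmod_ge_0.
  - apply rbounded_scal; [lra|]. apply asum_gam1.
Qed.

(** Since [kre k] = 1 + b Q^k [kre k], each term splits into [gam Q (n + 1)], whose sum vanishes by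
    [hsum_gam], and a term of [krc m] times a factor in which n cancels. *)
Lemma krc_succ m : krc (m + 1) = - (b * zpow Q m) * krc m.
Proof.
  apply (hsum_unique (fun n => gam Q (n + 1) * kre (m + 1 - (n + 1)))).
  - apply (hsum_shift (fun n => gam Q n * kre (m + 1 - n)) _ 1), krc_spec.
  - replace (- (b * zpow Q m) * krc m) with (0 + - (b * zpow Q m) * krc m) by ring.
    apply hsum_ext with (fun n => gam Q (n + 1) + - (b * zpow Q m) * (gam Q n * kre (m - n))).
    + intros n. replace (m + 1 - (n + 1))%Z with (m - n)%Z by lia. rewrite gam_succ by auto.
      assert (H := Hb (m - n)%Z). unfold kre. rewrite zpow_sub in * by auto.
      assert (Hn := zpow_nz Q n HQ0).
      replace (1 - b * (zpow Q m / zpow Q n)) with ((zpow Q n - b * zpow Q m) / zpow Q n) in *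
        by (field; auto).
      field. split; auto.
      intros H2. apply H. replace (zpow Q n - b * zpow Q m) with (zpow Q n - b * zpow Q m + 0) by ring.
      rewrite H2. field; auto.
    + apply hsum_plus; [|apply hsum_scal, krc_spec].
      apply (hsum_shift (gam Q) 0 1), hsum_gam; auto.
Qed.

Lemma krc_closed m : krc m = krc 0 * (gam Q m * zpow b m).
Proof.
  revert m. apply Z_bi_ind.
  - rewrite gam_0, zpow_0. ring.
  - intros m. rewrite krc_succ, gam_succ, zpow_succ by auto.
    assert (Hm := zpow_nz Q m HQ0). split; intros H.
    + rewrite H. ring.
    + replace (krc m) with (- / (b * zpow Q m) * (- (b * zpow Q m) * krc m))
        by (field; auto).
      rewrite H. field; auto.
Qed.

(** Compare Laurent coefficients in [a]: by [krc_succ], those of the left side are the theta coefficients twisted by powers of [b]. *)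
Lemma kronecker_aux (a T : C) : a <> 0 -> asum (fun n => krd n * zpow a n) ->
  hsum (fun n => krd n * zpow a n) T ->
  jth Q a * T = krc 0 * (1 - a) * jth Q (a * b).
Proof.
  intros Ha HA HT.
  assert (Hab : a * b <> 0) by (apply Cmult_neq_0; auto).
  assert (HP := hsum_prod _ _ _ _ (asum_gam Q HQ0 HQ1 a Ha) HA (jth_spec Q HQ0 HQ1 a Ha) HT).
  (* The product is regrouped by the total exponent m of [a]. *)
  assert (HP' := hsum_bij (fun mn : Z * Z => (snd mn, (fst mn - snd mn)%Z))
    (fun nm : Z * Z => ((fst nm + snd nm)%Z, fst nm)) _ _
    ltac:(intros [x y]; simpl; f_equal; lia) ltac:(intros [x y]; simpl; f_equal; lia) HP).
  assert (HS := hsum_fubini _ (fun m => zpow a m * (krc m - krc (m - 1))) _ HP').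
  eapply hsum_unique; [apply HS|]; clear HP HP' HS.
  - intros m. simpl.
    eapply hsum_ext; [|apply hsum_scal, hsum_minus; apply krc_spec].
    intros n. cbv beta. unfold krd. replace (m - 1 - n)%Z with (m - n - 1)%Z by lia.
    replace m with (n + (m - n))%Z at 1 by lia. rewrite zpow_add by auto. ring.
  - assert (HJ := jth_spec Q HQ0 HQ1 _ Hab).
    replace (krc 0 * (1 - a) * jth Q (a * b))
      with (krc 0 * (jth Q (a * b) - a * jth Q (a * b))) by ring.
    eapply hsum_ext; [|apply hsum_scal, hsum_minus; [apply HJ|]; apply hsum_scal,
      (hsum_shift _ _ (-1) HJ)].
    intros m. cbv beta. rewrite (krc_closed m), (krc_closed (m - 1)).
    replace (m + -1)%Z with (m - 1)%Z by lia. rewrite !zpow_mult by auto.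
    rewrite (zpow_sub a m 1), zpow_1 by auto. field; auto.
Qed.

(** Continuity at a = 1, uniform in [N] up to the bounded factor [qp Q N]. A paired factor depends
    on a only through a + 1/a, whose distance from 2 is (a - 1)^2 / a, at most a - 1 here. *)
Lemma Jprod_lipschitz (a : R) N : (1 <= a <= 2)%R ->
  (Cmod (Jprod Q a N - Jprod Q 1 N) <=
   exp (8 / (1 - Cmod Q)) * exp (8 / (1 - Cmod Q)) * (/ (1 - Cmod Q) * (a - 1))
   * Cmod (qp Q N))%R.
Proof.
  intros Ha. assert (HQp := Cmod_ge_0 Q).
  assert (Ha0 : RtoC a <> 0) by (intros H; apply RtoC_inj in H; lra).
  set (u := fun (a : C) (i : nat) => - (a + / a) * Q ^ S i + Q ^ S i * Q ^ S i).
  assert (HJ : forall a : C, a <> 0 -> Jprod Q a N = Cprod_nat (fun i => 1 + u a i) N * qp Q N).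
  { intros c Hc. unfold Jprod. f_equal. apply Cprod_nat_ext. intros i _. unfold u. field; auto. }
  rewrite !HJ by (auto; apply C1_nz).
  assert (Hq : forall i, (Cmod (Q ^ S i) <= Cmod Q ^ i)%R).
  { intros i. rewrite Cmod_pow. simpl. rewrite <- (Rmult_1_l (Cmod Q ^ i)) at 2.
    apply Rmult_le_compat_r; [apply pow_le; auto | lra]. }
  assert (Hu : forall c : R, (1 <= c <= 2)%R -> forall i, (Cmod (u c i) <= 8 * Cmod Q ^ i)%R).
  { intros c Hc i. unfold u. eapply Rle_trans; [apply Cmod_triangle|].
    rewrite !Cmod_mult, Cmod_opp. specialize (Hq i).
    assert (H1 := Cmod_triangle c (/ c)).
    rewrite <- RtoC_inv in H1 |- * by lra.
    rewrite (Cmod_R c), (Cmod_R (/ c)), (Rabs_pos_eq c), (Rabs_pos_eq (/ c)) in H1;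
      [|left; apply Rinv_0_lt_compat; lra|lra].
    assert (/ c <= 1)%R by (rewrite <- Rinv_1; apply Rinv_le_contravar; lra).
    assert (H3 := Cmod_ge_0 (Q ^ S i)).
    assert (H4 := Cmod_nome_pow Q HQ1 i).
    assert (H5 := Cmod_ge_0 (c + (/ c)%R)).
    assert (Cmod (c + (/ c)%R) * Cmod (Q ^ S i) <= 3 * Cmod Q ^ i)%R
      by (apply Rmult_le_compat; lra).
    nra. }
  replace (Cprod_nat (fun i => 1 + u a i) N * qp Q N - Cprod_nat (fun i => 1 + u 1 i) N * qp Q N)
    with ((Cprod_nat (fun i => 1 + u a i) N - Cprod_nat (fun i => 1 + u 1 i) N) * qp Q N) by ring.
  rewrite Cmod_mult. apply Rmult_le_compat_r; [apply Cmod_ge_0|].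
  eapply Rle_trans; [apply (prod_diff (u a) (u 1) (fun i => (8 * Cmod Q ^ i)%R)
    (8 / (1 - Cmod Q)))|].
  - apply Hu; auto.
  - apply Hu; lra.
  - intros n. rewrite rsum_scal. apply Rmult_le_compat_l; [lra|]. apply rsum_seq_geo; auto.
  - apply Rmult_le_compat_l; [apply Rmult_le_pos; left; apply exp_pos|].
    apply Rle_trans with (rsum (fun i => ((a - 1) * Cmod Q ^ i)%R) (seq 0 N)).
    + apply rsum_le. intros i _. unfold u.
      replace (- (a + / a) * Q ^ S i + Q ^ S i * Q ^ S i - (- (1 + / 1) * Q ^ S i + Q ^ S i * Q ^ S i))
        with (- ((a - 1) * ((a - 1) / a)) * Q ^ S i) by (field; auto).
      rewrite !Cmod_mult, Cmod_opp, Cmod_mult, Cmod_div by auto.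
      rewrite <- RtoC_minus, !Cmod_R, !Rabs_pos_eq by lra. specialize (Hq i).
      apply Rmult_le_compat; auto; try apply Cmod_ge_0.
      * apply Rmult_le_pos; [lra|]. apply Rdiv_le_0_compat; lra.
      * apply Rle_trans with ((a - 1) * 1)%R; [|lra]. apply Rmult_le_compat_l; [lra|].
        apply Rmult_le_reg_r with a; [lra|]. unfold Rdiv. rewrite Rmult_assoc, Rinv_l by lra. lra.
    + rewrite rsum_scal, Rmult_comm. apply Rmult_le_compat_r; [lra|]. apply rsum_seq_geo; auto.
Qed.

Lemma real_zpow_bound (r d : R) n : (1 <= r <= 1 + d)%R ->
  (Cmod (zpow r n) <= (1 + d) ^ Z.abs_nat n)%R.
Proof.
  intros H. revert n. apply Z_nat_cases; intros n.
  - rewrite zpow_of_nat, Zabs2Nat.id, Cmod_pow, Cmod_R, Rabs_pos_eq by lra.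
    apply pow_incr; lra.
  - replace (Z.abs_nat (- Z.of_nat (S n))) with (S n) by lia.
    assert (RtoC r <> 0) by (intros H1; apply RtoC_inj in H1; lra).
    rewrite zpow_opp_nat, Cmod_inv, Cmod_pow, Cmod_R, Rabs_pos_eq by (try apply Cpow_nz; auto; lra).
    apply Rle_trans with 1%R.
    + rewrite <- Rinv_1. apply Rinv_le_contravar; [lra|]. apply pow_R1_Rle; lra.
    + apply pow_R1_Rle; lra.
Qed.

(** Let [a] tend to 1 in [kronecker_aux]; the factor [1 - a] cancels against that of the triple product. *)
Lemma krc_0 : krc 0 * jth Q b = qinf Q ^ 3.
Proof.
  assert (HQ := nome_pos Q HQ0).
  (* With this [d], (1 + d) |Q| < 1, so a single geometric majorant serves for all a in [1, 1 + d].
     The values [al k] approach 1 from above and keep 1 - a nonzero. *)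
  set (d := ((1 - Cmod Q) / 2)%R).
  assert (Hd : (0 < d < 1)%R) by (unfold d; lra).
  assert (HdQ : (0 <= (1 + d) * Cmod Q < 1)%R) by (unfold d; nra).
  set (al := fun k : nat => (1 + d / (INR k + 1))%R).
  assert (Hal : forall k, (1 < al k <= 1 + d)%R).
  { intros k. unfold al. assert (H := pos_INR k).
    assert (0 < d / (INR k + 1))%R by (apply Rdiv_lt_0_compat; lra).
    assert (d / (INR k + 1) <= d)%R; [|lra].
    apply Rmult_le_reg_r with (INR k + 1)%R; [lra|].
    unfold Rdiv; rewrite Rmult_assoc, Rinv_l by lra. nra. }
  assert (Hal0 : forall k, RtoC (al k) <> 0)
    by (intros k H; apply RtoC_inj in H; specialize (Hal k); lra).
  assert (Hlim : is_lim_seq (fun k => (al k - 1)%R) 0%R).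
  { apply is_lim_seq_ext with (fun k => (d * / (INR k + 1))%R); [intros; unfold al, Rdiv; ring|].
    replace (Finite 0) with (Rbar_mult (Finite d) (Finite 0)) by (simpl; f_equal; ring).
    apply (is_lim_seq_scal_l (fun k => (/ (INR k + 1))%R) d 0%R).
    apply (is_lim_seq_ext (fun n => / INR (S n))%R); [intros; rewrite S_INR; auto|].
    apply (is_lim_seq_incr_1 (fun n => / INR n)%R).
    replace (Finite 0) with (Rbar_inv p_infty) by reflexivity.
    apply is_lim_seq_inv; [apply is_lim_seq_INR | discriminate]. }
  assert (Halcv : Cseq_cv (fun k => RtoC (al k)) (RtoC 1)).
  { apply cv_squeeze with (fun k => (al k - 1)%R); auto.
    intros k. rewrite <- RtoC_minus, Cmod_R, Rabs_pos_eq; specialize (Hal k); lra. }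
  assert (Hpow : forall n, Cseq_cv (fun k => zpow (al k) n) (RtoC 1)).
  { assert (Hnat : forall n : nat, Cseq_cv (fun k => RtoC (al k) ^ n) (RtoC 1)).
    { induction n as [|n IH]; [exact (cv_const (RtoC 1))|]. simpl.
      replace (RtoC 1) with (1 * 1) by ring. apply cv_mult; auto. }
    apply Z_nat_cases; intros n.
    - eapply cv_ext; [|apply (Hnat n)]. intros k. rewrite zpow_of_nat; auto.
    - replace (RtoC 1) with (/ 1) by (field).
      eapply cv_ext; [|apply (cv_inv _ _ (fun k => Cpow_nz _ (S n) (Hal0 k)) C1_nz (Hnat (S n)))].
      intros k. cbv beta. rewrite zpow_opp_nat; auto. }
  destruct krd_bound as [K [HK HKb]].
  assert (HTb : forall k n, (Cmod (krd n * zpow (al k) n) <= K * ((1 + d) * Cmod Q) ^ Z.abs_nat n)%R).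
  { intros k n. rewrite Cmod_mult, Rpow_mult_distr, (Rmult_comm ((1 + d) ^ _)), <- Rmult_assoc.
    apply Rmult_le_compat; auto; try apply Cmod_ge_0. apply real_zpow_bound.
    specialize (Hal k); lra. }
  assert (HTa : forall k, asum (fun n => krd n * zpow (al k) n))
    by (intros k; apply (asum_geo_Z _ K ((1 + d) * Cmod Q)); auto).
  set (T := fun k => tsum (fun n => krd n * zpow (al k) n)).
  assert (HT : Cseq_cv T (RtoC 1)).
  { apply (hsum_tannery (fun k n => krd n * zpow (al k) n) krd
      (fun n => (K * ((1 + d) * Cmod Q) ^ Z.abs_nat n)%R)); auto.
    - apply rbounded_scal; [lra|]. apply rbounded_geo_Z; auto.
    - intros n. assert (H := cv_scal (krd n) _ _ (Hpow n)). rewrite Cmult_1_r in H. exact H.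
    - intros k. apply tsum_spec; auto.
    - apply hsum_krd. }
  (* The majorant adds the moduli of the theta series at (1 + d) b and b / (1 + d): according to the
     sign of n, one of them supplies the factor (1 + d)^|n|. *)
  assert (Hj : Cseq_cv (fun k => jth Q (al k * b)) (jth Q b)).
  { assert (H1 : RtoC (1 + d) * b <> 0).
    { apply Cmult_neq_0; auto. intros H; apply RtoC_inj in H; lra. }
    assert (H2 : / RtoC (1 + d) * b <> 0).
    { apply Cmult_neq_0; auto. rewrite <- RtoC_inv by lra. intros H; apply RtoC_inj in H.
      apply (Rinv_neq_0_compat (1 + d)); auto; lra. }
    apply (hsum_tannery (fun k n => gam Q n * zpow (al k * b) n) (fun n => gam Q n * zpow b n)
      (fun n => (Cmod (gam Q n * zpow (RtoC (1 + d) * b) n)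
        + Cmod (gam Q n * zpow (/ RtoC (1 + d) * b) n))%R)).
    - intros k n. rewrite !zpow_mult by (auto; try (intros H; apply RtoC_inj in H; lra);
        rewrite <- RtoC_inv by lra; intros H; apply RtoC_inj in H;
        apply (Rinv_neq_0_compat (1 + d)); auto; lra).
      rewrite !Cmod_mult.
      assert (H3 : (Cmod (zpow (al k) n) <= (1 + d) ^ Z.abs_nat n)%R)
        by (apply real_zpow_bound; specialize (Hal k); lra).
      assert (H4 : ((1 + d) ^ Z.abs_nat n <= Cmod (zpow (RtoC (1 + d)) n)
        + Cmod (zpow (/ RtoC (1 + d)) n))%R).
      { clear H3. revert n. apply Z_nat_cases; intros n.
        - rewrite !zpow_of_nat, Zabs2Nat.id, !Cmod_pow, Cmod_R, (Rabs_pos_eq (1 + d)) by lra.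
          assert (H := pow_le (Cmod (/ RtoC (1 + d))) n (Cmod_ge_0 _)). lra.
        - replace (Z.abs_nat (- Z.of_nat (S n))) with (S n) by lia.
          rewrite !zpow_opp_nat.
          assert (H5 : RtoC (1 + d) <> 0) by (intros H; apply RtoC_inj in H; lra).
          rewrite Cpow_inv by auto.
          replace (/ / RtoC (1 + d) ^ S n) with (RtoC (1 + d) ^ S n)
            by (field; split; [apply Cpow_nz; auto | apply C1_nz] || (field; apply Cpow_nz; auto)).
          rewrite (Cmod_pow (RtoC (1 + d))), Cmod_R, (Rabs_pos_eq (1 + d)) by lra.
          assert (H := Cmod_ge_0 (/ RtoC (1 + d) ^ S n)). lra. }
      assert (H6 := Cmod_ge_0 (gam Q n)). assert (H7 := Cmod_ge_0 (zpow b n)).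
      assert (H8 : (0 <= Cmod (gam Q n) * Cmod (zpow b n))%R) by (apply Rmult_le_pos; auto).
      apply Rle_trans with (Cmod (gam Q n) * Cmod (zpow b n) *
        (Cmod (zpow (RtoC (1 + d)) n) + Cmod (zpow (/ RtoC (1 + d)) n)))%R; [|right; ring].
      replace (Cmod (gam Q n) * (Cmod (zpow (al k) n) * Cmod (zpow b n)))%R
        with (Cmod (gam Q n) * Cmod (zpow b n) * Cmod (zpow (al k) n))%R by ring.
      apply Rmult_le_compat_l; lra.
    - apply rbounded_plus; apply (asum_gam Q HQ0 HQ1); auto.
    - intros n. replace (gam Q n * zpow b n) with (gam Q n * (1 * zpow b n)) by ring.
      apply cv_ext with (fun k => gam Q n * (zpow (al k) n * zpow b n)).
      + intros k. rewrite zpow_mult; auto.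
      + apply cv_scal, cv_mult; auto. apply cv_const.
    - intros k. apply (jth_spec Q HQ0 HQ1). apply Cmult_neq_0; auto.
    - apply (jth_spec Q HQ0 HQ1); auto. }
  set (J := fun k => jth Q (al k) / (1 - al k)).
  assert (Hal1 : forall k, RtoC (al k) <> 1)
    by (intros k H; apply RtoC_inj in H; specialize (Hal k); lra).
  assert (HJ3 : Cseq_cv (Jprod Q 1) (qinf Q ^ 3)).
  { apply cv_ext with (fun N => qp Q N * (qp Q N * (qp Q N * 1))).
    - intros N. unfold Jprod.
      replace (Cprod_nat (fun i => (1 - 1 * Q ^ S i) * (1 - Q ^ S i / 1)) N : C)
        with (qp Q N * qp Q N); [ring|].
      unfold qp. rewrite <- Cprod_nat_mult. apply Cprod_nat_ext. intros i _. field.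
    - simpl. assert (H := qinf_spec Q HQ1). repeat apply cv_mult; auto. apply cv_const. }
  destruct (cv_bounded _ _ (qinf_spec Q HQ1)) as [Mq [HMq HMqb]].
  (* [J k] is the limit of [Jprod Q (al k)], so the bound uniform in N survives the limit and gives
     a distance of order [al k - 1]. *)
  assert (HJ : Cseq_cv J (qinf Q ^ 3)).
  { set (E := (exp (8 / (1 - Cmod Q)) * exp (8 / (1 - Cmod Q)))%R).
    assert (HE : (0 < E)%R) by (apply Rmult_lt_0_compat; apply exp_pos).
    assert (HI : (0 < / (1 - Cmod Q))%R) by (apply Rinv_0_lt_compat; lra).
    apply cv_squeeze with (fun k => (E * / (1 - Cmod Q) * Mq * (al k - 1))%R).
    - intros k.
      apply (cv_bound (fun N => Jprod Q (al k) N - Jprod Q 1 N)).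
      + apply cv_minus; auto. apply (Jprod_cv_ne1 Q HQ0 HQ1); auto.
      + intros N. specialize (Hal k).
        eapply Rle_trans; [apply (Jprod_lipschitz (al k) N); lra|]. fold E.
        replace (E * / (1 - Cmod Q) * Mq * (al k - 1))%R
          with (E * (/ (1 - Cmod Q) * (al k - 1)) * Mq)%R by ring.
        apply Rmult_le_compat_l; auto. apply Rmult_le_pos; [lra|]; apply Rmult_le_pos; lra.
    - replace (Finite 0) with (Rbar_mult (Finite (E * / (1 - Cmod Q) * Mq)) (Finite 0))
        by (simpl; f_equal; ring).
      apply (is_lim_seq_scal_l (fun k => (al k - 1)%R) _ 0%R); auto. }
  replace (qinf Q ^ 3) with (qinf Q ^ 3 * 1) by ring.
  apply (cv_unique (fun k => krc 0 * jth Q (al k * b))).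
  - apply cv_scal; auto.
  - apply cv_ext with (fun k => J k * T k); [|apply cv_mult; auto].
    intros k. assert (H := kronecker_aux (al k) (T k) (Hal0 k) (HTa k) (tsum_spec _ (HTa k))).
    assert (H1 : 1 - RtoC (al k) <> 0).
    { intros H1. apply (Hal1 k). replace (RtoC (al k)) with (1 - (1 - RtoC (al k))) by ring.
      rewrite H1. ring. }
    unfold J. replace (jth Q (al k) / (1 - al k) * T k) with (jth Q (al k) * T k / (1 - al k))
      by (field; auto).
    rewrite H. field; auto.
Qed.

(** Here [T] stands for 1 - a times Kronecker's series, continued to wherever the differenced series
    converges absolutely. *)
Lemma kronecker (a T : C) : a <> 0 -> asum (fun n => krd n * zpow a n) ->
  hsum (fun n => krd n * zpow a n) T ->
  jth Q a * jth Q b * T = qinf Q ^ 3 * (1 - a) * jth Q (a * b).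
Proof.
  intros Ha HA HT. assert (H := kronecker_aux a T Ha HA HT).
  replace (jth Q a * jth Q b * T) with (jth Q a * T * jth Q b) by ring.
  rewrite H, <- krc_0. ring.
Qed.

End Kronecker.

(** * Lambert series of weight one and two *)

(** A primitive cube root of unity. Its square is written [- 1 - omega] throughout. *)
Definition omega : C := ((-1 / 2)%R, (sqrt 3 / 2)%R).

Lemma omega_sqr : omega * omega = - 1 - omega.
Proof.
  assert (H : (sqrt 3 * sqrt 3 = 3)%R) by (apply sqrt_sqrt; lra).
  unfold omega. apply injective_projections; simpl; nra.
Qed.

Lemma omega_nz : omega <> 0.
Proof. intros H. apply (f_equal fst) in H. unfold omega in H. simpl in H. lra. Qed.

Lemma omega2_nz : - 1 - omega <> 0.
Proof. intros H. apply (f_equal fst) in H. unfold omega in H. simpl in H. lra. Qed.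

Lemma quad_omega (x : C) : (1 - omega * x) * (1 - (- 1 - omega) * x) = 1 + x + x * x.
Proof. assert (H := omega_sqr). ring [H]. Qed.

Lemma hsum_nat_S (f : nat -> C) s : hsum f s -> hsum (fun i => f (S i)) (s - f 0%nat).
Proof.
  intros H.
  set (f0 := fun i : nat => match i with O => f O | S _ => RtoC 0 end).
  assert (H0 : hsum f0 (f O)).
  { replace (f O) with (csum f0 [O]) by (simpl; ring).
    apply hsum_finite; [repeat constructor; auto|]. intros [|i] Hi; auto. exfalso; apply Hi; left; auto. }
  assert (H1 := hsum_minus _ _ _ _ H H0).
  apply (hsum_pull S) in H1.
  - eapply hsum_ext; [|apply H1]. intros i; simpl. ring.
  - intros; lia.
  - intros [|i] Hi; [simpl; ring|]. exfalso; apply (Hi i); auto.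
Qed.

Lemma hsum_Z_split (f : Z -> C) s t :
  hsum (fun i : nat => f (Z.of_nat (S i))) s -> hsum (fun i : nat => f (- Z.of_nat (S i))%Z) t ->
  hsum f (f 0%Z + s + t).
Proof.
  intros Hs Ht.
  set (f0 := fun n : Z => if Z.eq_dec n 0 then f n else RtoC 0).
  set (fp := fun n : Z => if Z_lt_dec 0 n then f n else RtoC 0).
  set (fm := fun n : Z => if Z_lt_dec n 0 then f n else RtoC 0).
  assert (H0 : hsum f0 (f 0%Z)).
  { replace (f 0%Z) with (csum f0 [0%Z]).
    - apply hsum_finite; [repeat constructor; auto|]. intros i Hi. unfold f0.
      destruct (Z.eq_dec i 0); auto. exfalso; apply Hi; left; auto.
    - unfold f0; simpl. ring. }
  assert (Hp : hsum fp s).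
  { apply (hsum_push (fun i : nat => Z.of_nat (S i))).
    - intros; lia.
    - intros i Hi. unfold fp. destruct (Z_lt_dec 0 i); auto.
      exfalso; apply (Hi (Z.to_nat (i - 1))). lia.
    - eapply hsum_ext; [|apply Hs]. intros i. unfold fp. destruct (Z_lt_dec 0 _); auto. lia. }
  assert (Hm : hsum fm t).
  { apply (hsum_push (fun i : nat => (- Z.of_nat (S i))%Z)).
    - intros; lia.
    - intros i Hi. unfold fm. destruct (Z_lt_dec i 0); auto.
      exfalso; apply (Hi (Z.to_nat (- i - 1))). lia.
    - eapply hsum_ext; [|apply Ht]. intros i. unfold fm. destruct (Z_lt_dec _ 0); auto. lia. }
  eapply hsum_ext; [|apply (hsum_plus _ _ _ _ (hsum_plus _ _ _ _ H0 Hp) Hm)].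
  intros i. unfold f0, fp, fm.
  destruct (Z.eq_dec i 0), (Z_lt_dec 0 i), (Z_lt_dec i 0); try lia; ring.
Qed.

Lemma hsum_Z_even (f : Z -> C) s : (forall n, f (- n)%Z = f n) ->
  hsum (fun i : nat => f (Z.of_nat (S i))) s -> hsum f (f 0%Z + 2 * s).
Proof.
  intros He Hs. replace (f 0%Z + 2 * s) with (f 0%Z + s + s) by ring.
  apply hsum_Z_split; auto. eapply hsum_ext; [|apply Hs]. intros i; cbv beta. rewrite He; auto.
Qed.

Lemma hsum_Z_even_inv (f : Z -> C) s : (forall n, f (- n)%Z = f n) -> asum f -> hsum f s ->
  hsum (fun i : nat => f (Z.of_nat (S i))) ((s - f 0%Z) / 2).
Proof.
  intros He Ha Hs.
  destruct (asum_hsum (fun i : nat => f (Z.of_nat (S i)))) as [t Ht].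
  - apply (asum_inj (fun i : nat => Z.of_nat (S i)) f); auto. intros; lia.
  - assert (H := hsum_unique _ _ _ Hs (hsum_Z_even f t He Ht)). rewrite H.
    replace ((f 0%Z + 2 * t - f 0%Z) / 2) with t by field. auto.
Qed.

Lemma asum_geo (z : C) : (Cmod z < 1)%R -> asum (fun i : nat => z ^ i).
Proof.
  intros Hz. eapply asum_le; [|apply (rbounded_geo (Cmod z))]; [|split; auto; apply Cmod_ge_0].
  intros i. rewrite Cmod_pow. lra.
Qed.

Lemma one_minus_nz (z : C) : (Cmod z < 1)%R -> 1 - z <> 0.
Proof.
  intros Hz H. assert (z = 1) by (replace z with (1 - (1 - z)) by ring; rewrite H; ring).
  subst. rewrite Cmod_1 in Hz. lra.
Qed.

Lemma hsum_geo (z : C) : (Cmod z < 1)%R -> hsum (fun i : nat => z ^ i) (/ (1 - z)).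
Proof.
  intros Hz. destruct (asum_hsum _ (asum_geo z Hz)) as [s Hs].
  assert (H1 := hsum_nat_S _ _ Hs). assert (H2 := hsum_scal z _ _ Hs).
  assert (H := hsum_unique _ _ _ H1 H2). simpl in H.
  assert (Hz1 := one_minus_nz z Hz).
  replace (/ (1 - z)) with s; auto.
  apply (f_equal (fun u => (u + 1 - z * s) / (1 - z))) in H.
  replace ((s - 1 + 1 - z * s) / (1 - z)) with s in H by (field; auto).
  rewrite H. field; auto.
Qed.

Lemma rbounded_linear_geo (r : R) : (0 < r < 1)%R ->
  rbounded (fun i : nat => ((INR i + 1) * r ^ i)%R).
Proof.
  intros Hr. destruct (linear_geo r Hr) as [K [s [Hs [HK H]]]].
  eapply rbounded_le; [apply H|]. apply rbounded_scal; [lra|]. apply rbounded_geo; lra.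
Qed.

Lemma Cmod_INR_S i : Cmod (INR (S i)) = (INR i + 1)%R.
Proof. rewrite Cmod_R, Rabs_pos_eq, S_INR; auto. apply pos_INR. Qed.

Lemma asum_linear_geo (z : C) : z <> 0 -> (Cmod z < 1)%R ->
  asum (fun i : nat => INR (S i) * z ^ i).
Proof.
  intros Hz0 Hz. eapply asum_le; [|apply (rbounded_linear_geo (Cmod z))].
  - intros i; cbv beta. rewrite Cmod_mult, Cmod_INR_S, Cmod_pow. lra.
  - split; auto. apply Cmod_gt_0; auto.
Qed.

Lemma hsum_linear_geo (z : C) : z <> 0 -> (Cmod z < 1)%R ->
  hsum (fun i : nat => INR (S i) * z ^ i) (/ ((1 - z) * (1 - z))).
Proof.
  intros Hz0 Hz. destruct (asum_hsum _ (asum_linear_geo z Hz0 Hz)) as [s Hs].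
  assert (H1 := hsum_minus _ _ _ _ (hsum_nat_S _ _ Hs) (hsum_scal z _ _ Hs)).
  assert (H2 := hsum_scal z _ _ (hsum_geo z Hz)).
  assert (Hz1 := one_minus_nz z Hz).
  assert (H : s - INR 1 * z ^ 0 - z * s = z * / (1 - z)).
  { apply (hsum_unique _ _ _ H1). eapply hsum_ext; [|apply H2].
    intros i. cbv beta. rewrite (S_INR (S i)), RtoC_plus. simpl Cpow. ring. }
  simpl in H. replace (/ ((1 - z) * (1 - z))) with s; auto.
  apply (f_equal (fun u => (u + 1) / (1 - z))) in H.
  replace ((s - 1 * 1 - z * s + 1) / (1 - z)) with s in H by (field; auto).
  rewrite H. field; auto.
Qed.

Lemma pow_le_mono (r : R) (m n : nat) : (0 <= r <= 1)%R -> (n <= m)%nat -> (r ^ m <= r ^ n)%R.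
Proof.
  intros Hr Hn. replace m with (n + (m - n))%nat by lia. rewrite pow_add.
  apply Rle_trans with (r ^ n * 1)%R; [|lra]. apply Rmult_le_compat_l; [apply pow_le; lra|].
  rewrite <- (pow1 (m - n)). apply pow_incr; lra.
Qed.

(** This is (1 - E_2) / 24, with E_2 the Eisenstein series of weight two. *)
Definition lam (q : C) : C := tsum (fun i => INR (S i) * (q ^ S i / (1 - q ^ S i))).

Section Lambert.

Context (q : C) (Hq0 : q <> 0) (Hq1 : (Cmod q < 1)%R).

Lemma Cmod_qS i : (Cmod (q ^ S i) < 1)%R.
Proof. eapply Rle_lt_trans; [apply Cmod_nome_pow; auto | auto]. Qed.

Lemma asum_lam : asum (fun i => INR (S i) * (q ^ S i / (1 - q ^ S i))).
Proof.
  assert (Hq := nome_pos q Hq0).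
  eapply asum_le; [|apply (rbounded_scal (/ (1 - Cmod q)) _
    (Rlt_le _ _ (Rinv_0_lt_compat (1 - Cmod q) ltac:(lra)))
    (rbounded_linear_geo (Cmod q) (conj Hq Hq1)))].
  intros i; cbv beta. assert (H1 := one_minus_nz _ (Cmod_qS i)).
  rewrite Cmod_mult, Cmod_INR_S, Cmod_div by auto.
  assert (H2 := Cmod_1_minus _ _ (Cmod_nome_pow q Hq1 i)).
  assert (Hi := pos_INR i).
  replace (/ (1 - Cmod q) * ((INR i + 1) * Cmod q ^ i))%R
    with ((INR i + 1) * (Cmod q ^ i * / (1 - Cmod q)))%R by ring.
  apply Rmult_le_compat_l; [lra|]. apply Rmult_le_compat; auto.
  - apply Cmod_ge_0.
  - left. apply Rinv_0_lt_compat. lra.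
  - rewrite Cmod_pow. apply pow_le_mono; [lra|lia].
  - apply Rinv_le_contravar; lra.
Qed.

Lemma lam_spec : hsum (fun i => INR (S i) * (q ^ S i / (1 - q ^ S i))) (lam q).
Proof. apply tsum_spec, asum_lam. Qed.

(** Both forms are iterated sums of n q^(nm). Summing over n first gives x / (1 - x)^2 at x =
    q^m. *)
Lemma lam_alt : hsum (fun i => q ^ S i / ((1 - q ^ S i) * (1 - q ^ S i))) (lam q).
Proof.
  assert (Hq := nome_pos q Hq0).
  apply (hsum_swap (fun ij : nat * nat => INR (S (fst ij)) * q ^ (S (fst ij) * S (snd ij)))
    (fun i => INR (S i) * (q ^ S i / (1 - q ^ S i)))); [| | |apply lam_spec].
  - eapply asum_le; [|apply (rbounded_prod (fun i : nat => ((INR i + 1) * Cmod q ^ i)%R)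
      (fun j : nat => (Cmod q ^ j)%R))].
    + intros [i j]. cbv beta iota delta [fst snd]. rewrite Cmod_mult, Cmod_INR_S, Cmod_pow.
      assert (Hi := pos_INR i). rewrite Rmult_assoc, <- pow_add.
      apply Rmult_le_compat_l; [lra|]. apply pow_le_mono; [lra|lia].
    + intros i. assert (Hi := pos_INR i). apply Rmult_le_pos; [lra|]. apply pow_le; lra.
    + intros; apply pow_le; lra.
    + apply rbounded_linear_geo; auto.
    + apply rbounded_geo; lra.
  - intros i.
    eapply hsum_ext; [|apply hsum_scal, hsum_scal, (hsum_geo _ (Cmod_qS i))].
    intros j. cbv beta iota delta [fst snd]. rewrite (Cpow_mult_r q (S i) (S j)). reflexivity.
  - intros j. assert (H := one_minus_nz _ (Cmod_qS j)).
    eapply hsum_ext; [|apply (hsum_scal (q ^ S j)), hsum_linear_geo; [|apply (Cmod_qS j)]].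
    + intros i. cbv beta iota delta [fst snd]. rewrite Nat.mul_comm, Cpow_mult_r.
      change ((q ^ S j) ^ S i) with (q ^ S j * (q ^ S j) ^ i). ring.
    + apply Cpow_nz; auto.
Qed.

End Lambert.

(** Equal to x (1 - x) / (1 - x^3), hence for |x| < 1 the generating function of the nontrivial
    character modulo 3. Invariance under x -> 1/x permits sums over all integers. *)
Definition gf (x : C) : C := x / (1 + x + x * x).

Section Weight1.

Context (q : C) (Hq0 : q <> 0) (Hq1 : (Cmod q < 1)%R).

Lemma Cmod_zpow_pos (n : nat) : (Cmod (zpow q (Z.of_nat (S n))) < 1)%R.
Proof. rewrite zpow_of_nat. apply Cmod_qS; auto. Qed.

(** Every q^n is 1, a nonzero point of the open disc, or the inverse of one. *)
Lemma zpow_cases (P : C -> Prop) : P 1 -> (forall z : C, z <> 0 -> (Cmod z < 1)%R -> P z /\ P (/ z)) ->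
  forall n, P (zpow q n).
Proof.
  intros H1 H. apply Z_nat_cases; intros n.
  - destruct n as [|n]; [exact H1|]. apply H; [apply zpow_nz; auto | apply Cmod_zpow_pos].
  - rewrite zpow_opp by auto. apply H; [apply zpow_nz; auto | apply Cmod_zpow_pos].
Qed.

Lemma cube_lt1 (z : C) : (Cmod z < 1)%R -> (Cmod (z * z * z) < 1)%R.
Proof.
  intros Hz. rewrite !Cmod_mult. assert (H := Cmod_ge_0 z).
  assert (Cmod z * Cmod z <= 1)%R by nra. nra.
Qed.

Lemma quad_nz_lt1 (z : C) : (Cmod z < 1)%R -> 1 + z + z * z <> 0.
Proof.
  intros Hz H. apply (one_minus_nz _ (cube_lt1 z Hz)).
  replace (1 - z * z * z) with ((1 - z) * (1 + z + z * z)) by ring. rewrite H. ring.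
Qed.

Lemma RtoC_nz (x : R) : x <> 0%R -> RtoC x <> 0.
Proof. intros H H1. apply H. apply RtoC_inj; auto. Qed.

Lemma quad_nz n : 1 + zpow q n + zpow q n * zpow q n <> 0.
Proof.
  apply (zpow_cases (fun z => 1 + z + z * z <> 0)).
  - replace (1 + 1 + 1 * 1) with (RtoC 3) by (apply injective_projections; simpl; ring).
    apply RtoC_nz; lra.
  - intros z Hz0 Hz. split; [apply quad_nz_lt1; auto|].
    intros H. apply (quad_nz_lt1 z Hz).
    replace (1 + z + z * z) with (z * z * (1 + / z + / z * / z)) by (field; auto).
    rewrite H. ring.
Qed.

Lemma cube_ne1 k : k <> 0%Z -> 1 - zpow q k * zpow q k * zpow q k <> 0.
Proof.
  intros Hk.
  assert (Hnat : forall n : nat, 1 - zpow q (Z.of_nat (S n)) * zpow q (Z.of_nat (S n)) * zpow q (Z.of_nat (S n)) <> 0)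
    by (intros n; apply one_minus_nz, cube_lt1, Cmod_zpow_pos).
  destruct (Z_lt_le_dec k 0).
  - replace k with (- Z.of_nat (S (Z.to_nat (- k - 1))))%Z by lia.
    rewrite zpow_opp by auto. specialize (Hnat (Z.to_nat (- k - 1))).
    assert (Hz := zpow_nz q (Z.of_nat (S (Z.to_nat (- k - 1)))) Hq0).
    revert Hz Hnat. generalize (zpow q (Z.of_nat (S (Z.to_nat (- k - 1))))). intros z Hz H H1.
    apply H. replace (1 - z * z * z) with (- (z * z * z * (1 - / z * / z * / z))) by (field; auto).
    rewrite H1. ring.
  - replace k with (Z.of_nat (S (Z.to_nat (k - 1)))) by lia. apply Hnat.
Qed.

Lemma omega_kre_nz n : 1 - omega * zpow q n <> 0.
Proof. intros H. apply (quad_nz n). rewrite <- quad_omega, H. ring. Qed.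

Lemma omega2_kre_nz n : 1 - (- 1 - omega) * zpow q n <> 0.
Proof. intros H. apply (quad_nz n). rewrite <- quad_omega, H. ring. Qed.

(** The sum of the two simple fractions whose difference is a multiple of [gf] by [gf_kre]. Products
    of values of [gf] expand in both, and differences of [vf] telescope. *)
Definition vf (n : Z) : C := kre q omega n + kre q (- 1 - omega) n.

Lemma vf_eq n : vf n = (2 + zpow q n) / (1 + zpow q n + zpow q n * zpow q n).
Proof.
  unfold vf, kre. assert (H1 := omega_kre_nz n). assert (H2 := omega2_kre_nz n).
  rewrite <- quad_omega. field. auto.
Qed.

Lemma gf_kre n : kre q omega n - kre q (- 1 - omega) n = (omega - (- 1 - omega)) * gf (zpow q n).
Proof.
  unfold gf, kre. assert (H1 := omega_kre_nz n). assert (H2 := omega2_kre_nz n).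
  rewrite <- quad_omega. field. auto.
Qed.

(** [vf] tends to 2 and to 0 at the two ends of [Z]. *)
Lemma hsum_vf_diff k : hsum (fun n => vf n - vf (n + k)) (- (RtoC 2) * IZR k).
Proof.
  assert (H1 : hsum (fun n => vf n - vf (n - 1)) 2).
  { replace (RtoC 2) with (1 + 1) by (apply injective_projections; simpl; ring).
    eapply hsum_ext; [|apply (hsum_plus _ _ _ _
      (hsum_krd q Hq0 Hq1 omega omega_nz omega_kre_nz)
      (hsum_krd q Hq0 Hq1 (- 1 - omega) omega2_nz omega2_kre_nz))].
    intros n. unfold vf, krd. ring. }
  revert k. apply Z_bi_ind.
  - replace (- (RtoC 2) * IZR 0) with (RtoC 0) by (simpl; ring).
    eapply hsum_ext; [|apply hsum_0]. intros n; cbv beta. rewrite Z.add_0_r. ring.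
  - intros k. assert (H2 := hsum_shift _ _ (k + 1) H1). rewrite plus_IZR, RtoC_plus.
    split; intros H.
    + replace (- (RtoC 2) * (IZR k + 1)) with (- (RtoC 2) * IZR k - 2) by ring.
      eapply hsum_ext; [|apply (hsum_minus _ _ _ _ H H2)].
      intros n; cbv beta. replace (n + (k + 1) - 1)%Z with (n + k)%Z by lia. ring.
    + replace (- (RtoC 2) * IZR k) with (- (RtoC 2) * (IZR k + 1) + 2) by ring.
      eapply hsum_ext; [|apply (hsum_plus _ _ _ _ H H2)].
      intros n; cbv beta. replace (n + (k + 1) - 1)%Z with (n + k)%Z by lia. ring.
Qed.

Lemma gf_bound n : (Cmod (gf (zpow q n)) <= 2 / (1 - Cmod q) * Cmod q ^ Z.abs_nat n)%R.
Proof.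
  assert (HQ := nome_pos q Hq0).
  assert (Hi : (1 < / (1 - Cmod q))%R).
  { rewrite <- Rinv_1. apply Rinv_lt_contravar; lra. }
  assert (Hnat : forall n, (Cmod (gf (zpow q (Z.of_nat (S n)))) <= 2 / (1 - Cmod q) * Cmod q ^ (S n))%R).
  { intros m. rewrite zpow_of_nat. set (z := q ^ S m).
    assert (Hz : (Cmod z <= Cmod q)%R) by (apply Cmod_nome_pow; auto).
    assert (Hz1 : (Cmod z < 1)%R) by lra.
    (* In this form |1 - z| <= 2 and |1 - z^3| >= 1 - |q| give the constant. *)
    replace (gf z) with (z * (1 - z) / (1 - z * z * z)).
    2:{ unfold gf. assert (H1 := quad_nz_lt1 z Hz1). assert (H2 := one_minus_nz _ (cube_lt1 z Hz1)).
        field. auto. }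
    assert (H3 : (Cmod (z * z * z) <= Cmod q)%R).
    { rewrite !Cmod_mult. assert (H := Cmod_ge_0 z).
      assert (Cmod z * Cmod z <= 1)%R by nra. nra. }
    assert (H2 := one_minus_nz _ (cube_lt1 z Hz1)).
    rewrite Cmod_div, Cmod_mult by auto. apply Cmod_1_minus in H3.
    assert (H4 := Cmod_triangle 1 (- z)). rewrite Cmod_1, Cmod_opp in H4.
    assert (H5 : (Cmod (1 - z) <= 2)%R) by (unfold Cminus; lra).
    rewrite <- Cmod_pow. fold z.
    replace (2 / (1 - Cmod q) * Cmod z)%R with (Cmod z * 2 * / (1 - Cmod q))%R by (field; lra).
    apply Rmult_le_compat.
    - apply Rmult_le_pos; apply Cmod_ge_0.
    - left. apply Rinv_0_lt_compat. lra.
    - apply Rmult_le_compat_l; auto. apply Cmod_ge_0.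
    - apply Rinv_le_contravar; lra. }
  revert n. apply Z_nat_cases; intros n.
  - rewrite Zabs2Nat.id. destruct n as [|n]; auto.
    simpl. replace (gf 1) with (RtoC (/ 3)).
    + rewrite Cmod_R, Rabs_pos_eq by lra. lra.
    + unfold gf. rewrite RtoC_inv by lra.
      replace (1 + 1 + 1 * 1) with (RtoC 3) by (apply injective_projections; simpl; ring).
      unfold Cdiv. ring.
  - replace (Z.abs_nat (- Z.of_nat (S n))) with (S n) by lia.
    replace (gf (zpow q (- Z.of_nat (S n)))) with (gf (zpow q (Z.of_nat (S n)))); auto.
    rewrite zpow_opp by auto. assert (H := zpow_nz q (Z.of_nat (S n)) Hq0).
    assert (H1 := quad_nz (Z.of_nat (S n))).
    unfold gf. field. repeat split; auto; intros H2; apply H1; rewrite <- H2; ring.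
Qed.

Lemma gf_even n : gf (zpow q (- n)) = gf (zpow q n).
Proof.
  rewrite zpow_opp by auto. assert (H := zpow_nz q n Hq0). assert (H1 := quad_nz n).
  unfold gf. field. repeat split; auto; intros H2; apply H1; rewrite <- H2; ring.
Qed.

Lemma asum_gf : asum (fun n => gf (zpow q n)).
Proof.
  apply (asum_geo_Z _ (2 / (1 - Cmod q)) (Cmod q)); [split; auto; apply Cmod_ge_0 | apply gf_bound].
Qed.

End Weight1.

Definition Gf (q : C) : C := tsum (fun n => gf (zpow q n)).

Lemma Gf_spec (q : C) : q <> 0 -> (Cmod q < 1)%R -> hsum (fun n => gf (zpow q n)) (Gf q).
Proof. intros. apply tsum_spec, asum_gf; auto. Qed.

(** * The square of the cubic theta function *)

Section Weight2.

Context (q : C) (Hq0 : q <> 0) (Hq1 : (Cmod q < 1)%R).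

Let x (n : Z) : C := zpow q n.

(** Equal to y / (1 - y) - y^3 / (1 - y^3), so weighting it by k at y = q^k and summing over k >= 1
    gives [lam q - lam (q ^ 3)]. *)
Definition kap (y : C) : C := y * (1 + y) / (1 - y * y * y).

(** Partial fractions of [g(x) g(xy)] in [x]. *)
Lemma gf_mul n k : k <> 0%Z -> gf (x n) * gf (x (n + k)) =
  - / 2 * kap (x k) * (vf q n - vf q (n + k)) - / 2 * gf (x k) * (gf (x n) + gf (x (n + k))).
Proof.
  intros Hk. rewrite !vf_eq by auto. unfold x.
  assert (H1 := quad_nz q Hq0 Hq1 n). assert (H2 := quad_nz q Hq0 Hq1 (n + k)).
  assert (H3 := quad_nz q Hq0 Hq1 k). assert (H4 := cube_ne1 q Hq0 Hq1 k Hk).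
  rewrite zpow_add in * by auto. unfold gf, kap. field. auto.
Qed.

(** In [gf_mul] the differences of [vf] sum to -2k, and each of the two remaining sums is [Gf q]. *)
Lemma hsum_gf_mul k : k <> 0%Z ->
  hsum (fun n => gf (x n) * gf (x (n + k))) (IZR k * kap (x k) - Gf q * gf (x k)).
Proof.
  intros Hk. assert (HG := Gf_spec q Hq0 Hq1).
  replace (IZR k * kap (x k) - Gf q * gf (x k)) with
    (- / 2 * kap (x k) * (- (RtoC 2) * IZR k) - / 2 * gf (x k) * (Gf q + Gf q)) by field.
  eapply hsum_ext; [intros n; symmetry; apply gf_mul; auto|].
  apply hsum_minus; apply hsum_scal; [apply hsum_vf_diff; auto|].
  apply hsum_plus; auto. apply (hsum_shift _ _ k HG).
Qed.

(** The diagonal k = 0, where the partial fractions of [gf_mul] degenerate. *)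
Definition Gf2 : C := tsum (fun n => gf (x n) * gf (x n)).

Lemma asum_gf2 : asum (fun n => gf (x n) * gf (x n)).
Proof.
  eapply asum_le; [|apply (rbounded_scal (2 / (1 - Cmod q) * 1) _
    (ltac:(apply Rmult_le_pos; [|lra]; apply Rdiv_le_0_compat; lra)) (asum_gf q Hq0 Hq1))].
  intros n. cbv beta. rewrite Cmod_mult. apply Rmult_le_compat_r; [apply Cmod_ge_0|].
  eapply Rle_trans; [apply gf_bound; auto|]. apply Rmult_le_compat_l.
  - apply Rdiv_le_0_compat; lra.
  - rewrite <- (pow1 (Z.abs_nat n)). apply pow_incr. split; [apply Cmod_ge_0|lra].
Qed.

Lemma Gf2_spec : hsum (fun n => gf (x n) * gf (x n)) Gf2.
Proof. apply tsum_spec, asum_gf2. Qed.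

Lemma gf_1 : gf 1 = / 3.
Proof.
  unfold gf. replace (1 + 1 + 1 * 1) with (RtoC 3) by (apply injective_projections; simpl; ring).
  unfold Cdiv. ring.
Qed.

(** Summing the products along the diagonals [m - n = k]. *)
Lemma hsum_kap : hsum (fun k => IZR k * kap (x k)) (2 * (Gf q * Gf q) - Gf2 - Gf q / 3).
Proof.
  assert (HG := Gf_spec q Hq0 Hq1). assert (HA := asum_gf q Hq0 Hq1).
  assert (HP := hsum_prod _ _ _ _ HA HA HG HG).
  assert (HP' := hsum_bij (fun kn : Z * Z => (snd kn, (snd kn + fst kn)%Z))
    (fun nm : Z * Z => ((snd nm - fst nm)%Z, fst nm)) _ _
    ltac:(intros [u v]; simpl; f_equal; lia) ltac:(intros [u v]; simpl; f_equal; lia) HP).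
  (* At k = 0 the general formula evaluates to - Gf q / 3 instead of [Gf2]; [e] adds the
     discrepancy. *)
  set (e := fun k : Z => if Z.eq_dec k 0 then Gf2 + Gf q / 3 else RtoC 0).
  assert (He : hsum e (Gf2 + Gf q / 3)).
  { replace (Gf2 + Gf q / 3) with (csum e [0%Z]).
    - apply hsum_finite; [repeat constructor; auto|]. intros i Hi. unfold e.
      destruct (Z.eq_dec i 0); auto. exfalso; apply Hi; left; auto.
    - unfold e; simpl. ring. }
  assert (HS : hsum (fun k => IZR k * kap (x k) - Gf q * gf (x k) + e k) (Gf q * Gf q)).
  { apply (hsum_fubini _ _ _ HP'). intros k. unfold e. simpl.
    destruct (Z.eq_dec k 0) as [->|Hk].
    - replace (IZR 0 * kap (x 0) - Gf q * gf (x 0) + (Gf2 + Gf q / 3)) with Gf2.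
      + eapply hsum_ext; [|apply Gf2_spec]. intros n. cbv beta. rewrite Z.add_0_r. reflexivity.
      + unfold x. rewrite zpow_0, gf_1. simpl. field.
    - rewrite Cplus_0_r. apply hsum_gf_mul; auto. }
  replace (2 * (Gf q * Gf q) - Gf2 - Gf q / 3) with
    (Gf q * Gf q + Gf q * Gf q - (Gf2 + Gf q / 3)) by ring.
  eapply hsum_ext; [|apply (hsum_minus _ _ _ _ (hsum_plus _ _ _ _ HS (hsum_scal (Gf q) _ _ HG)) He)].
  intros k. cbv beta. unfold x. ring.
Qed.

Lemma q3_nz : q ^ 3 <> 0.
Proof. apply Cpow_nz; auto. Qed.

Lemma q3_lt1 : (Cmod (q ^ 3) < 1)%R.
Proof. apply (Cmod_qS q Hq1 2). Qed.

Lemma pow_q3 i : (q ^ 3) ^ S i = q ^ S i * q ^ S i * q ^ S i.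
Proof. rewrite <- !Cpow_add_r, <- Cpow_mult_r. f_equal. lia. Qed.

Lemma hsum_kap_nat : hsum (fun i => IZR (Z.of_nat (S i)) * kap (x (Z.of_nat (S i))))
  (lam q - lam (q ^ 3)).
Proof.
  eapply hsum_ext; [|apply (hsum_minus _ _ _ _ (lam_spec q Hq0 Hq1) (lam_spec _ q3_nz q3_lt1))].
  intros i. cbv beta. unfold x. rewrite pow_q3, zpow_of_nat, <- INR_IZR_INZ. unfold kap.
  assert (Hz := Cmod_qS q Hq1 i). set (z := q ^ S i) in *.
  assert (H1 := one_minus_nz _ Hz). assert (H2 := one_minus_nz _ (cube_lt1 z Hz)).
  assert (H3 := quad_nz_lt1 z Hz). field. auto.
Qed.

Lemma kap_even k : IZR (- k) * kap (x (- k)) = IZR k * kap (x k).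
Proof.
  destruct (Z.eq_dec k 0) as [->|Hk]; [reflexivity|].
  unfold x, kap. assert (H := cube_ne1 q Hq0 Hq1 k Hk).
  assert (H' := cube_ne1 q Hq0 Hq1 (- k) ltac:(lia)).
  assert (Hz := zpow_nz q k Hq0).
  rewrite zpow_opp in * by auto. rewrite opp_IZR, RtoC_opp.
  set (z := zpow q k) in *.
  assert (H2 : z * z * z - 1 <> 0).
  { intros H2. apply H. replace (1 - z * z * z) with (- (z * z * z - 1)) by ring. rewrite H2. ring. }
  field. auto.
Qed.

Lemma Gf_nat : hsum (fun i => gf (q ^ S i)) ((Gf q - / 3) / 2).
Proof.
  assert (H := hsum_Z_even_inv _ _ (gf_even q Hq0 Hq1) (asum_gf q Hq0 Hq1) (Gf_spec q Hq0 Hq1)).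
  cbv beta in H. rewrite zpow_0, gf_1 in H.
  eapply hsum_ext; [|apply H]. intros i. cbv beta. rewrite zpow_of_nat. reflexivity.
Qed.

Lemma Gf2_nat : hsum (fun i => gf (q ^ S i) * gf (q ^ S i)) ((Gf2 - / 9) / 2).
Proof.
  assert (He : forall n, gf (x (- n)) * gf (x (- n)) = gf (x n) * gf (x n))
    by (intros n; unfold x; rewrite gf_even by auto; reflexivity).
  assert (H := hsum_Z_even_inv (fun n => gf (x n) * gf (x n)) _ He asum_gf2 Gf2_spec).
  unfold x in H. rewrite zpow_0, gf_1 in H.
  replace (/ 9) with (/ 3 * / 3) by (rewrite <- !RtoC_inv, <- RtoC_mult by lra; f_equal; field).
  eapply hsum_ext; [|apply H]. intros i. cbv beta. rewrite zpow_of_nat. reflexivity.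
Qed.

(** In terms of the cubic theta function [a = 3 Gf]: [a^2 = 1 + 12 sum (n x_n - 3 n x_(3n))] with [x_n = q^n / (1 - q^n)]. *)
Lemma Gf_sqr : 9 * (Gf q * Gf q) = 1 + 12 * (lam q - 3 * lam (q ^ 3)).
Proof.
  assert (E1 : 2 * (Gf q * Gf q) - Gf2 - Gf q / 3 = 2 * (lam q - lam (q ^ 3))).
  { apply (hsum_unique _ _ _ hsum_kap).
    replace (2 * (lam q - lam (q ^ 3)))
      with (IZR 0 * kap (x 0) + 2 * (lam q - lam (q ^ 3))) by (simpl; ring).
    apply (hsum_Z_even (fun k => IZR k * kap (x k)) _ kap_even hsum_kap_nat). }
  (* A second relation for [Gf2], from g(x) + 3 g(x)^2 = x / (1 - x)^2 - 9 x^3 / (1 - x^3)^2. *)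
  assert (E2 : (Gf q - / 3) / 2 + 3 * ((Gf2 - / 9) / 2) = lam q - 9 * lam (q ^ 3)).
  { apply (hsum_unique _ _ _ (hsum_plus _ _ _ _ Gf_nat (hsum_scal 3 _ _ Gf2_nat))).
    eapply hsum_ext; [|apply (hsum_minus _ _ _ _ (lam_alt q Hq0 Hq1)
      (hsum_scal 9 _ _ (lam_alt _ q3_nz q3_lt1)))].
    intros i. cbv beta. rewrite pow_q3.
    assert (Hz := Cmod_qS q Hq1 i). set (z := q ^ S i) in *.
    assert (H1 := one_minus_nz _ Hz). assert (H2 := one_minus_nz _ (cube_lt1 z Hz)).
    assert (H3 := quad_nz_lt1 z Hz). unfold gf. field. auto. }
  (* With the weights 9 and 6 both [Gf2] and the linear term in [Gf q] cancel. *)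
  apply (f_equal (fun u => 9 * u)) in E1. apply (f_equal (fun u => 6 * u)) in E2.
  assert (E3 : 9 * (2 * (Gf q * Gf q) - Gf2 - Gf q / 3)
    + 6 * ((Gf q - / 3) / 2 + 3 * ((Gf2 - / 9) / 2)) = 18 * (Gf q * Gf q) - 2) by field.
  rewrite E1, E2 in E3.
  replace (9 * (Gf q * Gf q)) with ((18 * (Gf q * Gf q) - 2) / 2 + 1) by field.
  rewrite <- E3. field.
Qed.

Lemma q2_nz : q ^ 2 <> 0.
Proof. apply Cpow_nz; auto. Qed.

Lemma q2_lt1 : (Cmod (q ^ 2) < 1)%R.
Proof. apply (Cmod_qS q Hq1 1). Qed.

Lemma zpow_q2 n : zpow (q ^ 2) n = zpow q n * zpow q n.
Proof.
  rewrite zpow_pow, <- zpow_add by auto. f_equal. lia.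
Qed.

(** The factor 1 + (-1)^n selects the even indices, whose terms are those of the series at q^2, with
    weight 2. *)
Lemma hsum_gf_alt : hsum (fun n => zpow (-(1)) n * gf (zpow q n)) (2 * Gf (q ^ 2) - Gf q).
Proof.
  assert (H2 := hsum_scal 2 _ _ (Gf_spec _ q2_nz q2_lt1)).
  assert (Hm : forall n, zpow (-(1)) (2 * n) = 1).
  { intros n. replace (2 * n)%Z with (n + n)%Z by lia. rewrite zpow_add by apply m1_nz.
    apply zpow_m1_sqr. }
  assert (HE : hsum (fun n => (1 + zpow (-(1)) n) * gf (zpow q n)) (2 * Gf (q ^ 2))).
  { apply (hsum_push (fun n : Z => (2 * n)%Z)).
    - intros; lia.
    - intros i Hi. destruct (Z.Even_or_Odd i) as [[k Hk]|[k Hk]].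
      + exfalso; apply (Hi k); lia.
      + subst. rewrite zpow_succ, Hm by apply m1_nz. ring.
    - eapply hsum_ext; [|apply H2]. intros n. cbv beta. rewrite Hm, zpow_q2.
      replace (2 * n)%Z with (n + n)%Z by lia. rewrite zpow_add by auto. ring. }
  eapply hsum_ext; [|apply (hsum_minus _ _ _ _ HE (Gf_spec q Hq0 Hq1))].
  intros n. cbv beta. ring.
Qed.

End Weight2.

(** * Evaluation of theta quotients *)

Lemma cv_quot (X u v : nat -> C) (U V : C) : (forall N, X N * u N = v N) -> (forall N, u N <> 0) ->
  U <> 0 -> Cseq_cv u U -> Cseq_cv v V -> Cseq_cv X (V / U).
Proof.
  intros H Hu HU HuU HvV. apply cv_ext with (fun N => v N * / u N).
  - intros N. rewrite <- H. field; auto.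
  - apply cv_mult; auto. apply cv_inv; auto.
Qed.

Lemma cv_mul3 (u : nat -> C) (l : C) : Cseq_cv u l -> Cseq_cv (fun N => u (3 * N)%nat) l.
Proof. apply (cv_subseq u l (fun N => (3 * N)%nat)). intros; lia. Qed.

Section Eta.

Context (q : C) (Hq0 : q <> 0) (Hq1 : (Cmod q < 1)%R).

Lemma qk_nz k : q ^ k <> 0.
Proof. apply Cpow_nz; auto. Qed.

Lemma qk_lt1 k : (Cmod (q ^ S k) < 1)%R.
Proof. apply (Cmod_qS q Hq1 k). Qed.

Definition euler (k : nat) : C := qinf (q ^ k).

Lemma qpoch_euler k : qpoch (S k) q = euler (S k).
Proof.
  unfold qpoch. apply Clim_eq.
  eapply cv_ext; [|apply (qinf_spec _ (qk_lt1 k))].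
  intros N. unfold qp. apply Cprod_nat_ext. intros i _. rewrite <- Cpow_mult_r. reflexivity.
Qed.

Lemma euler_nz k : euler (S k) <> 0.
Proof. apply qinf_nz, qk_lt1. Qed.

Lemma euler_cv k : Cseq_cv (qp (q ^ S k)) (euler (S k)).
Proof. apply qinf_spec, qk_lt1. Qed.

Lemma euler_cv1 : Cseq_cv (qp q) (euler 1).
Proof. unfold euler. rewrite Cpow_1_r. apply qinf_spec; auto. Qed.

Lemma qpk_nz k N : qp (q ^ S k) N <> 0.
Proof. apply qp_nz, qk_lt1. Qed.

Lemma qp_pow k N : qp (q ^ k) N = Cprod_nat (fun i => 1 - (q ^ S i) ^ k) N.
Proof.
  apply Cprod_nat_ext. intros i _. rewrite <- !Cpow_mult_r, Nat.mul_comm. reflexivity.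
Qed.

Lemma qp_prod N : qp q N = Cprod_nat (fun i => 1 - q ^ S i) N.
Proof. reflexivity. Qed.

(** Factor by factor, (1 - omega z)(1 - z / omega)(1 - z) = 1 - z^3. *)
Lemma jth_omega : jth q omega = (1 - omega) * euler 3.
Proof.
  apply Jprod_cv; auto; [apply omega_nz|].
  eapply cv_ext; [|apply (euler_cv 2)]. intros N. rewrite qp_pow. unfold Jprod.
  rewrite qp_prod, <- Cprod_nat_mult. apply Cprod_nat_ext. intros i _.
  set (z := q ^ S i).
  replace (1 - z / omega) with (1 - (- 1 - omega) * z).
  - rewrite quad_omega. ring.
  - assert (H := omega_sqr). assert (H0 := omega_nz).
    replace (- 1 - omega) with (/ omega); [unfold Cdiv; ring|].
    assert (omega * (- 1 - omega) = 1) by ring [H].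
    apply (f_equal (fun u => / omega * u)) in H1.
    rewrite Cmult_1_r in H1. rewrite <- H1. field; auto.
Qed.

(** The paired factor is 1 - z + z^2 = (1 - z)(1 - z^6) / ((1 - z^2)(1 - z^3)). Both [omega] and its
    inverse are used for [w]. *)
Lemma jth_neg_root (w : C) : w <> 0 -> w + / w = - 1 ->
  jth q (- w) = (1 + w) * (euler 1 * euler 1 * euler 6 / (euler 2 * euler 3)).
Proof.
  intros Hw0 Hw. replace (1 + w) with (1 - - w) by ring.
  assert (Hw' : - w <> 0) by (intros H; apply Hw0; replace w with (- - w) by ring; rewrite H; ring).
  apply Jprod_cv; auto.
  apply cv_quot with (fun N => qp (q ^ 2) N * qp (q ^ 3) N)
    (fun N => qp q N * qp q N * qp (q ^ 6) N).
  - intros N. unfold Jprod. rewrite !qp_pow, !qp_prod.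
    rewrite <- !Cprod_nat_mult. apply Cprod_nat_ext. intros i _. set (z := q ^ S i).
    replace ((1 - - w * z) * (1 - z / - w)) with (1 + (w + / w) * z + z * z) by (field; auto).
    rewrite Hw. ring.
  - intros N. apply Cmult_neq_0; apply qpk_nz.
  - apply Cmult_neq_0; apply euler_nz.
  - apply cv_mult; apply euler_cv.
  - apply cv_mult; [apply cv_mult; apply euler_cv1 | apply (euler_cv 5)].
Qed.

Lemma omega_inv : omega + / omega = - 1.
Proof.
  assert (H := omega_sqr). assert (H0 := omega_nz).
  replace (omega + / omega) with ((omega * omega + 1) / omega) by (field; auto).
  rewrite H. field; auto.
Qed.

End Eta.

(** Factor by factor, (1 + z)^2 (1 - z) = (1 - z^2)^2 / (1 - z). *)
Lemma jth_m1 (q : C) : q <> 0 -> (Cmod q < 1)%R ->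
  jth q (-(1)) = 2 * (qinf (q ^ 2) * qinf (q ^ 2) / qinf q).
Proof.
  intros Hq0 Hq1. replace (RtoC 2) with (1 - -(1)) by (apply injective_projections; simpl; ring).
  apply Jprod_cv; auto; [apply m1_nz|].
  apply cv_quot with (qp q) (fun N => qp (q ^ 2) N * qp (q ^ 2) N).
  - intros N. unfold Jprod. rewrite !qp_pow, !qp_prod.
    rewrite <- !Cprod_nat_mult. apply Cprod_nat_ext. intros i _. set (z := q ^ S i).
    field.
  - intros N. apply qp_nz; auto.
  - apply qinf_nz; auto.
  - apply qinf_spec; auto.
  - apply cv_mult; apply (qinf_spec _ (qk_lt1 q Hq1 1)).
Qed.

Section Evaluations.

Context (q : C) (Hq0 : q <> 0) (Hq1 : (Cmod q < 1)%R).

Lemma kre_omega_opp n : kre q omega (- n) = 1 - kre q (- 1 - omega) n.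
Proof.
  rewrite kre_opp by (auto using omega_kre_nz). unfold kre.
  assert (H1 := omega2_kre_nz q Hq0 Hq1 n). assert (H := omega_sqr).
  set (z := zpow q n) in *.
  assert (H0 : z - omega <> 0).
  { intros H2. apply H1. replace (1 - (- 1 - omega) * z) with ((1 + omega) * (z - omega)) by ring [H].
    rewrite H2. ring. }
  replace (1 - (- 1 - omega) * z) with ((1 + omega) * (z - omega)) in * by ring [H].
  assert (H3 : 1 + omega <> 0) by (intros H3; apply H1; rewrite H3; ring).
  replace (1 - / ((1 + omega) * (z - omega)))
    with (((1 + omega) * z - (omega * omega + omega) - 1) / ((1 + omega) * (z - omega)))
    by (field; auto).
  rewrite H. field. auto.
Qed.

Lemma Cmod_zpow_m1 n : Cmod (zpow (-(1)) n) = 1%R.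
Proof.
  assert (H := f_equal Cmod (zpow_m1_sqr n)). rewrite Cmod_mult, Cmod_1 in H.
  assert (H0 := Cmod_ge_0 (zpow (-(1)) n)).
  assert (H1 : ((Cmod (zpow (-(1)) n) - 1) * (Cmod (zpow (-(1)) n) + 1) = 0)%R) by lra.
  apply Rmult_integral in H1. lra.
Qed.

Lemma asum_krd_alt : asum (fun n => krd q omega n * zpow (-(1)) n).
Proof.
  eapply asum_le; [|apply (asum_krd q Hq0 Hq1 omega omega_nz (omega_kre_nz q Hq0 Hq1))].
  intros n. rewrite Cmod_mult, Cmod_zpow_m1. lra.
Qed.

(** The reflection n -> 1 - n exchanges [omega] with its conjugate in [krd] and changes the sign
    (-1)^n. Adding the reflected series therefore leaves differences of the two [kre], that is,
    values of [gf]. *)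
Lemma hsum_krd_alt : hsum (fun n => krd q omega n * zpow (-(1)) n)
  ((omega - (- 1 - omega)) * (2 * Gf (q ^ 2) - Gf q)).
Proof.
  set (d := omega - (- 1 - omega)). set (S := 2 * Gf (q ^ 2) - Gf q).
  assert (HA := asum_krd_alt).
  destruct (asum_hsum _ HA) as [T HT].
  assert (Hg := hsum_gf_alt q Hq0 Hq1). fold S in Hg.
  assert (HT2 := hsum_plus _ _ _ _ HT (hsum_reflect _ _ 1 HT)).
  assert (HG2 := hsum_scal d _ _ (hsum_plus _ _ _ _ Hg (hsum_shift _ _ (-1) Hg))).
  assert (E : T + T = d * (S + S)).
  { apply (hsum_unique _ _ _ HT2). eapply hsum_ext; [|apply HG2].
    intros n. cbv beta. unfold krd.
    replace (1 - n)%Z with (- (n - 1))%Z by lia. replace (- (n - 1) - 1)%Z with (- n)%Z by lia.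
    replace (n + -1)%Z with (n - 1)%Z by lia.
    rewrite !kre_omega_opp, zpow_m1_opp.
    replace (zpow (-(1)) n) with (- zpow (-(1)) (n - 1)).
    2:{ replace n with (n - 1 + 1)%Z at 2 by lia. rewrite (zpow_succ _ (n - 1)) by apply m1_nz. ring. }
    assert (E1 := gf_kre q Hq0 Hq1 n). assert (E2 := gf_kre q Hq0 Hq1 (n - 1)). fold d in E1, E2.
    match goal with |- d * (?a * ?b + ?c * ?e) = _ =>
      replace (d * (a * b + c * e)) with (a * (d * b) + c * (d * e)) by ring end.
    rewrite <- E1, <- E2. ring. }
  replace (d * S) with T; auto.
  replace T with ((T + T) / 2) by field. rewrite E. field.
Qed.

(** The Borwein relation [phi(-q)^3 / phi(-q^3) = 2 a(q^2) - a(q)], with [a = 3 Gf] the cubic theta function. *)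
Lemma euler_quotient_B :
  euler q 1 ^ 6 * euler q 6 = 3 * (2 * Gf (q ^ 2) - Gf q) * (euler q 2 ^ 3 * euler q 3 ^ 2).
Proof.
  assert (HT := hsum_krd_alt).
  assert (HA := asum_krd_alt).
  (* Kronecker's identity at a = -1, b = [omega]: the three theta values are [jth_m1], [jth_omega]
     and [jth_neg_root]. *)
  assert (HK := kronecker q Hq0 Hq1 omega omega_nz (omega_kre_nz q Hq0 Hq1) _ _ m1_nz HA HT).
  rewrite jth_m1, jth_omega in HK by auto.
  replace (-(1) * omega) with (- omega) in HK by ring.
  rewrite (jth_neg_root q Hq0 Hq1 omega omega_nz omega_inv) in HK.
  replace (qinf q) with (euler q 1) in HK by (unfold euler; rewrite Cpow_1_r; auto).
  fold (euler q 2) in HK. set (S := 2 * Gf (q ^ 2) - Gf q) in *.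
  assert (H1 := euler_nz q Hq1 0). assert (H2 := euler_nz q Hq1 1).
  assert (H3 := euler_nz q Hq1 2).
  (* The factor 1 + [omega] cancels that of [jth_neg_root], which leaves the constant 3. *)
  assert (Hw : (1 - omega) * (omega - (- 1 - omega)) = 3 * (1 + omega)).
  { assert (H := omega_sqr). ring [H]. }
  assert (Hw1 : 1 + omega <> 0).
  { intros H. apply (f_equal fst) in H. unfold omega in H. simpl in H. lra. }
  assert (E : 2 * (1 + omega) * (euler q 1 ^ 6 * euler q 6)
    = 2 * (1 + omega) * (3 * S * (euler q 2 ^ 3 * euler q 3 ^ 2))).
  { apply (f_equal (fun u => euler q 1 * euler q 2 * euler q 3 * u)) in HK.
    transitivity (euler q 1 * euler q 2 * euler q 3 * (euler q 1 ^ 3 * (1 - - (1)) *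
      ((1 + omega) * (euler q 1 * euler q 1 * euler q 6 / (euler q 2 * euler q 3))))).
    - field. auto.
    - rewrite <- HK.
      transitivity (2 * S * (euler q 2 ^ 3 * euler q 3 ^ 2) * ((1 - omega) * (omega - (- 1 - omega)))).
      + field. auto.
      + rewrite Hw. ring. }
  apply (f_equal (fun u => u / (2 * (1 + omega)))) in E.
  replace (euler q 1 ^ 6 * euler q 6) with (2 * (1 + omega) * (euler q 1 ^ 6 * euler q 6) / (2 * (1 + omega)))
    by (field; auto).
  rewrite E. field; auto.
Qed.

(** The three residue classes modulo 3 reassemble (q;q)_oo; N steps of the triple product match 3 N
    factors. *)
Lemma jth_q3_q : jth (q ^ 3) q = euler q 1.
Proof.
  apply (cv_unique (fun N => jprod (q ^ 3) q N * qp (q ^ 3) N)).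
  - apply jacobi_triple_product; auto; [apply qk_nz; auto | apply (qk_lt1 q Hq1 2)].
  - eapply cv_ext; [|apply (cv_mul3 _ _ (euler_cv1 q Hq1))].
    intros N. cbv beta. induction N as [|N IH].
    + unfold jprod, qp. simpl. change (RtoC 1 = RtoC 1 * RtoC 1). ring.
    + replace (3 * S N)%nat with (S (S (S (3 * N)))) by lia.
      rewrite !qp_S, IH. unfold jprod. rewrite Cprod_nat_S.
      rewrite <- !Cpow_mult_r. replace (3 * S N)%nat with (S (S (S (3 * N)))) by lia.
      rewrite !Cpow_S. field. auto.
Qed.

(** The factors 1 + q^n with n prime to 3 are those of (-q;q)_oo / (-q^3;q^3)_oo, and (-x;x)_oo =
    (x^2;x^2)_oo / (x;x)_oo. *)
Lemma jth_q3_mq : jth (q ^ 3) (- q) = euler q 2 * euler q 3 ^ 2 / (euler q 1 * euler q 6).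
Proof.
  assert (Hq0' : - q <> 0) by (intros H; apply Hq0; replace q with (- - q) by ring; rewrite H; ring).
  apply (cv_unique (fun N => jprod (q ^ 3) (- q) N * qp (q ^ 3) N)).
  - apply jacobi_triple_product; auto; [apply qk_nz; auto | apply (qk_lt1 q Hq1 2)].
  - apply cv_quot with (fun N => qp q (3 * N) * qp (q ^ 6) N)
      (fun N => qp (q ^ 2) (3 * N) * (qp (q ^ 3) N * (qp (q ^ 3) N * 1))).
    + induction N as [|N IH].
      * unfold jprod, qp. simpl. change (1 * 1 * (1 * 1) = 1 * (1 * (1 * 1))). ring.
      * replace (3 * S N)%nat with (S (S (S (3 * N)))) by lia.
        rewrite !qp_S. unfold jprod in *. rewrite Cprod_nat_S.
        set (P := Cprod_nat (fun i => (1 - - q * (q ^ 3) ^ i) * (1 - (q ^ 3) ^ S i / - q)) N) in *.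
        rewrite <- !Cpow_mult_r. set (z := q ^ (3 * N)).
        replace (q ^ (3 * S N)) with (q * q * q * z)
          by (replace (3 * S N)%nat with (S (S (S (3 * N)))) by lia; rewrite !Cpow_S; unfold z; ring).
        replace (q ^ (6 * S N)) with (q * q * q * z * (q * q * q * z))
          by (replace (6 * S N)%nat with (S (S (S (3 * N))) + S (S (S (3 * N))))%nat by lia;
              rewrite Cpow_add_r; rewrite !Cpow_S; unfold z; ring).
        replace (q ^ (2 * S (3 * N))) with (q * z * (q * z))
          by (replace (2 * S (3 * N))%nat with (S (3 * N) + S (3 * N))%nat by lia;
              rewrite Cpow_add_r; rewrite !Cpow_S; unfold z; ring).
        replace (q ^ (2 * S (S (3 * N)))) with (q * q * z * (q * q * z))
          by (replace (2 * S (S (3 * N)))%nat with (S (S (3 * N)) + S (S (3 * N)))%nat by lia;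
              rewrite Cpow_add_r; rewrite !Cpow_S; unfold z; ring).
        replace (q ^ (2 * S (S (S (3 * N))))) with (q * q * q * z * (q * q * q * z))
          by (replace (2 * S (S (S (3 * N))))%nat
                with (S (S (S (3 * N))) + S (S (S (3 * N))))%nat by lia;
              rewrite Cpow_add_r; rewrite !Cpow_S; unfold z; ring).
        replace (q ^ S (S (S (3 * N)))) with (q * q * q * z) by (rewrite !Cpow_S; unfold z; ring).
        replace (q ^ S (S (3 * N))) with (q * q * z) by (rewrite !Cpow_S; unfold z; ring).
        replace (q ^ S (3 * N)) with (q * z) by (rewrite !Cpow_S; unfold z; ring).
        match goal with |- ?l = ?r => transitivity
          (P * qp (q ^ 3) N * (qp q (3 * N) * qp (q ^ 6) N) *
           ((1 - - q * z) * (1 - q * q * q * z / - q) * (1 - q * q * q * z) *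
            ((1 - q * z) * (1 - q * q * z) * (1 - q * q * q * z)
             * (1 - q * q * q * z * (q * q * q * z))))); [ring|] end.
        rewrite IH. field. auto.
    + intros N. apply Cmult_neq_0; [apply qp_nz; auto | apply (qpk_nz q Hq1 5)].
    + apply Cmult_neq_0; apply euler_nz; auto.
    + apply cv_mult; [|apply (euler_cv q Hq1 5)].
      apply (cv_mul3 _ _ (euler_cv1 q Hq1)).
    + simpl. apply cv_mult.
      * apply (cv_mul3 _ _ (euler_cv q Hq1 1)).
      * repeat apply cv_mult; try apply cv_const; apply (euler_cv q Hq1 2).
Qed.

Lemma m1_kre_nz n : 1 - -(1) * zpow (q ^ 3) n <> 0.
Proof.
  assert (H3 := qk_nz q Hq0 3). assert (H4 := qk_lt1 q Hq1 2).
  replace (1 - -(1) * zpow (q ^ 3) n) with (1 + zpow (q ^ 3) n) by ring.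
  apply (zpow_cases (q ^ 3) H3 H4 (fun z => 1 + z <> 0)).
  - rewrite <- RtoC_plus. apply RtoC_nz. lra.
  - assert (Hlt : forall z : C, (Cmod z < 1)%R -> 1 + z <> 0).
    { intros z Hz. replace (1 + z) with (1 - - z) by ring. apply one_minus_nz.
      rewrite Cmod_opp; auto. }
    intros z Hz0 Hz. split; auto. intros H. apply (Hlt z Hz).
    replace (1 + z) with (z * (1 + / z)) by (field; auto). rewrite H. ring.
Qed.

Notation e n := (kre (q ^ 3) (-(1)) n).

(** Towards minus infinity [kre] decays like |q|^(3|n|), which outweighs the growth |q|^(-|n|) of
    the power. *)
Lemma asum_zpow_kre : asum (fun n => zpow q n * e n).
Proof.
  assert (H3 := qk_nz q Hq0 3). assert (H4 := qk_lt1 q Hq1 2).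
  destruct (kre_bounds (q ^ 3) H3 H4 (-(1)) m1_nz m1_kre_nz) as [K [HK [_ HKb]]].
  destruct (kre_bounded (q ^ 3) H3 H4 (-(1)) m1_nz m1_kre_nz) as [M [HM HMb]].
  assert (Hp := nome_pos q Hq0).
  apply (asum_geo_Z _ (M + K) (Cmod q)); [lra|].
  apply Z_nat_cases; intros n.
  - rewrite Zabs2Nat.id, zpow_of_nat, Cmod_mult, Cmod_pow, Rmult_comm.
    apply Rmult_le_compat_r; [apply pow_le; lra|]. specialize (HMb (Z.of_nat n)). lra.
  - replace (Z.abs_nat (- Z.of_nat (S n))) with (S n) by lia. specialize (HKb (S n)).
    rewrite Cmod_mult, zpow_opp_nat, Cmod_inv, Cmod_pow by (apply Cpow_nz; auto).
    rewrite Cmod_pow, <- pow_mult in HKb.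
    assert (Hn : (0 < Cmod q ^ S n)%R) by (apply pow_lt; lra).
    apply Rmult_le_reg_l with (Cmod q ^ S n)%R; auto.
    rewrite <- Rmult_assoc, Rinv_r, Rmult_1_l by lra.
    eapply Rle_trans; [apply HKb|].
    assert (Hm := pow_le_mono (Cmod q) (3 * S n) (S n + S n) ltac:(lra) ltac:(lia)).
    rewrite pow_add in Hm.
    apply Rle_trans with (K * (Cmod q ^ S n * Cmod q ^ S n))%R.
    + apply Rmult_le_compat_l; lra.
    + nra.
Qed.

(** The terms of index n and -n add up to x / (1 - x + x^2) at x = q^n, which equals g(x) + 2
    g(x^2). *)
Lemma hsum_zpow_kre : hsum (fun n => zpow q n * e n) ((Gf q + 2 * Gf (q ^ 2)) / 2).
Proof.
  destruct (asum_hsum _ asum_zpow_kre) as [s Hs].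
  assert (H2 := hsum_plus _ _ _ _ (Gf_spec q Hq0 Hq1)
    (hsum_scal 2 _ _ (Gf_spec _ (q2_nz q Hq0) (q2_lt1 q Hq1)))).
  assert (E : s + s = Gf q + 2 * Gf (q ^ 2)).
  { apply (hsum_unique _ _ _ (hsum_plus _ _ _ _ Hs (hsum_reflect _ _ 0 Hs))).
    eapply hsum_ext; [|apply H2]. intros n. cbv beta.
    replace (0 - n)%Z with (- n)%Z by lia.
    assert (H5 := m1_kre_nz n). assert (H6 := m1_kre_nz (- n)). unfold kre.
    rewrite zpow_q2 by auto. rewrite !zpow_pow, (zpow_opp q n) in * by auto.
    replace (Z.of_nat 3 * - n)%Z with (- (n + n + n))%Z in * by lia.
    replace (Z.of_nat 3 * n)%Z with (n + n + n)%Z in * by lia.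
    rewrite zpow_opp, !zpow_add in * by auto.
    assert (H7 := quad_nz q Hq0 Hq1 n). assert (H8 := quad_nz q Hq0 Hq1 (n + n)).
    rewrite zpow_add in H8 by auto.
    assert (Hz := zpow_nz q n Hq0). set (z := zpow q n) in *. unfold gf.
    assert (H9 : z * z * z + 1 <> 0).
    { intros H. apply H5. replace (1 - -(1) * (z * z * z)) with (z * z * z + 1) by ring. auto. }
    replace (1 - -(1) * / (z * z * z)) with ((z * z * z + 1) / (z * z * z)) by (field; auto).
    replace (1 - -(1) * (z * z * z)) with (z * z * z + 1) by ring.
    field. repeat split; auto. }
  replace ((Gf q + 2 * Gf (q ^ 2)) / 2) with s; auto. rewrite <- E. field.
Qed.

(** The companion relation [phi(-q^3)^3 / phi(-q) = (a(q) + 2 a(q^2)) / 3]. *)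
Lemma euler_quotient_C :
  euler q 3 ^ 6 * euler q 2 = (Gf q + 2 * Gf (q ^ 2)) * (euler q 1 ^ 2 * euler q 6 ^ 3).
Proof.
  assert (H3 := qk_nz q Hq0 3). assert (H4 := qk_lt1 q Hq1 2).
  assert (Hs := hsum_zpow_kre). set (S := Gf q + 2 * Gf (q ^ 2)) in *.
  (* Here |q^3| < |q| < 1, so the undifferenced series converges too; its factor 1 - q cancels the 1
     - a of Kronecker's identity. *)
  assert (HT : hsum (fun n => krd (q ^ 3) (-(1)) n * zpow q n) (S / 2 - q * (S / 2))).
  { eapply hsum_ext; [|apply (hsum_minus _ _ _ _ Hs (hsum_scal q _ _ (hsum_shift _ _ (-1) Hs)))].
    intros n. cbv beta. unfold krd. replace (n + -1)%Z with (n - 1)%Z by lia.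
    rewrite (zpow_sub q n 1), zpow_1 by auto. field. auto. }
  assert (HA : asum (fun n => krd (q ^ 3) (-(1)) n * zpow q n)).
  { eapply asum_ext; [|apply (asum_plus _ _ asum_zpow_kre (asum_scal (- q) _
      (asum_inj (fun n : Z => (n - 1)%Z) _ ltac:(intros j k H; cbv beta in H; lia) asum_zpow_kre)))].
    intros n. cbv beta. unfold krd. rewrite (zpow_sub q n 1), zpow_1 by auto. field. auto. }
  (* Kronecker's identity with nome q^3, at a = q, b = -1. *)
  assert (HK := kronecker (q ^ 3) H3 H4 (-(1)) m1_nz m1_kre_nz q _ Hq0 HA HT).
  rewrite jth_q3_q, jth_m1 in HK by auto. rewrite <- Cpow_mult_r in HK.
  change (3 * 2)%nat with 6%nat in HK. fold (euler q 6) (euler q 3) in HK.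
  replace (q * -(1)) with (- q) in HK by ring. rewrite jth_q3_mq in HK.
  assert (E1 := euler_nz q Hq1 0). assert (E2 := euler_nz q Hq1 1).
  assert (E3 := euler_nz q Hq1 2). assert (E6 := euler_nz q Hq1 5).
  assert (Hq : 1 - q <> 0) by (apply one_minus_nz; auto).
  apply (f_equal (fun u => euler q 1 * euler q 3 * euler q 6 / (1 - q) * u)) in HK.
  transitivity (euler q 1 * euler q 3 * euler q 6 / (1 - q) *
     (euler q 3 ^ 3 * (1 - q) * (euler q 2 * euler q 3 ^ 2 / (euler q 1 * euler q 6)))).
  - field. auto.
  - rewrite <- HK. field. auto.
Qed.

End Evaluations.

(** * Complex derivatives *)

(** The remainder form avoids division and admits h = 0, so the chain rule covers inner increments
    that vanish. *)
Definition cdiff (f : C -> C) (z l : C) : Prop :=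
  forall eps : R, (0 < eps)%R -> exists delta : R, (0 < delta)%R /\
    forall h : C, (Cmod h < delta)%R -> (Cmod (f (z + h)%C - f z - h * l) <= eps * Cmod h)%R.

Lemma cdiff_derivable (f : C -> C) (z l : C) : cdiff f z l -> C_derivable_lim f z l.
Proof.
  intros H eps He. destruct (H (eps / 2)%R) as [delta [Hd Hh]]; [lra|].
  exists delta. split; auto.
  change (forall h : C, (0 < Cmod h)%R -> (Cmod h < delta)%R ->
    (Cmod ((f (z + h)%C - f z) / h - l) < eps)%R).
  intros h Hh0 Hhd. specialize (Hh h Hhd).
  assert (Hnz : h <> 0) by (apply Cmod_gt_0; auto).
  replace ((f (z + h)%C - f z) / h - l) with ((f (z + h)%C - f z - h * l) / h) by (field; auto).
  rewrite Cmod_div by auto. apply Rmult_lt_reg_r with (Cmod h); auto.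
  unfold Rdiv at 1. rewrite Rmult_assoc, Rinv_l by lra. nra.
Qed.

Lemma cdiff_quadratic (f : C -> C) (z l : C) (K d : R) : (0 < d)%R ->
  (forall h, (Cmod h < d)%R -> (Cmod (f (z + h)%C - f z - h * l) <= K * (Cmod h * Cmod h))%R) ->
  cdiff f z l.
Proof.
  intros Hd H eps He. assert (HK := Rabs_pos K).
  exists (Rmin d (eps / (Rabs K + 1))). split.
  - apply Rmin_pos; auto. apply Rdiv_lt_0_compat; lra.
  - intros h Hh. assert (H1 : (Cmod h < d)%R) by (eapply Rlt_le_trans; [apply Hh | apply Rmin_l]).
    assert (H2 : (Cmod h < eps / (Rabs K + 1))%R) by (eapply Rlt_le_trans; [apply Hh | apply Rmin_r]).
    eapply Rle_trans; [apply H; auto|]. rewrite <- Rmult_assoc.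
    apply Rmult_le_compat_r; [apply Cmod_ge_0|].
    assert (H3 := Cmod_ge_0 h). assert (H4 := Rle_abs K).
    apply Rle_trans with ((Rabs K + 1) * Cmod h)%R; [nra|].
    apply Rlt_le. apply Rmult_lt_compat_l with (r := (Rabs K + 1)%R) in H2; [|lra].
    replace ((Rabs K + 1) * (eps / (Rabs K + 1)))%R with eps in H2 by (field; lra). auto.
Qed.

Lemma cdiff_eq (f : C -> C) (z l m : C) : l = m -> cdiff f z l -> cdiff f z m.
Proof. intros ->; auto. Qed.

Lemma cdiff_ext_near (f g : C -> C) (z l : C) (d : R) : (0 < d)%R ->
  (forall h, (Cmod h < d)%R -> f (z + h)%C = g (z + h)%C) -> cdiff f z l -> cdiff g z l.
Proof.
  intros Hd H Hf eps He. destruct (Hf eps He) as [d' [Hd' Hh]].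
  exists (Rmin d d'). split; [apply Rmin_pos; auto|]. intros h Hm.
  rewrite <- H by (eapply Rlt_le_trans; [apply Hm | apply Rmin_l]).
  replace (g z) with (f z).
  - apply Hh. eapply Rlt_le_trans; [apply Hm | apply Rmin_r].
  - rewrite <- (Cplus_0_r z). apply H. rewrite Cmod_0. auto.
Qed.

Lemma cdiff_const (c z : C) : cdiff (fun _ => c) z 0.
Proof.
  apply cdiff_quadratic with 0%R 1%R; [lra|]. intros h _.
  replace (c - c - h * 0) with (RtoC 0) by ring. rewrite Cmod_0. lra.
Qed.

Lemma cdiff_linear (c z : C) : cdiff (fun w => c * w) z c.
Proof.
  apply cdiff_quadratic with 0%R 1%R; [lra|]. intros h _.
  replace (c * (z + h) - c * z - h * c) with (RtoC 0) by ring. rewrite Cmod_0. lra.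
Qed.

Lemma cdiff_mult (f g : C -> C) (z l m : C) : cdiff f z l -> cdiff g z m ->
  cdiff (fun w => f w * g w) z (l * g z + f z * m).
Proof.
  intros Hf Hg eps He.
  (* One summand for each of the six error terms of the expansion below, all bounded by that summand
     times e |h|. *)
  set (S := (Cmod (f z) + Cmod l * Cmod m + Cmod l + Cmod (g z) + Cmod m + 1)%R).
  assert (P1 := Cmod_ge_0 (f z)). assert (P2 := Cmod_ge_0 (g z)).
  assert (P3 := Cmod_ge_0 l). assert (P4 := Cmod_ge_0 m).
  assert (P5 : (0 <= Cmod l * Cmod m)%R) by (apply Rmult_le_pos; auto).
  assert (HS : (1 <= S)%R) by (unfold S; lra).
  set (e := Rmin 1 (eps / S)).
  assert (He0 : (0 < e)%R) by (apply Rmin_pos; [lra | apply Rdiv_lt_0_compat; lra]).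
  assert (He1 : (e <= 1)%R) by apply Rmin_l.
  assert (HeS : (e * S <= eps)%R).
  { apply Rle_trans with (eps / S * S)%R; [|right; field; lra].
    apply Rmult_le_compat_r; [lra | apply Rmin_r]. }
  destruct (Hf e He0) as [d1 [Hd1 H1]]. destruct (Hg e He0) as [d2 [Hd2 H2]].
  exists (Rmin e (Rmin d1 d2)). split; [apply Rmin_pos; [|apply Rmin_pos]; auto|]. intros h Hh.
  assert (Hhe : (Cmod h < e)%R) by (eapply Rlt_le_trans; [apply Hh | apply Rmin_l]).
  assert (Hh' : (Cmod h < Rmin d1 d2)%R) by (eapply Rlt_le_trans; [apply Hh | apply Rmin_r]).
  specialize (H1 h ltac:(eapply Rlt_le_trans; [apply Hh' | apply Rmin_l])).
  specialize (H2 h ltac:(eapply Rlt_le_trans; [apply Hh' | apply Rmin_r])).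
  set (r1 := f (z + h)%C - f z - h * l) in *. set (r2 := g (z + h)%C - g z - h * m) in *.
  replace (f (z + h)%C * g (z + h)%C - f z * g z - h * (l * g z + f z * m)) with
    (f z * r2 + (h * l * (h * m) + (h * l * r2 + (r1 * g z + (r1 * (h * m) + r1 * r2)))))
    by (unfold r1, r2; ring).
  assert (P6 := Cmod_ge_0 h). set (t := Cmod h) in *.
  apply Rle_trans with (e * t * S)%R;
    [|apply Rle_trans with (e * S * t)%R; [right; ring|apply Rmult_le_compat_r; auto]].
  assert (Q1 := Cmod_triangle (f z * r2)
    (h * l * (h * m) + (h * l * r2 + (r1 * g z + (r1 * (h * m) + r1 * r2))))).
  assert (Q2 := Cmod_triangle (h * l * (h * m))
    (h * l * r2 + (r1 * g z + (r1 * (h * m) + r1 * r2)))).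
  assert (Q3 := Cmod_triangle (h * l * r2) (r1 * g z + (r1 * (h * m) + r1 * r2))).
  assert (Q4 := Cmod_triangle (r1 * g z) (r1 * (h * m) + r1 * r2)).
  assert (Q5 := Cmod_triangle (r1 * (h * m)) (r1 * r2)).
  rewrite !Cmod_mult in Q1. rewrite !Cmod_mult in Q2. rewrite !Cmod_mult in Q3.
  rewrite !Cmod_mult in Q4. rewrite !Cmod_mult in Q5. fold t in Q2, Q3, Q5.
  assert (R1 : (0 <= Cmod r1)%R) by apply Cmod_ge_0.
  assert (R2 : (0 <= Cmod r2)%R) by apply Cmod_ge_0.
  assert (T0 : (0 <= e * t)%R) by (apply Rmult_le_pos; lra).
  assert (T1 : (Cmod (f z) * Cmod r2 <= Cmod (f z) * (e * t))%R) by (apply Rmult_le_compat_l; auto).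
  assert (T2 : (t * Cmod l * (t * Cmod m) <= Cmod l * Cmod m * (e * t))%R).
  { replace (t * Cmod l * (t * Cmod m))%R with (Cmod l * Cmod m * (t * t))%R by ring.
    apply Rmult_le_compat_l; auto. apply Rmult_le_compat_r; lra. }
  assert (T3 : (t * Cmod l * Cmod r2 <= Cmod l * (e * t))%R).
  { apply Rle_trans with (1 * Cmod l * (e * t))%R; [|lra].
    apply Rmult_le_compat; auto; [apply Rmult_le_pos; lra|]. apply Rmult_le_compat_r; lra. }
  assert (T4 : (Cmod r1 * Cmod (g z) <= e * t * Cmod (g z))%R) by (apply Rmult_le_compat_r; auto).
  assert (T5 : (Cmod r1 * (t * Cmod m) <= e * t * Cmod m)%R).
  { apply Rmult_le_compat; auto; [apply Rmult_le_pos; lra|].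
    apply Rle_trans with (1 * Cmod m)%R; [|lra]. apply Rmult_le_compat_r; lra. }
  assert (T6 : (Cmod r1 * Cmod r2 <= e * t * 1)%R).
  { apply Rmult_le_compat; auto. apply Rle_trans with (e * t)%R; auto. nra. }
  unfold S. lra.
Qed.

Lemma cdiff_comp (f g : C -> C) (z l m : C) : cdiff f z l -> cdiff g (f z) m ->
  cdiff (fun w => g (f w)) z (l * m).
Proof.
  intros Hf Hg eps He. assert (P3 := Cmod_ge_0 l). assert (P4 := Cmod_ge_0 m).
  set (e1 := Rmin 1 (eps / (2 * (Cmod m + 1)))).
  assert (He1 : (0 < e1)%R) by (apply Rmin_pos; [lra | apply Rdiv_lt_0_compat; lra]).
  assert (He1a : (e1 <= 1)%R) by apply Rmin_l.
  assert (He1b : (e1 * (Cmod m + 1) <= eps / 2)%R).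
  { apply Rle_trans with (eps / (2 * (Cmod m + 1)) * (Cmod m + 1))%R; [|right; field; lra].
    apply Rmult_le_compat_r; [lra | apply Rmin_r]. }
  set (e2 := (eps / (2 * (Cmod l + 1)))%R).
  assert (He2 : (0 < e2)%R) by (apply Rdiv_lt_0_compat; lra).
  destruct (Hf e1 He1) as [d1 [Hd1 H1]]. destruct (Hg e2 He2) as [d2 [Hd2 H2]].
  exists (Rmin d1 (d2 / (Cmod l + 1))). split.
  { apply Rmin_pos; auto. apply Rdiv_lt_0_compat; lra. }
  intros h Hh.
  specialize (H1 h ltac:(eapply Rlt_le_trans; [apply Hh | apply Rmin_l])).
  assert (Hh2 : (Cmod h < d2 / (Cmod l + 1))%R) by (eapply Rlt_le_trans; [apply Hh | apply Rmin_r]).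
  set (k := f (z + h)%C - f z).
  assert (Hk : (Cmod k <= (Cmod l + 1) * Cmod h)%R).
  { replace k with ((f (z + h)%C - f z - h * l) + h * l) by (unfold k; ring).
    eapply Rle_trans; [apply Cmod_triangle|]. rewrite Cmod_mult.
    assert (P5 := Cmod_ge_0 h). nra. }
  assert (Hk2 : (Cmod k < d2)%R).
  { eapply Rle_lt_trans; [apply Hk|].
    apply Rmult_lt_compat_l with (r := (Cmod l + 1)%R) in Hh2; [|lra].
    replace ((Cmod l + 1) * (d2 / (Cmod l + 1)))%R with d2 in Hh2 by (field; lra). auto. }
  specialize (H2 k Hk2).
  replace (f (z + h)%C) with (f z + k)%C by (unfold k; ring).
  replace (g (f z + k)%C - g (f z) - h * (l * m)) with
    ((g (f z + k)%C - g (f z) - k * m) + (f (z + h)%C - f z - h * l) * m) by (unfold k; ring).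
  eapply Rle_trans; [apply Cmod_triangle|]. rewrite Cmod_mult.
  assert (P5 := Cmod_ge_0 h).
  assert (T1 : (e2 * Cmod k <= eps / 2 * Cmod h)%R).
  { apply Rle_trans with (e2 * ((Cmod l + 1) * Cmod h))%R; [apply Rmult_le_compat_l; lra|].
    right. unfold e2. field. lra. }
  assert (T2 : (Cmod (f (z + h)%C - f z - h * l) * Cmod m <= e1 * Cmod h * Cmod m)%R)
    by (apply Rmult_le_compat_r; auto).
  nra.
Qed.

Lemma cdiff_Cinv (w : C) : w <> 0 -> cdiff Cinv w (- / (w * w)).
Proof.
  intros Hw. assert (Hw0 : (0 < Cmod w)%R) by (apply Cmod_gt_0; auto).
  apply cdiff_quadratic with (2 / (Cmod w * Cmod w * Cmod w))%R (Cmod w / 2)%R; [lra|].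
  intros h Hh.
  assert (H1 : (Cmod w / 2 < Cmod (w + h))%R).
  { assert (H := Cmod_triangle (w + h) (- h)). rewrite Cmod_opp in H.
    replace (w + h + - h) with w in H by ring. lra. }
  assert (H2 : w + h <> 0) by (intros H; rewrite H, Cmod_0 in H1; lra).
  replace (/ (w + h) - / w - h * - / (w * w)) with (h * h / (w * w * (w + h))) by (field; auto).
  rewrite Cmod_div, !Cmod_mult by (repeat apply Cmult_neq_0; auto).
  rewrite (Rmult_comm (2 / _)). unfold Rdiv.
  apply Rmult_le_compat_l; [apply Rmult_le_pos; apply Cmod_ge_0|].
  apply Rmult_le_reg_r with (Cmod w * Cmod w * Cmod (w + h))%R; [repeat apply Rmult_lt_0_compat; lra|].
  rewrite Rinv_l by (apply Rgt_not_eq; repeat apply Rmult_lt_0_compat; lra).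
  replace (2 * / (Cmod w * Cmod w * Cmod w) * (Cmod w * Cmod w * Cmod (w + h)))%R
    with (Cmod (w + h) * (2 / Cmod w))%R by (field; lra).
  apply Rle_trans with (Cmod w / 2 * (2 / Cmod w))%R; [right; field; lra|].
  apply Rmult_le_compat_r; [|lra]. apply Rlt_le, Rdiv_lt_0_compat; lra.
Qed.

Lemma cdiff_inv (f : C -> C) (z l : C) : f z <> 0 -> cdiff f z l ->
  cdiff (fun w => / f w) z (l * - / (f z * f z)).
Proof. intros Hz Hf. apply (cdiff_comp f Cinv); auto. apply cdiff_Cinv; auto. Qed.

(** * The complex exponential and its derivative *)

Lemma exp_quadratic (x : R) : (Rabs x <= / 2)%R -> (Rabs (exp x - 1 - x) <= 2 * x ^ 2)%R.
Proof.
  intros Hx. apply Rabs_le_between in Hx.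
  assert (H1 : (1 + x <= exp x)%R) by apply exp_ineq1_le.
  assert (H2 : (1 - x <= exp (- x))%R) by (assert (H := exp_ineq1_le (- x)); lra).
  assert (H3 : (exp x * (1 - x) <= 1)%R).
  { replace 1%R with (exp x * exp (- x))%R at 2.
    - apply Rmult_le_compat_l; auto. left; apply exp_pos.
    - rewrite <- exp_plus, Rplus_opp_r, exp_0. auto. }
  apply Rabs_le_between. split; [nra|].
  apply Rmult_le_reg_r with (1 - x)%R; [lra|]. nra.
Qed.

Lemma Rabs_sin_le (x : R) : (Rabs (sin x) <= Rabs x)%R.
Proof.
  destruct (Rtotal_order x 0) as [H|[->|H]].
  - assert (H1 := sin_lt_x (- x) ltac:(lra)). assert (H2 := SIN_bound x).
    rewrite sin_neg in H1. rewrite (Rabs_left x) by lra.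
    apply Rabs_le_between. split; [lra|].
    destruct (Rle_dec 1 (- x)); [lra|].
    assert (H3 : (0 < sin (- x))%R) by (apply sin_gt_0; assert (H4 := PI2_1); unfold PI2 in *; lra).
    rewrite sin_neg in H3. lra.
  - rewrite sin_0. lra.
  - assert (H1 := sin_lt_x x H). assert (H2 := SIN_bound x).
    rewrite (Rabs_right x) by lra. apply Rabs_le_between. split; [|lra].
    destruct (Rle_dec 1 x); [lra|].
    assert (H3 : (0 < sin x)%R) by (apply sin_gt_0; assert (H4 := PI2_1); unfold PI2 in *; lra).
    lra.
Qed.

Lemma cos_quadratic (x : R) : (Rabs (cos x - 1) <= x ^ 2 / 2)%R.
Proof.
  replace (cos x) with (1 - 2 * sin (x / 2) ^ 2)%R.
  - assert (H := Rabs_sin_le (x / 2)).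
    assert (H1 : (sin (x / 2) ^ 2 <= (x / 2) ^ 2)%R).
    { rewrite <- (pow2_abs (sin _)), <- (pow2_abs (x / 2)). apply pow_incr.
      split; [apply Rabs_pos | auto]. }
    assert (H2 := pow2_ge_0 (sin (x / 2))).
    apply Rabs_le_between. split; nra.
  - replace x with (2 * (x / 2))%R at 2 by field. rewrite cos_2a_sin. ring.
Qed.

Lemma sin_quadratic (x : R) : (Rabs x <= / 2)%R -> (Rabs (sin x - x) <= x ^ 2)%R.
Proof.
  intros Hx.
  destruct (MVT_gen (fun t => sin t - t)%R 0 x (fun t => cos t - 1)%R) as [c [Hc H]].
  - intros t _. auto_derive; auto. ring.
  - intros t _. apply continuity_pt_minus; [apply continuity_sin | apply derivable_continuous_pt, derivable_pt_id].
  - rewrite sin_0, !Rminus_0_r in H. rewrite H, Rabs_mult.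
    assert (H1 := cos_quadratic c).
    assert (H2 : (Rabs c <= Rabs x)%R).
    { unfold Rmin, Rmax in Hc. destruct (Rle_dec 0 x).
      - rewrite !Rabs_pos_eq; lra.
      - rewrite !Rabs_left1; lra. }
    assert (H3 : (c ^ 2 <= x ^ 2)%R).
    { rewrite <- (pow2_abs c), <- (pow2_abs x). apply pow_incr. split; [apply Rabs_pos | auto]. }
    assert (H4 := Rabs_pos x). assert (H5 := pow2_ge_0 x).
    apply Rle_trans with (x ^ 2 / 2 * / 2)%R; [|lra].
    apply Rmult_le_compat; auto; try apply Rabs_pos. lra.
Qed.

Lemma Cexp_add (z w : C) : Cexp (z + w) = Cexp z * Cexp w.
Proof.
  destruct z as [a b], w as [c d]. unfold Cexp, Cmult, Cplus; simpl.
  rewrite exp_plus, cos_plus, sin_plus. f_equal; ring.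
Qed.

Lemma Cexp_0 : Cexp (RtoC 0) = RtoC 1.
Proof. unfold Cexp, RtoC; simpl. rewrite exp_0, cos_0, sin_0. f_equal; ring. Qed.

Lemma Cexp_nz (z : C) : Cexp z <> RtoC 0.
Proof.
  intros H. apply C1_nz. rewrite <- Cexp_0. replace (RtoC 0) with (z + - z) at 1 by ring.
  rewrite Cexp_add, H. ring.
Qed.

Lemma Cmod_Cexp (z : C) : Cmod (Cexp z) = exp (fst z).
Proof.
  unfold Cmod, Cexp; simpl.
  replace (exp (fst z) * cos (snd z) * (exp (fst z) * cos (snd z) * 1) +
    exp (fst z) * sin (snd z) * (exp (fst z) * sin (snd z) * 1))%R
    with (exp (fst z) * exp (fst z) * ((sin (snd z))² + (cos (snd z))²))%R by (unfold Rsqr; ring).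
  rewrite sin2_cos2, Rmult_1_r. apply sqrt_square. left; apply exp_pos.
Qed.

Lemma Cexp_nat (z : C) (n : nat) : Cexp (INR n * z) = (Cexp z : C) ^ n.
Proof.
  induction n as [|n IH].
  - simpl. replace (0 * z) with (RtoC 0) by ring. apply Cexp_0.
  - rewrite S_INR, RtoC_plus. replace ((INR n + 1) * z) with (z + INR n * z) by ring.
    rewrite Cexp_add, IH. reflexivity.
Qed.

Lemma Cinv_unique (a b : C) : a <> 0 -> a * b = 1 -> b = / a.
Proof. intros Ha H. transitivity (/ a * (a * b)); [field; auto | rewrite H; ring]. Qed.

Lemma Cexp_opp (z : C) : Cexp (- z) = / (Cexp z : C).
Proof.
  apply Cinv_unique; [apply Cexp_nz|]. rewrite <- Cexp_add.
  replace (z + - z) with (RtoC 0) by ring. apply Cexp_0.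
Qed.

Lemma Cexp_Z (z : C) (n : Z) : Cexp (IZR n * z) = zpow (Cexp z) n.
Proof.
  revert n. apply Z_nat_cases; intros n.
  - rewrite <- INR_IZR_INZ, zpow_of_nat. apply Cexp_nat.
  - rewrite opp_IZR, <- INR_IZR_INZ, zpow_opp_nat, RtoC_opp.
    replace (- INR (S n) * z) with (- (INR (S n) * z)) by ring.
    rewrite Cexp_opp, Cexp_nat. reflexivity.
Qed.

Lemma cdiff_Cexp (z : C) : cdiff Cexp z (Cexp z).
Proof.
  (* The constant 8 is generous: the estimates below add up to 7/2 times |h|^2. *)
  apply cdiff_quadratic with (Cmod (Cexp z) * 8)%R (/ 2)%R; [lra|].
  intros h Hh. rewrite Cexp_add.
  replace (Cexp z * Cexp h - Cexp z - h * Cexp z) with (Cexp z * (Cexp h - 1 - h)) by ring.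
  rewrite Cmod_mult, Rmult_assoc. apply Rmult_le_compat_l; [apply Cmod_ge_0|].
  assert (Hm := Rmax_Cmod h). assert (Hc := Cmod2_alt h).
  destruct h as [x y]. unfold Re, Im in Hc. simpl fst in *. simpl snd in *.
  set (t := Cmod (x, y)) in *.
  assert (Hx : (Rabs x <= / 2)%R) by (assert (Hm1 := Rle_trans _ _ _ (Rmax_l _ _) Hm); lra).
  assert (Hy : (Rabs y <= / 2)%R) by (assert (Hm1 := Rle_trans _ _ _ (Rmax_r _ _) Hm); lra).
  assert (Hex := exp_quadratic x Hx). assert (Hcy := cos_quadratic y).
  assert (Hsy := sin_quadratic y Hy).
  assert (E : Cexp (x, y) - 1 - (x, y) =
    RtoC (exp x * (cos y - 1) + (exp x - 1 - x)) +
    Ci * RtoC (exp x * (sin y - y) + y * (exp x - 1 - x) + x * y)).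
  { unfold Cexp, Cminus, Cplus, Copp, Cmult, RtoC, Ci; simpl. f_equal; ring. }
  rewrite E. eapply Rle_trans; [apply Cmod_triangle|].
  rewrite Cmod_mult, Cmod_Ci, !Cmod_R, Rmult_1_l.
  assert (X2 := pow2_ge_0 x). assert (Y2 := pow2_ge_0 y).
  assert (Hx' : (x ^ 2 <= / 4)%R).
  { rewrite <- (pow2_abs x). replace (/ 4)%R with ((/ 2) ^ 2)%R by (simpl; field).
    apply pow_incr. split; [apply Rabs_pos | auto]. }
  assert (Hexp : (Rabs (exp x) <= 2)%R).
  { apply Rabs_le_between in Hex. apply Rabs_le_between in Hx.
    rewrite Rabs_pos_eq by (left; apply exp_pos). lra. }
  assert (Hxy : (Rabs (x * y) <= (x ^ 2 + y ^ 2) / 2)%R).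
  { assert (S1 := pow2_ge_0 (x - y)). assert (S2 := pow2_ge_0 (x + y)).
    apply Rabs_le_between. split; lra. }
  assert (A1 := Rabs_triang (exp x * (cos y - 1)) (exp x - 1 - x)).
  assert (A2 := Rabs_triang (exp x * (sin y - y) + y * (exp x - 1 - x)) (x * y)).
  assert (A3 := Rabs_triang (exp x * (sin y - y)) (y * (exp x - 1 - x))).
  rewrite Rabs_mult in A1. rewrite !Rabs_mult in A3.
  assert (B1 : (Rabs (exp x) * Rabs (cos y - 1) <= 2 * (y ^ 2 / 2))%R)
    by (apply Rmult_le_compat; auto using Rabs_pos).
  assert (B2 : (Rabs (exp x) * Rabs (sin y - y) <= 2 * y ^ 2)%R)
    by (apply Rmult_le_compat; auto using Rabs_pos).
  assert (B3 : (Rabs y * Rabs (exp x - 1 - x) <= / 2 * (2 * x ^ 2))%R)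
    by (apply Rmult_le_compat; auto using Rabs_pos).
  replace (t * t)%R with (x ^ 2 + y ^ 2)%R by (rewrite <- Hc; ring). lra.
Qed.

(** * The derivative of the Euler product *)

Lemma pow_diff_bound (q h : C) (r : R) i : (Cmod q <= r)%R -> (Cmod (q + h) <= r)%R ->
  (Cmod ((q + h) ^ S i - q ^ S i) <= (INR i + 1) * r ^ i * Cmod h)%R.
Proof.
  intros Hq Hh. assert (Hr : (0 <= r)%R) by (eapply Rle_trans; [apply Cmod_ge_0 | apply Hq]).
  assert (H0 := Cmod_ge_0 h).
  induction i as [|i IH].
  - replace ((q + h) ^ 1 - q ^ 1) with h by (simpl; ring). simpl. lra.
  - replace ((q + h) ^ S (S i) - q ^ S (S i))
      with ((q + h) * ((q + h) ^ S i - q ^ S i) + h * q ^ S i) by (simpl; ring).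
    eapply Rle_trans; [apply Cmod_triangle|]. rewrite !Cmod_mult, Cmod_pow, S_INR.
    assert (H1 : (Cmod q ^ S i <= r ^ S i)%R) by (apply pow_incr; split; auto; apply Cmod_ge_0).
    assert (H2 : (Cmod (q + h) * Cmod ((q + h) ^ S i - q ^ S i)
      <= r * ((INR i + 1) * r ^ i * Cmod h))%R)
      by (apply Rmult_le_compat; auto; apply Cmod_ge_0).
    assert (H3 : (Cmod h * Cmod q ^ S i <= Cmod h * r ^ S i)%R) by (apply Rmult_le_compat_l; auto).
    simpl pow in *. nra.
Qed.

(** The natural bound has the power r^(i-1); the extra factor [r] on the left avoids the negative
    exponent at i = 0. *)
Lemma pow_diff2_bound (q h : C) (r : R) i : (Cmod q <= r)%R -> (Cmod (q + h) <= r)%R -> (0 < r)%R ->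
  (r * Cmod ((q + h) ^ S i - q ^ S i - h * (INR (S i) * q ^ i))
    <= (INR i + 1) * ((INR i + 1) * r ^ i) * (Cmod h * Cmod h))%R.
Proof.
  intros Hq Hh Hr. assert (H0 : (0 <= Cmod h * Cmod h)%R) by (apply Rmult_le_pos; apply Cmod_ge_0).
  induction i as [|i IH].
  - replace ((q + h) ^ 1 - q ^ 1 - h * (INR 1 * q ^ 0)) with (RtoC 0) by (simpl; ring).
    rewrite Cmod_0. simpl. lra.
  - replace ((q + h) ^ S (S i) - q ^ S (S i) - h * (INR (S (S i)) * q ^ S i))
      with ((q + h) * ((q + h) ^ S i - q ^ S i - h * (INR (S i) * q ^ i)) + INR (S i) * (h * h * q ^ i))
      by (rewrite (S_INR (S i)), RtoC_plus; simpl Cpow; ring).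
    set (E := (q + h) ^ S i - q ^ S i - h * (INR (S i) * q ^ i)) in *.
    assert (T := Cmod_triangle ((q + h) * E) (INR (S i) * (h * h * q ^ i))).
    rewrite !Cmod_mult, Cmod_INR_S, Cmod_pow in T.
    assert (H1 : (Cmod q ^ i <= r ^ i)%R) by (apply pow_incr; split; auto; apply Cmod_ge_0).
    assert (Hri : (0 <= r ^ i)%R) by (apply pow_le; lra).
    assert (Hi := pos_INR i).
    assert (H2 : (Cmod (q + h) * Cmod E <= r * Cmod E)%R)
      by (apply Rmult_le_compat_r; auto; apply Cmod_ge_0).
    assert (H3 : ((INR i + 1) * (Cmod h * Cmod h * Cmod q ^ i)
      <= (INR i + 1) * (Cmod h * Cmod h * r ^ i))%R)
      by (apply Rmult_le_compat_l; [lra|]; apply Rmult_le_compat_l; auto).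
    apply Rle_trans with (r * (r * Cmod E + (INR i + 1) * (Cmod h * Cmod h * r ^ i)))%R.
    + apply Rmult_le_compat_l; lra.
    + rewrite S_INR. simpl pow. set (H := (Cmod h * Cmod h)%R) in *. set (s := (r ^ i)%R) in *.
      set (n := INR i) in *.
      assert (P : (0 <= r * (H * s))%R) by (apply Rmult_le_pos; [lra | apply Rmult_le_pos; lra]).
      assert (IH' : (r * (r * Cmod E) <= r * ((n + 1) * ((n + 1) * s) * H))%R)
        by (apply Rmult_le_compat_l; lra).
      apply Rle_trans with (r * ((n + 1) * ((n + 1) * s) * H) + (n + 1) * (r * (H * s)))%R.
      * lra.
      * replace ((n + 1 + 1) * ((n + 1 + 1) * (r * s)) * H)%R
          with (r * ((n + 1) * ((n + 1) * s) * H) + (n + 1) * (r * (H * s))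
            + (n + 2) * (r * (H * s)))%R by ring.
        assert (0 <= (n + 2) * (r * (H * s)))%R by (apply Rmult_le_pos; lra). lra.
Qed.

Lemma rbounded_square_geo (r : R) : (0 < r < 1)%R ->
  rbounded (fun i : nat => ((INR i + 1) * ((INR i + 1) * r ^ i))%R).
Proof.
  intros Hr. destruct (linear_geo r Hr) as [K [s [Hs [HK H]]]].
  eapply rbounded_le; [|apply (rbounded_scal K _ ltac:(lra) (rbounded_linear_geo s Hs))].
  intros i; cbv beta. assert (Hi := pos_INR i).
  apply Rle_trans with ((INR i + 1) * (K * s ^ i))%R; [|right; ring].
  apply Rmult_le_compat_l; auto. lra.
Qed.

Lemma Csum_nat_plus (f g : nat -> C) N :
  Csum_nat (fun i => f i + g i) N = Csum_nat f N + Csum_nat g N :> C.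
Proof. rewrite !Csum_nat_csum. apply csum_plus. Qed.

Lemma Csum_nat_scal (c : C) (f : nat -> C) N :
  Csum_nat (fun i => c * f i) N = c * Csum_nat f N :> C.
Proof. rewrite !Csum_nat_csum. apply csum_scal. Qed.

(** The logarithmic derivative of an infinite product, from the second-order expansion of the ratio [prod (1 - (q+h)^n) / (1 - q^n)]. *)
Lemma cdiff_qinf (q : C) : q <> 0 -> (Cmod q < 1)%R ->
  cdiff qinf q (- (qinf q * (lam q / q))).
Proof.
  intros Hq0 Hq1. assert (Hp := nome_pos q Hq0).
  (* The radius [r] bounds both |q| and |q + h| once |h| < (1 - |q|) / 2. *)
  set (r := ((1 + Cmod q) / 2)%R). assert (Hr : (0 < r < 1)%R) by (unfold r; lra).
  set (c := (/ (1 - Cmod q))%R). assert (Hc : (0 < c)%R) by (apply Rinv_0_lt_compat; lra).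
  destruct (rbounded_linear_geo r Hr) as [M1 HM1].
  destruct (rbounded_square_geo r Hr) as [M2 HM2].
  assert (HM10 : (0 <= M1)%R) by (apply (HM1 nil); constructor).
  assert (HM20 : (0 <= M2)%R) by (apply (HM2 nil); constructor).
  set (A := (c * M1)%R). assert (HA : (0 <= A)%R) by (apply Rmult_le_pos; lra).
  (* The second bound gives A |h| <= 1/2, as [prod_second_order] requires. *)
  set (d := Rmin ((1 - Cmod q) / 2) (/ (2 * (A + 1)))).
  assert (Hd : (0 < d)%R) by (apply Rmin_pos; [lra | apply Rinv_0_lt_compat; lra]).
  (* The first summand is the second-order error of the product, the second that of linearizing its
     factors in h. *)
  set (K := (2 * A * A + c * (/ r * M2))%R).
  apply cdiff_quadratic with (Cmod (qinf q) * K)%R d; auto.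
  intros h Hh. assert (Hh0 := Cmod_ge_0 h).
  assert (Hh1 : (Cmod h < (1 - Cmod q) / 2)%R) by (eapply Rlt_le_trans; [apply Hh | apply Rmin_l]).
  assert (Hh2 : (Cmod h < / (2 * (A + 1)))%R) by (eapply Rlt_le_trans; [apply Hh | apply Rmin_r]).
  assert (Hqr : (Cmod q <= r)%R) by (unfold r; lra).
  assert (Hqh : (Cmod (q + h) <= r)%R).
  { eapply Rle_trans; [apply Cmod_triangle|]. unfold r. lra. }
  assert (Hqh1 : (Cmod (q + h) < 1)%R) by lra.
  assert (Hden : forall i, 1 - q ^ S i <> 0) by (intros i; apply one_minus_nz, Cmod_qS; auto).
  assert (Hdinv : forall i, (/ Cmod (1 - q ^ S i) <= c)%R).
  { intros i. apply Rinv_le_contravar; [lra|]. apply Cmod_1_minus, Cmod_nome_pow; auto. }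
  (* Chosen so that (1 - (q+h)^n) / (1 - q^n) = 1 + [ep]; its linear part in h is - h [ld]. *)
  set (ep := fun i => - ((q + h) ^ S i - q ^ S i) / (1 - q ^ S i)).
  set (ld := fun i => INR (S i) * (q ^ i / (1 - q ^ S i))).
  assert (Hep : forall i, (Cmod (ep i) <= c * Cmod h * ((INR i + 1) * r ^ i))%R).
  { intros i. unfold ep. rewrite Cmod_div, Cmod_opp by auto. unfold Rdiv.
    replace (c * Cmod h * ((INR i + 1) * r ^ i))%R
      with ((INR i + 1) * r ^ i * Cmod h * c)%R by ring.
    apply Rmult_le_compat; auto; [apply Cmod_ge_0 | left; apply Rinv_0_lt_compat, Cmod_gt_0; auto|].
    apply pow_diff_bound; auto. }
  assert (Hep2 : forall i, (Cmod (ep i + h * ld i)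
    <= c * / r * (Cmod h * Cmod h) * ((INR i + 1) * ((INR i + 1) * r ^ i)))%R).
  { intros i. unfold ep, ld.
    replace (- ((q + h) ^ S i - q ^ S i) / (1 - q ^ S i) + h * (INR (S i) * (q ^ i / (1 - q ^ S i))))
      with (- ((q + h) ^ S i - q ^ S i - h * (INR (S i) * q ^ i)) / (1 - q ^ S i))
      by (field; auto).
    rewrite Cmod_div, Cmod_opp by auto. unfold Rdiv.
    assert (H := pow_diff2_bound q h r i Hqr Hqh ltac:(lra)).
    set (E := (q + h) ^ S i - q ^ S i - h * (INR (S i) * q ^ i)) in *.
    replace (c * / r * (Cmod h * Cmod h) * ((INR i + 1) * ((INR i + 1) * r ^ i)))%R
      with (/ r * ((INR i + 1) * ((INR i + 1) * r ^ i) * (Cmod h * Cmod h)) * c)%R by ring.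
    apply Rmult_le_compat; auto; [apply Cmod_ge_0 | left; apply Rinv_0_lt_compat, Cmod_gt_0; auto|].
    apply Rmult_le_reg_l with r; [lra|].
    rewrite <- Rmult_assoc, Rinv_r, Rmult_1_l by lra. auto. }
  assert (HSN : forall N, (rsum (fun i => Cmod (ep i)) (seq 0 N) <= A * Cmod h)%R).
  { intros N. eapply Rle_trans; [apply rsum_le; intros i _; apply Hep|].
    rewrite rsum_scal. specialize (HM1 (seq 0 N) (seq_NoDup _ _)).
    unfold A. replace (c * M1 * Cmod h)%R with (c * Cmod h * M1)%R by ring.
    apply Rmult_le_compat_l; auto. apply Rmult_le_pos; lra. }
  assert (HAh : (A * Cmod h <= / 2)%R).
  { apply Rle_trans with ((A + 1) * / (2 * (A + 1)))%R; [|right; field; lra].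
    apply Rmult_le_compat; lra. }
  set (R := fun N => Cprod_nat (fun i => 1 + ep i) N : C).
  assert (HR : forall N, R N * qp q N = qp (q + h) N).
  { intros N. unfold R, qp. rewrite <- Cprod_nat_mult. apply Cprod_nat_ext. intros i _.
    unfold ep. specialize (Hden i). field. auto. }
  assert (Hbound : forall N, (Cmod (R N - 1 - (- h) * Csum_nat ld N) <= K * (Cmod h * Cmod h))%R).
  { intros N. destruct (prod_second_order ep N) as [_ H2]; [specialize (HSN N); lra|].
    fold (R N) in H2.
    replace (R N - 1 - (- h) * Csum_nat ld N)
      with ((R N - 1 - Csum_nat ep N) + (Csum_nat ep N + h * Csum_nat ld N)) by ring.
    eapply Rle_trans; [apply Cmod_triangle|].
    set (S := rsum (fun i => Cmod (ep i)) (seq 0 N)) in *.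
    assert (HS0 : (0 <= S)%R) by (apply rsum_nonneg; intros; apply Cmod_ge_0).
    assert (T1 : (2 * S * S <= 2 * A * A * (Cmod h * Cmod h))%R).
    { replace (2 * A * A * (Cmod h * Cmod h))%R with (2 * (A * Cmod h) * (A * Cmod h))%R by ring.
      specialize (HSN N). fold S in HSN. apply Rmult_le_compat; lra. }
    assert (T2 : (Cmod (Csum_nat ep N + h * Csum_nat ld N)
      <= c * (/ r * M2) * (Cmod h * Cmod h))%R).
    { rewrite <- Csum_nat_scal, <- Csum_nat_plus, Csum_nat_csum.
      eapply Rle_trans; [apply csum_le|].
      eapply Rle_trans; [apply rsum_le; intros i _; apply Hep2|].
      rewrite rsum_scal. specialize (HM2 (seq 0 N) (seq_NoDup _ _)).
      replace (c * (/ r * M2) * (Cmod h * Cmod h))%R with (c * / r * (Cmod h * Cmod h) * M2)%R by ring.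
      apply Rmult_le_compat_l; auto.
      assert (0 < / r)%R by (apply Rinv_0_lt_compat; lra).
      apply Rmult_le_pos; [|apply Rmult_le_pos; lra]. apply Rmult_le_pos; lra. }
    unfold K. lra. }
  assert (Hq := qinf_nz q Hq1).
  assert (HRcv : Cseq_cv R (qinf (q + h) / qinf q)).
  { apply (cv_quot R (qp q) (qp (q + h))); auto.
    - intros; apply qp_nz; auto.
    - apply qinf_spec; auto.
    - apply qinf_spec; auto. }
  assert (Hldcv : Cseq_cv (Csum_nat ld) (lam q / q)).
  { apply hsum_nat_cv. replace (lam q / q) with (/ q * lam q) by (unfold Cdiv; ring).
    eapply hsum_ext; [|apply hsum_scal, (lam_spec q Hq0 Hq1)].
    intros i. unfold ld. simpl Cpow. specialize (Hden i). simpl Cpow in Hden. field. auto. }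
  assert (Hfin : (Cmod (qinf (q + h) / qinf q - 1 - (- h) * (lam q / q)) <= K * (Cmod h * Cmod h))%R).
  { apply (cv_bound (fun N => R N - 1 - (- h) * Csum_nat ld N)); auto.
    apply cv_minus; [apply cv_minus; auto; apply cv_const | apply cv_scal; auto]. }
  replace (qinf (q + h) - qinf q - h * - (qinf q * (lam q / q)))
    with (qinf q * (qinf (q + h) / qinf q - 1 - (- h) * (lam q / q))) by (field; auto).
  rewrite Cmod_mult, Rmult_assoc. apply Rmult_le_compat_l; auto. apply Cmod_ge_0.
Qed.

(** * The Riccati equation *)

Definition tpi : C := (0%R, (2 * PI)%R).

Definition nome (tau : C) : C := Cexp (tpi * tau).

Lemma nome_nz tau : nome tau <> 0.
Proof. apply Cexp_nz. Qed.

Lemma nome_lt1 (tau : C) : (0 < snd tau)%R -> (Cmod (nome tau) < 1)%R.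
Proof.
  intros H. unfold nome. rewrite Cmod_Cexp. rewrite <- exp_0. apply exp_increasing.
  unfold tpi; simpl. assert (HP := PI_RGT_0). nra.
Qed.

Lemma nome_pow tau k : nome tau ^ k = Cexp (INR k * tpi * tau).
Proof. unfold nome. rewrite <- Cexp_nat. f_equal. ring. Qed.

(** The inner derivative of the nome contributes a factor q^(k+1), which cancels the denominator in
    [cdiff_qinf]. *)
Lemma cdiff_euler (tau : C) (k : nat) : (0 < snd tau)%R ->
  cdiff (fun t => euler (nome t) (S k)) tau
    (euler (nome tau) (S k) * - (tpi * (INR (S k) * lam (nome tau ^ S k)))).
Proof.
  intros Ht. assert (Hq1 := nome_lt1 tau Ht). assert (Hq0 := nome_nz tau).
  assert (Hk0 := qk_nz (nome tau) Hq0 (S k)). assert (Hk1 := qk_lt1 (nome tau) Hq1 k).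
  unfold euler.
  eapply cdiff_eq; [|apply (cdiff_comp (fun t => nome t ^ S k) qinf)].
  3: apply cdiff_qinf; auto.
  2:{ eapply (cdiff_ext_near (fun t => Cexp (INR (S k) * tpi * t)) _ _ _ 1%R Rlt_0_1).
      - intros h _. rewrite nome_pow. reflexivity.
      - apply (cdiff_comp (fun t => INR (S k) * tpi * t) Cexp); [apply cdiff_linear | apply cdiff_Cexp]. }
  rewrite <- nome_pow. field. auto.
Qed.

Definition Wq (q : C) : C :=
  9 * (euler q 2 * (euler q 3 * euler q 3) / (euler q 1 * euler q 1 * euler q 6)) ^ 4.

(** Each Euler factor E_k contributes -k [lam (q ^ k)] to the logarithmic derivative, weighted by
    its exponent in W: 4 for E_2, 8 for E_3, -8 for E_1 and -4 for E_6. *)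
Lemma cdiff_Wq (tau : C) : (0 < snd tau)%R -> let q := nome tau in
  cdiff (fun t => Wq (nome t)) tau
    (Wq q * (tpi * (8 * (lam q - lam (q ^ 2) - 3 * lam (q ^ 3) + 3 * lam (q ^ 6))))).
Proof.
  intros Ht q. assert (Hq1 := nome_lt1 tau Ht). fold q in Hq1.
  assert (D1 := cdiff_euler tau 0 Ht). assert (D2 := cdiff_euler tau 1 Ht).
  assert (D3 := cdiff_euler tau 2 Ht). assert (D6 := cdiff_euler tau 5 Ht).
  fold q in D1, D2, D3, D6. rewrite Cpow_1_r in D1.
  assert (E1 := euler_nz q Hq1 0). assert (E2 := euler_nz q Hq1 1).
  assert (E3 := euler_nz q Hq1 2). assert (E6 := euler_nz q Hq1 5).
  assert (Dn := cdiff_mult _ _ _ _ _ D2 (cdiff_mult _ _ _ _ _ D3 D3)).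
  assert (Dd := cdiff_mult _ _ _ _ _ (cdiff_mult _ _ _ _ _ D1 D1) D6).
  assert (Hd0 : euler (nome tau) 1 * euler (nome tau) 1 * euler (nome tau) 6 <> 0)
    by (repeat apply Cmult_neq_0; auto).
  assert (Du := cdiff_mult _ _ _ _ _ Dn (cdiff_inv
    (fun t => euler (nome t) 1 * euler (nome t) 1 * euler (nome t) 6) _ _ Hd0 Dd)).
  assert (Du4 := cdiff_mult _ _ _ _ _ Du (cdiff_mult _ _ _ _ _ Du
    (cdiff_mult _ _ _ _ _ Du (cdiff_mult _ _ _ _ _ Du (cdiff_const 1 tau))))).
  assert (DW := cdiff_mult _ _ _ _ _ (cdiff_const 9 tau) Du4).
  unfold Wq. eapply cdiff_eq; [|exact DW].
  cbv beta. fold q. simpl Cpow. simpl INR.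
  replace (RtoC (1 + 1 + 1 + 1 + 1 + 1)) with (RtoC 6) by (f_equal; ring).
  replace (RtoC (1 + 1 + 1)) with (RtoC 3) by (f_equal; ring).
  replace (RtoC (1 + 1)) with (RtoC 2) by (f_equal; ring).
  field. auto.
Qed.

Lemma Wq_BC (q : C) : q <> 0 -> (Cmod q < 1)%R ->
  8 * (lam q - lam (q ^ 2) - 3 * lam (q ^ 3) + 3 * lam (q ^ 6)) * Wq q =
  (1 / 8) * ((euler q 1 * euler q 1 * (euler q 3 * euler q 3) / (euler q 2 * euler q 6)) ^ 2
    * (Wq q ^ 2 - 10 * Wq q + 9)).
Proof.
  intros Hq0 Hq1.
  assert (S1 := Gf_sqr q Hq0 Hq1).
  assert (S2 := Gf_sqr (q ^ 2) (q2_nz q Hq0) (q2_lt1 q Hq1)).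
  rewrite <- Cpow_mult_r in S2. change (2 * 3)%nat with 6%nat in S2.
  assert (HB := euler_quotient_B q Hq0 Hq1). assert (HC := euler_quotient_C q Hq0 Hq1).
  assert (E1 := euler_nz q Hq1 0). assert (E2 := euler_nz q Hq1 1).
  assert (E3 := euler_nz q Hq1 2). assert (E6 := euler_nz q Hq1 5).
  unfold Wq.
  set (G1 := Gf q) in *. set (G2 := Gf (q ^ 2)) in *.
  (* Subtracting [Gf_sqr] at q^2 from [Gf_sqr] at q gives exactly this combination of Lambert
     series. *)
  assert (EL : 8 * (lam q - lam (q ^ 2) - 3 * lam (q ^ 3) + 3 * lam (q ^ 6))
    = 6 * (G1 * G1 - G2 * G2)).
  { transitivity ((8 / 12) * ((1 + 12 * (lam q - 3 * lam (q ^ 3)))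
      - (1 + 12 * (lam (q ^ 2) - 3 * lam (q ^ 6))))); [field|].
    rewrite <- S1, <- S2. field. }
  rewrite EL. clear EL S1 S2.
  set (a1 := euler q 1) in *. set (a2 := euler q 2) in *. set (a3 := euler q 3) in *.
  set (a6 := euler q 6) in *.
  set (B := a1 ^ 6 * a6 / (a2 ^ 3 * a3 ^ 2)). set (C := a3 ^ 6 * a2 / (a1 ^ 2 * a6 ^ 3)).
  assert (HB' : B = 3 * (2 * G2 - G1)) by (unfold B; rewrite HB; field; auto).
  assert (HC' : C = G1 + 2 * G2) by (unfold C; rewrite HC; field; auto).
  assert (HB0 : B <> 0).
  { intros H. apply (Cmult_neq_0 (a1 ^ 6) a6 (Cpow_nz _ _ E1) E6).
    replace (a1 ^ 6 * a6) with (B * (a2 ^ 3 * a3 ^ 2)) by (unfold B; field; auto).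
    rewrite H. ring. }
  replace (9 * (a2 * (a3 * a3) / (a1 * a1 * a6)) ^ 4) with (9 * C / B)
    by (unfold B, C; field; auto).
  replace ((a1 * a1 * (a3 * a3) / (a2 * a6)) ^ 2) with (B * C)
    by (unfold B, C; field; auto).
  (* Indeed 9 C - B = 12 (G1 + G2) and C - B = 4 (G1 - G2). *)
  assert (HG : 6 * (G1 * G1 - G2 * G2) = (9 * C - B) * (C - B) / 8)
    by (rewrite HB', HC'; field).
  rewrite HG. field. auto.
Qed.

(** * Theta constants as triple products *)

Lemma IZR_tri n : (2 * IZR (n * (n - 1) / 2) = IZR n * (IZR n - 1))%R.
Proof.
  rewrite <- minus_IZR, <- !mult_IZR. f_equal. symmetry. apply Z.div_exact; [lia|].
  rewrite Zmult_mod. assert (H := Z.mod_pos_bound n 2 ltac:(lia)).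
  assert (H1 : (n mod 2 = 0 \/ n mod 2 = 1)%Z) by lia.
  rewrite Zminus_mod. destruct H1 as [-> | ->]; reflexivity.
Qed.

(** Expanding (n + 1/2)^2 / 2 = n (n + 1) / 2 + 1/8 splits off the prefactors. Reflecting n turns n
    (n + 1) / 2 into the exponent of [gam], and the minus sign in the argument cancels the sign of
    [gam]. *)
Lemma theta_jth (e' : R) (tau : C) : (0 < snd tau)%R ->
  theta 1 e' C0 tau = Cexp (tpi * tau / 8) * Cexp ((0, PI * e' / 2)%R : C)
    * jth (nome tau) (- / (Cexp ((0, PI * e')%R : C) : C)).
Proof.
  intros Ht. assert (Hq1 := nome_lt1 tau Ht). assert (Hq0 := nome_nz tau).
  set (u := Cexp ((0, PI * e')%R : C) : C). assert (Hu : u <> 0) by apply Cexp_nz.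
  assert (Hiu : - / u <> 0).
  { intros H. apply C1_nz. replace (RtoC 1) with (- (- / u) * u) by (field; auto). rewrite H. ring. }
  unfold theta. apply Clim_eq.
  apply (hsum_Z_cv (theta_term 1 e' C0 tau)).
  eapply hsum_ext; [|apply hsum_scal, (hsum_reflect _ _ 0 (jth_spec _ Hq0 Hq1 _ Hiu))].
  intros n. cbv beta. replace (0 - n)%Z with (- n)%Z by lia.
  unfold gam. rewrite zpow_m1_opp, (zpow_opp _ n) by auto.
  replace (- / u) with (-(1) * / u) by ring.
  rewrite zpow_mult by (try apply m1_nz; intros H; apply Hiu; rewrite H; ring).
  assert (Hui : zpow (/ u) n = / zpow u n).
  { assert (H := zpow_mult u (/ u) n Hu ltac:(intros H; apply Hiu; rewrite H; ring)).
    replace (u * / u) with (RtoC 1) in H by (field; auto). rewrite zpow_one in H.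
    apply Cinv_unique; auto. apply zpow_nz; auto. }
  rewrite Hui. assert (Hun := zpow_nz u n Hu).
  assert (Hm0 := zpow_nz _ n m1_nz).
  transitivity (Cexp (tpi * tau / 8) * Cexp ((0, PI * e' / 2)%R : C)
    * (zpow (nome tau) (- n * (- n - 1) / 2) * zpow u n) : C).
  { set (X := Cexp (tpi * tau / 8) : C). set (Y := Cexp ((0, PI * e' / 2)%R : C) : C).
    field. auto. }
  unfold nome, u. rewrite <- !Cexp_Z, <- !Cexp_add. unfold theta_term. f_equal.
  assert (H3 := IZR_tri (- n)). rewrite opp_IZR in H3.
  set (m := IZR (- n * (- n - 1) / 2)) in *.
  assert (Em : m = ((IZR n * IZR n + IZR n) / 2)%R) by lra. rewrite Em.
  destruct tau as [x y]. unfold tpi.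
  unfold Cdiv, Cinv, Cadd, Cmul, Defs.RtoC, twopi_i, C0, Cplus, Cmult, RtoC; simpl. f_equal; field.
Qed.

Lemma Cexp_pi3 : Cexp ((0, PI * (1 / 3))%R : C) = 1 + omega :> C.
Proof.
  unfold Cexp, omega; simpl. rewrite exp_0. replace (PI * (1 / 3))%R with (PI / 3)%R by field.
  rewrite cos_PI3, sin_PI3. apply injective_projections; simpl; field.
Qed.

Lemma Cexp_2pi3 : Cexp ((0, PI * (2 / 3))%R : C) = omega :> C.
Proof.
  replace ((0, PI * (2 / 3))%R : C) with (((0, PI * (1 / 3))%R : C) + ((0, PI * (1 / 3))%R : C))
    by (apply injective_projections; simpl; field).
  rewrite Cexp_add, Cexp_pi3. assert (H := omega_sqr). ring [H].
Qed.

Lemma sqrt3_pow4 (z : C) : (sqrt 3 * z) ^ 4 = 9 * z ^ 4.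
Proof.
  rewrite Cpow_mult_l. f_equal. rewrite <- RtoC_pow. f_equal.
  replace (sqrt 3 ^ 4)%R with ((sqrt 3 * sqrt 3) * (sqrt 3 * sqrt 3))%R by ring.
  rewrite sqrt_sqrt by lra. ring.
Qed.

(** The arguments of [jth] are [omega] and - 1 / [omega]. The prefactor [X] cancels in the quotient,
    and the fourth powers of the remaining constants combine to 9 omega^3 / omega^6 = 9. *)
Lemma Wfun_euler (tau : C) : (0 < snd tau)%R -> Wfun tau = Wq (nome tau).
Proof.
  intros Ht. assert (Hq1 := nome_lt1 tau Ht). assert (Hq0 := nome_nz tau).
  set (q := nome tau) in *.
  assert (E1 := euler_nz q Hq1 0). assert (E2 := euler_nz q Hq1 1).
  assert (E3 := euler_nz q Hq1 2). assert (E6 := euler_nz q Hq1 5).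
  assert (Hw := omega_sqr). assert (Hw0 := omega_nz).
  assert (Hw1 : 1 + omega <> 0).
  { intros H. apply (f_equal fst) in H. unfold omega in H. simpl in H. lra. }
  set (X := Cexp (tpi * tau / 8) : C). assert (HX : X <> 0) by apply Cexp_nz.
  set (p := Cexp ((0, PI * (1 / 3) / 2)%R : C) : C).
  assert (Hp : p * p = 1 + omega).
  { unfold p. rewrite <- Cexp_pi3, <- Cexp_add. f_equal.
    apply injective_projections; simpl; field. }
  assert (T1 : (theta 1 (1 / 3) C0 tau : C) = X * p * ((1 - omega) * euler q 3)).
  { rewrite theta_jth by auto. rewrite Cexp_pi3. fold q X p.
    replace (- / (1 + omega)) with omega; [rewrite jth_omega by auto; reflexivity|].
    symmetry. assert (H : (1 + omega) * - omega = 1) by ring [Hw].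
    rewrite <- (Cinv_unique _ _ Hw1 H). ring. }
  assert (T2 : (theta 1 (2 / 3) C0 tau : C)
    = X * (1 + omega) * (- omega * (euler q 1 * euler q 1 * euler q 6 / (euler q 2 * euler q 3)))).
  { rewrite theta_jth by auto. rewrite Cexp_2pi3. fold q X.
    replace ((0, PI * (2 / 3) / 2)%R : C) with ((0, PI * (1 / 3))%R : C)
      by (apply injective_projections; simpl; field).
    rewrite Cexp_pi3.
    assert (Hi0 : / omega <> 0).
    { intros H. apply C1_nz. rewrite <- (Cinv_r omega) by auto. rewrite H. ring. }
    rewrite (jth_neg_root q Hq0 Hq1 (/ omega) Hi0).
    - replace (1 + / omega) with (- omega); [reflexivity|].
      assert (H := omega_inv). replace (/ omega) with (omega + / omega - omega) by ring.
      rewrite H. ring.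
    - replace (/ / omega) with omega by (field; auto).
      rewrite Cplus_comm. apply omega_inv. }
  change (Wfun tau) with ((theta 1 (1 / 3) C0 tau : C) ^ 4 / (theta 1 (2 / 3) C0 tau : C) ^ 4).
  rewrite T1, T2. unfold Wq.
  assert (P4 : p ^ 4 = omega).
  { replace (p ^ 4) with ((p * p) * (p * p)) by ring. rewrite Hp. ring [Hw]. }
  assert (O3 : omega ^ 3 = 1) by ring [Hw].
  assert (N4 : (1 - omega) ^ 4 = 9 * omega ^ 2) by ring [Hw].
  assert (D4 : (1 + omega) ^ 4 = omega ^ 2) by ring [Hw].
  match goal with |- ?a = ?b => change (a = b :> C) end.
  transitivity (p ^ 4 * (1 - omega) ^ 4 / ((1 + omega) ^ 4 * omega ^ 4)
    * (euler q 2 * (euler q 3 * euler q 3) / (euler q 1 * euler q 1 * euler q 6)) ^ 4).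
  - field. repeat split; auto.
  - rewrite P4, N4, D4. f_equal.
    transitivity (9 * omega ^ 3 / (omega ^ 3 * omega ^ 3)); [field; auto|].
    rewrite O3. field.
Qed.

Lemma riccati_euler (tau : C) : (0 < snd tau)%R -> let q := nome tau in
  Wfun tau = (sqrt 3 * ((euler q 2 * euler q 3 ^ 2) / (euler q 1 ^ 2 * euler q 6))) ^ 4 /\
  C_derivable_lim Wfun tau
    (tpi * ((1 / 2 ^ 3)%R * (((euler q 1 ^ 2 * euler q 3 ^ 2) / (euler q 2 * euler q 6)) ^ 2 *
      ((Wfun tau : C) ^ 2 - 10 * Wfun tau + 9)))).
Proof.
  intros Ht q. assert (Hq1 := nome_lt1 tau Ht). assert (Hq0 := nome_nz tau).
  assert (HW := Wfun_euler tau Ht). fold q in Hq1, Hq0, HW. rewrite HW.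
  assert (HP : forall x : C, x ^ 2 = x * x) by (intros x; simpl; ring).
  split.
  - rewrite sqrt3_pow4, !HP. reflexivity.
  - apply cdiff_derivable.
    (* [Wfun] is identified with [Wq] only in the upper half-plane; |h| < Im tau keeps tau + h
       inside it. *)
    apply (cdiff_ext_near (fun t => Wq (nome t)) _ _ _ (snd tau)); auto.
    + intros h Hh. symmetry. apply Wfun_euler. simpl.
      assert (H1 := Rle_trans _ _ _ (Rmax_r _ _) (Rmax_Cmod h)).
      assert (H2 := Rle_abs (- snd h)). rewrite Rabs_Ropp in H2. lra.
    + eapply cdiff_eq; [|apply (cdiff_Wq tau Ht)]. fold q.
      replace (RtoC (1 / 2 ^ 3)) with (1 / 8)
        by (rewrite <- RtoC_div by lra; f_equal; field).
      rewrite !(HP (euler q _)). rewrite <- (Wq_BC q Hq0 Hq1). ring.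
Qed.

Lemma riccati_qpoch (tau : C) : (0 < snd tau)%R -> let q := nome tau in
  Wfun tau = (sqrt 3 * ((qpoch 2 q * (qpoch 3 q : C) ^ 2) / ((qpoch 1 q : C) ^ 2 * qpoch 6 q))) ^ 4 /\
  C_derivable_lim Wfun tau
    (tpi * ((1 / 2 ^ 3)%R * ((((qpoch 1 q : C) ^ 2 * (qpoch 3 q : C) ^ 2)
      / (qpoch 2 q * qpoch 6 q)) ^ 2 * ((Wfun tau : C) ^ 2 - 10 * Wfun tau + 9)))).
Proof.
  intros Ht q. unfold q. assert (Hq1 := nome_lt1 tau Ht).
  rewrite (qpoch_euler _ Hq1 0), (qpoch_euler _ Hq1 1), (qpoch_euler _ Hq1 2),
    (qpoch_euler _ Hq1 5).
  exact (riccati_euler tau Ht).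
Qed.

End Hauptmodul.

Theorem mainTheorem9 (tau : Cplx) (Htau : Im tau > 0) :
  let q := qexp tau in
  Wfun tau =
    Cpow (Cmul (RtoC (sqrt 3))
            (Cdiv (Cmul (qpoch 2 q) (Cpow (qpoch 3 q) 2))
                  (Cmul (Cpow (qpoch 1 q) 2) (qpoch 6 q)))) 4
  /\
  (* q dW/dq = (1/(2 pi i)) dW/dtau, i.e. dW/dtau = 2 pi i * RHS *)
  C_derivable_lim Wfun tau
    (Cmul twopi_i
      (Cmul (RtoC (1 / 2 ^ 3))
        (Cmul
          (Cpow (Cdiv (Cmul (Cpow (qpoch 1 q) 2) (Cpow (qpoch 3 q) 2))
                      (Cmul (qpoch 2 q) (qpoch 6 q))) 2)
          (Cadd (Csub (Cpow (Wfun tau) 2) (Cmul (RtoC 10) (Wfun tau)))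
                (RtoC 9))))).
Proof.
  assert (H := Hauptmodul.riccati_qpoch tau Htau).
  unfold Hauptmodul.nome in H. unfold Cminus, Complex.Cdiv in H.
  (* Rewriting, since the kernel's conversion check would unfold the powers. *)
  rewrite (eq_refl : Hauptmodul.tpi = twopi_i), (eq_refl : Cmult = Cmul),
    (eq_refl : Cplus = Cadd), (eq_refl : Complex.Copp = Copp),
    (eq_refl : Complex.Cinv = Cinv), (eq_refl : Complex.Cpow = Cpow),
    (eq_refl : Complex.RtoC = RtoC) in H.
  unfold qexp, Csub, Cdiv. exact H.
Qed.
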